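(* Let $(\bar{\mathcal N}^l_t)_{t\ge0}$, $l\in\{1,2\}$, be exponentially $\alpha$-mixing point processes such that the distribution of $(\bar{\mathcal N}^l_{t+t_k}-\bar{\mathcal N}^l_{t+t_{k-1}})_{1\le k\le K,\ l=1,2}$ does not depend on $t\ge0$ for any $K\in\mathbb N$ and $0\le t_0<t_1<\dots<t_K$. Let the observation times be generated by $\mathcal N^{n,l}_t=\bar{\mathcal N}^l_{h_n^{-1}t}$ for $0\le t<T_n$ and $l\in\{1,2\}$, with final observation time $T_n$. Assume that for every $q>0$: (B1-$q$) $\displaystyle\sup_{n\ge1}\max_{l\in\{1,2\}}\sup_{0\le t\le(n-1)h_n}E[(\mathcal N^{n,l}_{t+h_n}-\mathcal N^{n,l}_t)^q]<\infty$; (B2-$q$) $\displaystyle\limsup_{u\to\infty}\sup_{n\ge1}\max_{l\in\{1,2\}}\sup_{0\le t\le nh_n-uh_n}u^qP(\mathcal N^{n,l}_{t+uh_n}-\mathcal N^{n,l}_t=0)<\infty$. Then the following hold: (A2) $r_n\to0$ in probability; (A4) there exist positive constants $a_0^1,a_0^2$ such that, for $l\in\{1,2\}$ and any $(s_k)\in\mathfrak S$, $\{h_nM_{l,q_n+1}\}_{n\ge1}$ is tight and $\max_{1\le k\le q_n}|h_nM_{l,k}-a_0^l(s_k-s_{k-1})|\to0$ in probability; and for any $p\in\mathbb N$ there exists a nonnegative constant $a_p^1$ such that $\max_{1\le k\le q_n}|h_n\mathrm{tr}(\mathcal E^1_{(k)}(GG^\top)^p)-a_p^1(s_k-s_{k-1})|\to0$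 in probability for any $(s_k)\in\mathfrak S$; (A5) for each $p\in\mathbb Z_+$ there exist nonnegative constants $f_p^{1,1},f_p^{1,2},f_p^{2,2}$ such that, for any $(s_k)\in\mathfrak S$, in probability, $\max_{1\le k\le q_n}|\mathfrak I_1^\top\mathcal E^1_{(k)}(GG^\top)^p\mathfrak I_1-f_p^{1,1}(s_k-s_{k-1})|\to0$, $\max_{1\le k\le q_n}|\mathfrak I_1^\top\mathcal E^1_{(k)}(GG^\top)^pG\mathfrak I_2-f_p^{1,2}(s_k-s_{k-1})|\to0$ and $\max_{1\le k\le q_n}|\mathfrak I_2^\top\mathcal E^2_{(k)}(G^\top G)^p\mathfrak I_2-f_p^{2,2}(s_k-s_{k-1})|\to0$; and $a_1^1>0$.
   Context: $(h_n)_{n\ge1}$ are positive numbers with $h_n\to0$, $T_n:=nh_n\to\infty$, $nh_n^2\to0$. For each $n$ and $l\in\{1,2\}$, $0=S^{n,l}_0<S^{n,l}_1<\dots<S^{n,l}_{M_l}=T_n$ are random observation times and $\mathcal N^{n,l}_t=\sum_{i=1}^{M_l}1_{\{S_i^{n,l}\le t\}}$. A point process here is identified with its counting process, which has unit jumps and starts at $0$. Exponentially $\alpha$-mixing means: there are $c_1,c_2>0$ with $|P(A\cap B)-P(A)P(B)|\le c_1e^{-c_2k}$ for all $u,k\ge0$, $A\in\sigma(\bar{\mathcal N}^l_t-\bar{\mathcal N}^l_s;0\le s<t\le u,l=1,2)$ and $B\in\sigma(\bar{\mathcal N}^l_t-\bar{\mathcal N}^l_s;u+k\le s<t,l=1,2)$.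 $I_i^l=(S^{n,l}_{i-1},S_i^{n,l}]$, $|\cdot|$ is interval length, $r_n=\max_{i,l}|I_i^l|$, $\mathfrak I_l=(|I_i^l|^{1/2})_{i=1}^{M_l}$ (column vector). $G$ is the $M_1\times M_2$ matrix $[G]_{ij}=|I_i^1\cap I_j^2|/(|I_i^1|^{1/2}|I_j^2|^{1/2})$. $\mathfrak S$ is the set of partitions $0=s_0<s_1<\cdots$ of $[0,\infty)$ with $\sup_{k\ge1}|s_k-s_{k-1}|\le1$ and $\inf_{k\ge1}|s_k-s_{k-1}|>0$. For $(s_k)\in\mathfrak S$: $q_n=\max\{k:s_k\le nh_n\}$, $M_{l,k}=\#\{i:\sup I_i^l\in(s_{k-1},s_k]\}$, and $\mathcal E^l_{(k)}$ is the $M_l\times M_l$ diagonal matrix with $i$th diagonal entry $1$ if $\sup I_i^l\in(s_{k-1},s_k]$ and $0$ otherwise. $\mathbb Z_+=\{0,1,2,\dots\}$, $\mathbb N=\{1,2,\dots\}$. *)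

(* Defs.v *)
From HB Require Import structures.
From mathcomp Require Import all_boot all_order all_algebra.
From mathcomp Require Import all_classical all_reals all_analysis.

Set Implicit Arguments.
Unset Strict Implicit.
Unset Printing Implicit Defensive.

Import Order.TTheory GRing.Theory Num.Theory.
Import numFieldNormedType.Exports.

Local Open Scope classical_set_scope.
Local Open Scope ring_scope.

(* The index l in {1, 2} is an element of 'I_2; [ix1] and [ix2] are its
   values. *)
Definition ix1 : 'I_2 := ord0.
Definition ix2 : 'I_2 := ord_max.

(* Counting paths are nondecreasing, so truncated subtraction on nat is the
   true increment. *)
Definition incr {R : realType} {T : Type} (N : R -> T -> nat) (s t : R)
  (w : T) : nat := (N t w - N s w)%N.

Section PointProcesses.
Context {d : measure_display} {T : measurableType d} {R : realType}.
Variable P : probability T R.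

(* Only times t >= 0 are meaningful. As N is nat-valued and nondecreasing, its
   left limit at t is the value it takes just before t, so the last clause
   bounds the jump at t by 1. *)
Definition counting_path (N : R -> nat) : Prop :=
  [/\ N 0 = 0%N,
      forall s t : R, 0 <= s -> s <= t -> (N s <= N t)%N,
      forall t : R, 0 <= t -> N x @[x --> t^'+] --> N t
    & forall t : R, 0 < t -> \forall x \near t^'-, (N t <= (N x).+1)%N].

Definition point_process (N : R -> T -> nat) : Prop :=
  (forall t : R, 0 <= t -> measurable_fun [set: T] (N t)) /\
  (forall w, counting_path (N ^~ w)).

(* sigma(N^l_t - N^l_s ; l = 1, 2, s < t, D s t) *)
Definition sigma_incr (N : 'I_2 -> R -> T -> nat) (D : R -> R -> Prop) :
    set (set T) :=
  <<s [set A | exists l s t (B : set nat),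
         [/\ s < t, D s t & A = incr (N l) s t @^-1` B] ] >>.

Definition exp_alpha_mixing (N : 'I_2 -> R -> T -> nat) : Prop :=
  exists c1 c2 : R, [/\ 0 < c1, 0 < c2 &
    forall (u k : R) (A B : set T), 0 <= u -> 0 <= k ->
      sigma_incr N (fun s t => 0 <= s /\ t <= u) A ->
      sigma_incr N (fun s t => u + k <= s) B ->
      (`| P (A `&` B) - P A * P B | <= (c1 * expR (- c2 * k))%:E)%E].

(* The increment vector takes values in the countable discrete space
   'I_2 -> 'I_K -> nat, all of whose subsets B are measurable. *)
Definition stationary_increments (N : 'I_2 -> R -> T -> nat) : Prop :=
  forall (K : nat) (tau : nat -> R), (1 <= K)%N -> 0 <= tau 0%N ->
    (forall k, (k < K)%N -> tau k < tau k.+1) ->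
    forall (B : set ('I_2 -> 'I_K -> nat)) (t t' : R), 0 <= t -> 0 <= t' ->
      let X (x : R) (w : T) := fun (l : 'I_2) (k : 'I_K) =>
        incr (N l) (x + tau k) (x + tau k.+1) w in
      P (X t @^-1` B) = P (X t' @^-1` B).

Definition cvg_in_prob (X : nat -> T -> R) (x : R) : Prop :=
  forall eps : R, 0 < eps ->
    P [set w | eps < `|X n w - x|] @[n --> \oo] --> 0%E.

Definition tight (X : nat -> T -> R) : Prop :=
  forall eps : R, 0 < eps -> exists K : R, forall n, (1 <= n)%N ->
    (P [set w | (K < `|X n w|)%R] <= eps%:E)%E.

End PointProcesses.

Definition len {R : realType} (A : set R) : R := fine (lebesgue_measure A).

(* One realization of the two observation grids: t l 0 < ... < t l (m l) are
   the observation times of the l-th component. The intervals are indexed from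
   0: [obs_itv t l i] is the (i+1)-st interval. *)
Section Grids.
Context {R : realType}.
Variables (m : 'I_2 -> nat) (t : 'I_2 -> nat -> R).

Definition obs_itv (l : 'I_2) (i : nat) : set R :=
  [set x | t l i < x <= t l i.+1].

Definition obs_count (l : 'I_2) (x : R) : nat :=
  #|[set i : 'I_(m l) | t l i.+1 <= x]%SET|.

Definition mesh : R :=
  \big[Num.max/0]_(l < 2) \big[Num.max/0]_(i < m l) len (obs_itv l i).

Definition sqrt_len (l : 'I_2) : 'cV[R]_(m l) :=
  \col_i Num.sqrt (len (obs_itv l i)).

Definition Gmx : 'M[R]_(m ix1, m ix2) :=
  \matrix_(i, j) (len (obs_itv ix1 i `&` obs_itv ix2 j)
    / (Num.sqrt (len (obs_itv ix1 i)) * Num.sqrt (len (obs_itv ix2 j)))).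

Definition in_block (a b : R) (l : 'I_2) (i : nat) : bool :=
  a < sup (obs_itv l i) <= b.

Definition block_count (l : 'I_2) (a b : R) : nat :=
  #|[set i : 'I_(m l) | in_block a b l i]%SET|.

Definition block_proj (l : 'I_2) (a b : R) : 'M[R]_(m l) :=
  diag_mx (\row_i (if in_block a b l i then 1 else 0)).

Definition block_trace (p : nat) (a b : R) : R :=
  \tr (block_proj ix1 a b *m (Gmx *m Gmx^T) ^+ p).

Definition block_form11 (p : nat) (a b : R) : R :=
  ((sqrt_len ix1)^T *m block_proj ix1 a b *m (Gmx *m Gmx^T) ^+ p
     *m sqrt_len ix1) 0 0.

Definition block_form12 (p : nat) (a b : R) : R :=
  ((sqrt_len ix1)^T *m block_proj ix1 a b *m (Gmx *m Gmx^T) ^+ p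
     *m Gmx *m sqrt_len ix2) 0 0.

Definition block_form22 (p : nat) (a b : R) : R :=
  ((sqrt_len ix2)^T *m block_proj ix2 a b *m (Gmx^T *m Gmx) ^+ p
     *m sqrt_len ix2) 0 0.

End Grids.

Section Partitions.
Context {R : realType}.

Definition frakS (s : nat -> R) : Prop :=
  [/\ s 0%N = 0,
      forall k, s k < s k.+1,
      (ereal_sup [set `|s k - s k.-1|%:E | k in [set k | (1 <= k)%N]] <= 1)%E
    & (0 < ereal_inf [set `|s k - s k.-1|%:E | k in [set k | (1 <= k)%N]])%E].

Definition horizon (h : nat -> R) (n : nat) : R := n%:R * h n.

(* max {k | s k <= x}; the maximum exists for s in [frakS] and x >= 0 *)
Definition last_index (s : nat -> R) (x : R) : nat :=
  xget 0%N [set k | s k <= x /\ forall j, s j <= x -> (j <= k)%N].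

(* max_{1 <= k <= q} |F(s_{k-1}, s_k) - c (s_k - s_{k-1})| *)
Definition block_dev (s : nat -> R) (q : nat) (F : R -> R -> R) (c : R) : R :=
  \big[Num.max/0]_(1 <= k < q.+1)
     `|F (s k.-1) (s k) - c * (s k - s k.-1)|.

End Partitions.

Section Sampling.
Context {d : measure_display} {T : measurableType d} {R : realType}.
Variables (P : probability T R) (h : nat -> R).
Variables (M : nat -> 'I_2 -> T -> nat) (S_ : nat -> 'I_2 -> nat -> T -> R).

(* The i-th observation time S_ n l i only exists where i <= M n l; its values
   elsewhere are irrelevant. *)
Definition random_grids : Prop :=
  forall n, (1 <= n)%N -> forall l,
  [/\ measurable_fun [set: T] (M n l),
      forall i, measurable_fun [set w | (i <= M n l w)%N] (S_ n l i)
    & forall w, [/\ S_ n l 0%N w = 0,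
        forall i, (i < M n l w)%N -> S_ n l i w < S_ n l i.+1 w
      & S_ n l (M n l w) w = horizon h n]].

Definition grid_size (n : nat) (w : T) : 'I_2 -> nat := fun l => M n l w.
Definition grid (n : nat) (w : T) : 'I_2 -> nat -> R := fun l i => S_ n l i w.

Definition obs_process (n : nat) (l : 'I_2) (x : R) (w : T) : nat :=
  obs_count (grid_size n w) (grid n w) l x.

(* At the final time T_n the two sides may differ, T_n being always an
   observation time. *)
Definition generated_by (barN : 'I_2 -> R -> T -> nat) : Prop :=
  forall n, (1 <= n)%N -> forall l x w, 0 <= x -> x < horizon h n ->
    obs_process n l x w = barN l ((h n)^-1 * x) w.

Definition condB1 (q : R) : Prop :=
  let moments : set (\bar R) := [set y | exists n l (x : R),
    [/\ (1 <= n)%N, 0 <= x <= (n%:R - 1) * h n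
      & y = ('E_P[fun w =>
          ((incr (obs_process n l) x (x + h n) w)%:R `^ q)%R])%E]] in
  (ereal_sup moments < +oo)%E.

Definition condB2 (q : R) : Prop :=
  let voids (u : R) : set (\bar R) := [set y | exists n l (x : R),
    [/\ (1 <= n)%N, 0 <= x <= n%:R * h n - u * h n
      & y = ((u `^ q)%:E *
          P [set w | incr (obs_process n l) x (x + u * h n) w = 0%N])%E]] in
  (limf_esup (fun u => ereal_sup (voids u)) (pinfty_nbhs R) < +oo)%E.

Definition condA2 : Prop :=
  cvg_in_prob P (fun n w => mesh (grid_size n w) (grid n w)) 0.

Definition qn (s : nat -> R) (n : nat) : nat := last_index s (horizon h n).

(* For a block functional F, the sequence (indexed by n) of random variables
   max_{1 <= k <= q_n} |F_k - c (s_k - s_{k-1})| tends to 0 in probability. *)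
Definition blocks_cvg (s : nat -> R)
    (F : nat -> forall (m : 'I_2 -> nat), ('I_2 -> nat -> R) -> R -> R -> R)
    (c : R) : Prop :=
  cvg_in_prob P (fun n w =>
    block_dev s (qn s n) (F n (grid_size n w) (grid n w)) c) 0.

(* a0 l is a_0^l and a p is a_p^1 for p >= 1; a 0 is not used *)
Definition condA4 (a0 : 'I_2 -> R) (a : nat -> R) : Prop :=
  (forall l, 0 < a0 l) /\
  (forall l s, frakS s ->
     tight P (fun n w => h n *
       (block_count (grid_size n w) (grid n w) l
          (s (qn s n)) (s (qn s n).+1))%:R) /\
     blocks_cvg s
       (fun n m t x y => h n * (block_count m t l x y)%:R) (a0 l)) /\
  (forall p, (1 <= p)%N -> 0 <= a p /\
     forall s, frakS s ->
       blocks_cvg s (fun n m t x y => h n * block_trace m t p x y) (a p)).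

Definition condA5 (f11 f12 f22 : nat -> R) : Prop :=
  forall p, [/\ 0 <= f11 p, 0 <= f12 p, 0 <= f22 p &
    forall s, frakS s ->
    [/\ blocks_cvg s (fun n m t => block_form11 m t p) (f11 p),
        blocks_cvg s (fun n m t => block_form12 m t p) (f12 p)
      & blocks_cvg s (fun n m t => block_form22 m t p) (f22 p)]].

End Sampling.

(* Main.v *)
Require Import Defs.
From mathcomp Require Import all_boot all_order all_algebra.
From mathcomp Require Import all_classical all_reals all_analysis.
From mathcomp Require Import measurable_realfun.
From mathcomp Require Import zify ring lra.

(**
Measure time in the units of the point process, so that the horizon is [n] and
a block of length of order one becomes a window of length of order [1 / h n].
The windows are compared with cells of a fixed integer length [b].

Counts and traces are additive over cells up to a bounded error per cell. For
counts this is clear. For traces, sample time on a grid of step [1 / (r + 1)]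
and label a sample point by the number of observations that precede it, once
for each component. The overlap matrix of the sampled intervals is the product
of two factors, and carrying one factor around the trace turns the [p]-th power
of G G^T into the power of a product of two averaging kernels: averages over the
classes of the first labeling and over the classes of the second
([trace_sampled_G]). These kernels are stochastic, and the share of a single
class in such a trace is at most one ([trace_class_le1]). Cutting both labelings
at a point splits one class of each, and therefore changes the trace by at most
[4 p], wherever the point is ([trace_loop_cut]). Cutting at all the cell
boundaries makes the trace over a window the sum of the traces over the cells
([block_cells], [trace_vs_cells]). No locality of the powers of G G^T enters:
long gaps between the observations do no harm. Since the sampled matrices tend
to G entrywise as the step tends to zero, the estimates pass to G G^T
([sampled_block_cvg], [prob_dev_small]).

The trace over a cell is at most one plus the number of points in the cell, and
it is a function of the increments in the cell. Its integer parts are therefore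
stationary, mixing, and have tails as light as the moments of the increments
permit. For integer valued variables a covariance is a double sum of differences
P(X > i, Y > k) - P(X > i) P(Y > k); each is bounded by both tails and by the
mixing rate, hence by the product of the three cube roots, which is summable
([second_moment_le]). The variance of the sum over [J] cells is then of order
[J], and Chebyshev's inequality bounds by a multiple of [h n] the probability
that a window deviates from its mean ([window_sum_concentration],
[window_deviation]). There are at most of order [n * h n] blocks, so that some
block deviates with probability of order [n * h n ^ 2], which tends to zero
([blocks_cvg_of_windows]).

Additivity up to bounded errors also gives the means: the mean per unit of time
over cells of lengths [b] and [b'] differs by a multiple of [1 / b + 1 / b'],
uniformly in [r] ([cell_mean_ratio]). Any cluster point of these densities is
thus the constant that belongs to the trace ([mean_density_cluster],
[trace_window]). For [p = 1] it is positive. With probability at least one half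
a stretch of time of suitable length has few points of both components and is
flanked by stretches with points of both; the classes are then short, a
positive fraction of the stretch lies in a common class, and the trace over the
stretch is bounded below ([good_window_ge], [mean_density_lower]).

The quadratic forms need no probability: each grid partitions [0, T], so that G
maps the vector of square roots of the lengths of one grid to that of the other
([Gmx_sqrt_len]). The forms are sums of lengths of the intervals that end in a
block; they differ from the length of the block by at most the mesh, and all the
constants are one ([forms_cvg]). The mesh is small since a long gap contains a
whole empty cell, and by stationarity and the bound on void probabilities some
cell is empty with probability of order [n * h n ^ 2] ([mesh_cvg]).
*)

Import Order.TTheory GRing.Theory Num.Theory.
Import numFieldNormedType.Exports.

Set Implicit Arguments.
Unset Strict Implicit.
Unset Printing Implicit Defensive.

Local Open Scope classical_set_scope.
Local Open Scope ring_scope.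

(** * Averaging kernels of a labeling and the effect of a cut *)

Section Kernels.
Context {R : realFieldType}.
Implicit Types (m : nat) (f g : nat -> nat).

Definition class_size m f (v : nat) : nat := #|[set y : 'I_m | f y == v]%SET|.

Definition avg m f : 'M[R]_m :=
  \matrix_(x, y) ((f x == f y)%:R / (class_size m f (f x))%:R).

Definition sel m (E : pred nat) : 'M[R]_m := diag_mx (\row_x (E x)%:R).

Definition substoch m (Q : 'M[R]_m) : Prop :=
  (forall x y, 0 <= Q x y) /\ (forall x, \sum_y Q x y <= 1).

Lemma class_size_gt0 m f (x : 'I_m) : (0 < class_size m f (f x))%N.
Proof. by apply/card_gt0P; exists x; rewrite inE. Qed.

Lemma sum_class m f v : \sum_(y < m) (f y == v)%:R = (class_size m f v)%:R :> R.
Proof.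
rewrite /class_size -sum1_card natr_sum [RHS]big_mkcond /=.
by apply: eq_bigr => y _; rewrite inE; case: (f y == v).
Qed.

Lemma avg_ge0 m f x y : 0 <= avg m f x y.
Proof. by rewrite mxE divr_ge0 ?ler0n. Qed.

Lemma avg_row m f x : \sum_y avg m f x y = 1.
Proof.
under eq_bigr do rewrite mxE eq_sym.
by rewrite -mulr_suml sum_class divff // pnatr_eq0 -lt0n class_size_gt0.
Qed.

Lemma eq_avg m f g : (forall x, (x < m)%N -> f x = g x) -> avg m f = avg m g.
Proof.
move=> fg; apply/matrixP => x y; rewrite !mxE !fg //; congr (_ / _%:R).
by apply: eq_card => z; rewrite !inE fg.
Qed.

Lemma substoch_avg m f : substoch (avg m f).
Proof. by split=> [x y|x]; rewrite ?avg_ge0 ?avg_row. Qed.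

Lemma substochM m (A B : 'M[R]_m) :
  substoch A -> substoch B -> substoch (A *m B).
Proof.
move=> [A0 A1] [B0 B1]; split=> [x y|x].
  by rewrite mxE sumr_ge0 // => z _; rewrite mulr_ge0.
under eq_bigr do rewrite mxE.
rewrite exchange_big /=; apply: le_trans (A1 x); apply: ler_sum => z _.
by rewrite -mulr_sumr ler_piMr.
Qed.

Lemma substoch1 m : substoch (1%:M : 'M[R]_m).
Proof.
split=> [x y|x]; first by rewrite mxE ler0n.
rewrite (bigD1 x) //= big1 ?mxE ?eqxx ?addr0 // => y yx.
by rewrite mxE eq_sym (negPf yx).
Qed.

Lemma substochX m (A : 'M[R]_m) p : substoch A -> substoch (A ^+ p).
Proof.
move=> sA; elim: p => [|p IH]; first exact: substoch1.
by rewrite exprS; apply: substochM.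
Qed.

Lemma substoch_sel m E : substoch (sel m E).
Proof.
split=> [x y|x]; first by rewrite !mxE mulrn_wge0 // ler0n.
rewrite (bigD1 x) //= big1 => [|y yx]; rewrite !mxE.
  by rewrite eqxx addr0 lern1 leq_b1.
by rewrite eq_sym (negPf yx).
Qed.

Lemma mxtrace_sel m E (Q : 'M[R]_m) :
  \tr (sel m E *m Q) = \sum_(x < m | E x) Q x x.
Proof.
rewrite /mxtrace [RHS]big_mkcond /=; apply: eq_bigr => x _.
rewrite mul_diag_mx !mxE; case: (E x); by rewrite (mul1r, mul0r).
Qed.

(** A single class is averaged onto one probability vector, so that its share
of the trace is at most one row sum. *)
Lemma trace_class_le1 m f (Q : 'M[R]_m) v : substoch Q ->
  0 <= \sum_(x < m | f x == v) (avg m f *m Q) x x <= 1.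
Proof.
move=> [Q0 Q1]; apply/andP; split.
  by apply: sumr_ge0 => x _; rewrite mxE sumr_ge0 // => y _; rewrite mulr_ge0 ?avg_ge0.
have -> : \sum_(x < m | f x == v) (avg m f *m Q) x x =
   \sum_(y < m | f y == v) (class_size m f v)%:R^-1 * \sum_(x < m | f x == v) Q y x.
  under [RHS]eq_bigr do rewrite mulr_sumr.
  rewrite exchange_big /=; apply: eq_bigr => x /eqP fx.
  rewrite mxE [RHS]big_mkcond /=; apply: eq_bigr => y _.
  by rewrite mxE fx [v == _]eq_sym; case: (f y == v); rewrite ?mul1r ?mul0r.
apply: (@le_trans _ _ (\sum_(y < m | f y == v) (class_size m f v)%:R^-1)).
  apply: ler_sum => y _; rewrite ler_piMr ?invr_ge0 ?ler0n //.
  apply: le_trans (Q1 y); rewrite [X in X <= _]big_mkcond /=.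
  by apply: ler_sum => x _; case: ifP.
rewrite big_mkcond /= (eq_bigr (fun y : 'I_m => (f y == v)%:R * (class_size m f v)%:R^-1)).
  rewrite -mulr_suml sum_class; have [->|c0] := posnP (class_size m f v).
    by rewrite mul0r ler01.
  by rewrite divff // pnatr_eq0 -lt0n.
by move=> y _; case: ifP; rewrite ?mul1r ?mul0r.
Qed.

Lemma diag_avg_ge0 m f (Q : 'M[R]_m) x : substoch Q -> 0 <= (avg m f *m Q) x x.
Proof.
by move=> [Q0 _]; rewrite mxE sumr_ge0 // => y _; rewrite mulr_ge0 ?avg_ge0.
Qed.

(** A set of points carrying [K] labels lies in [K] classes, and each of them
contributes at most one. *)
Lemma trace_labels_le m f (Q : 'M[R]_m) (D : pred nat) v K : substoch Q ->
  (forall x, (x < m)%N -> D x -> (v <= f x < v + K)%N) ->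
  0 <= \sum_(x < m | D x) (avg m f *m Q) x x <= K%:R.
Proof.
move=> sQ; rewrite sumr_ge0 => [|x _]; last exact: diag_avg_ge0.
elim: K D => [|K IH] D DK /=.
  by rewrite big1 // => x /DK; rewrite ltn_ord addn0 => /(_ isT); lia.
rewrite (bigID (fun x : 'I_m => f x == v + K)%N) /= -natr1 addrC lerD //.
  apply: (IH (fun x => D x && (f x != v + K)%N)) => x xm /andP[Dx fx].
  by move: (DK x xm Dx); lia.
have /andP[_] := trace_class_le1 f (v + K)%N sQ; apply: le_trans.
rewrite [X in _ <= X](bigID (fun x : 'I_m => D x)) /= [X in _ <= X + _](eq_bigl (fun x : 'I_m => D x && (f x == v + K)%N)); last by move=> x; rewrite andbC.
by rewrite lerDl sumr_ge0 // => x _; exact: diag_avg_ge0.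
Qed.

Lemma mxtrace_avg_class m f (Q : 'M[R]_m) v (B : pred nat) : (forall x, (x < m)%N -> B x -> f x == v) ->
  substoch Q -> 0 <= \sum_(x < m | B x) (avg m f *m Q) x x <= 1.
Proof.
move=> Bv sQ; apply: (@trace_labels_le m f Q B v 1) => // x xm /Bv.
by move=> /(_ xm) /eqP ->; rewrite addn1 leqnn ltnSn.
Qed.

Definition cut f (c x : nat) : nat := (f x + (c <= x))%N.

(** Only the class of [c] is split, and each of the two new classes, like the old
one, contributes a number between 0 and 1 to the trace. *)
Lemma trace_cut m f c (Q : 'M[R]_m) : {homo f : x y / (x <= y)%N} -> substoch Q ->
  `|\tr (Q *m (avg m f - avg m (cut f c)))| <= 2.
Proof.
move=> fm sQ; set f' := cut f c.
have trE (h : nat -> nat) : \tr (Q *m avg m h) = \sum_(x < m) (avg m h *m Q) x x.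
  by rewrite mxtrace_mulC.
rewrite mulmxBr raddfB /= !trE.
rewrite (bigID (fun x : 'I_m => f x == f c)) /= [X in _ - X](bigID (fun x : 'I_m => f x == f c)) /=.
have offE : \sum_(x < m | f x != f c) (avg m f *m Q) x x = \sum_(x < m | f x != f c) (avg m f' *m Q) x x.
  apply: eq_bigr => x fxc; rewrite !mxE; apply: eq_bigr => y _; congr (_ * _).
  have eqf (z : nat) : (f' z == f' x) = (f z == f x).
    rewrite /f' /cut.
    have := fm c x; have := fm x c; have := fm c z; have := fm z c.
    have := fm x z; have := fm z x; lia.
  rewrite !mxE [f' x == _]eq_sym [f x == _]eq_sym eqf; congr (_ / _%:R).
  by apply: eq_card => z; rewrite !inE eqf.
rewrite offE opprD addrACA subrr addr0.
have /andP[a0 a1] := @mxtrace_avg_class m f Q (f c) (fun x => f x == f c) (fun x _ => id) sQ.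
rewrite [X in `|_ - X|](bigID (fun x : 'I_m => (c <= x)%N)) /=.
have /andP[b0 b1] := @mxtrace_avg_class m f' Q (f c).+1 (fun x => (f x == f c) && (c <= x)%N)
  (fun x _ H => ltac:(rewrite /f' /cut; lia)) sQ.
have /andP[c0 c1] := @mxtrace_avg_class m f' Q (f c) (fun x => (f x == f c) && ~~ (c <= x)%N)
  (fun x _ H => ltac:(rewrite /f' /cut; lia)) sQ.
by rewrite ler_norml; apply/andP; split; lra.
Qed.

Definition loop m p f g : 'M[R]_m := (avg m f *m avg m g) ^+ p.

Lemma eq_loop m p f f' g g' :
  (forall x, (x < m)%N -> f x = f' x) -> (forall x, (x < m)%N -> g x = g' x) ->
  loop m p f g = loop m p f' g'.
Proof. by move=> ff gg; rewrite /loop (eq_avg ff) (eq_avg gg). Qed.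

Lemma substoch_loop m p f g : substoch (loop m p f g).
Proof. by apply: substochX; apply: substochM; apply: substoch_avg. Qed.

Lemma loopS m p f g : loop m p.+1 f g = avg m f *m (avg m g *m loop m p f g).
Proof. by rewrite /loop exprS mulmxA. Qed.

(** The [2 p] kernels are replaced one at a time; by cyclicity of the trace each
replacement is one application of [trace_cut]. *)
Lemma trace_loop_cut m p f g c (Q : 'M[R]_m) :
  {homo f : x y / (x <= y)%N} -> {homo g : x y / (x <= y)%N} -> substoch Q ->
  `|\tr (Q *m (loop m p f g - loop m p (cut f c) (cut g c)))| <= (4 * p)%:R.
Proof.
move=> fm gm; elim: p Q => [|p IH] Q sQ.
  by rewrite subrr mulmx0 mxtrace0 normr0.
set A := avg m f; set B := avg m g; set A' := avg m (cut f c); set B' := avg m (cut g c).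
have sA := substoch_avg m f; have sA' := substoch_avg m (cut f c).
have sB := substoch_avg m g; have sB' := substoch_avg m (cut g c).
pose L := loop m p f g; pose L' := loop m p (cut f c) (cut g c).
have LS : loop m p.+1 f g = L *m (A *m B) by rewrite /loop exprSr.
have LS' : loop m p.+1 (cut f c) (cut g c) = L' *m (A' *m B') by rewrite /loop exprSr.
have -> : Q *m (loop m p.+1 f g - loop m p.+1 (cut f c) (cut g c)) =
    Q *m L *m A *m (B - B') + Q *m L *m (A - A') *m B' + Q *m (L - L') *m (A' *m B').
  by rewrite LS LS' !(mulmxBr, mulmxBl) !mulmxA !addrA !subrK.
rewrite !mxtraceD.
have -> : (4 * p.+1)%:R = 2 + 2 + (4 * p)%:R :> R by rewrite mulnS natrD; congr (_ + _); ring.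
have sQL : substoch (Q *m L) by apply: substochM sQ (substoch_loop _ _ _ _).
have d1 : `|\tr (Q *m L *m A *m (B - B'))| <= 2.
  by apply: trace_cut => //; apply: substochM.
have d2 : `|\tr (Q *m L *m (A - A') *m B')| <= 2.
  by rewrite mxtrace_mulC mulmxA; apply: trace_cut => //; apply: substochM.
have d3 : `|\tr (Q *m (L - L') *m (A' *m B'))| <= (4 * p)%:R.
  by rewrite mxtrace_mulC mulmxA; apply: IH; apply: substochM => //; apply: substochM.
apply: le_trans (ler_normD _ _) _; apply: lerD => //.
by apply: le_trans (ler_normD _ _) _; apply: lerD.
Qed.

(** Adding the number of cut points passed to a nondecreasing labeling splits the
classes that straddle one of them and leaves the other classes alone. *)
Definition cuts f (cs : seq nat) (x : nat) : nat := (f x + count (fun c => c <= x)%N cs)%N.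

Lemma cuts_homo f cs : {homo f : x y / (x <= y)%N} -> {homo cuts f cs : x y / (x <= y)%N}.
Proof.
move=> fm x y xy; rewrite /cuts leq_add ?fm // sub_count // => c /= cx; lia.
Qed.

Lemma trace_loop_cuts m p f g cs (Q : 'M[R]_m) :
  {homo f : x y / (x <= y)%N} -> {homo g : x y / (x <= y)%N} -> substoch Q ->
  `|\tr (Q *m (loop m p f g - loop m p (cuts f cs) (cuts g cs)))| <= (4 * p * size cs)%:R.
Proof.
move=> fm gm sQ; elim: cs => [|c cs IH].
  have -> : loop m p (cuts f [::]) (cuts g [::]) = loop m p f g.
    by apply: eq_loop => x _; rewrite /cuts addn0.
  by rewrite subrr mulmx0 mxtrace0 normr0.
have -> : loop m p (cuts f (c :: cs)) (cuts g (c :: cs)) =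
    loop m p (cut (cuts f cs) c) (cut (cuts g cs) c).
  by apply: eq_loop => x _; rewrite /cuts /cut /=; lia.
set L1 := loop m p f g; set L2 := loop m p (cuts f cs) (cuts g cs); set L3 := loop _ _ _ _.
rewrite -(subrK L2 L1) -addrA mulmxDr mxtraceD /=.
rewrite /= mulnS addnC natrD; apply: le_trans (ler_normD _ _) _; apply: lerD => //.
by apply: trace_loop_cut => //; apply: cuts_homo.
Qed.

(** If the window [s, s + k) is a union of classes of both labelings, the
trace over it only sees the window. *)
Lemma trace_closed_classes m k s p f g fw gw :
  (s + k <= m)%N ->
  (forall x y, (s <= x < s + k)%N -> f x = f y -> (s <= y < s + k)%N) ->
  (forall x y, (s <= x < s + k)%N -> g x = g y -> (s <= y < s + k)%N) ->
  (forall x y, (x < k)%N -> (y < k)%N -> (f (s + x)%N == f (s + y)%N) = (fw x == fw y)) ->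
  (forall x y, (x < k)%N -> (y < k)%N -> (g (s + x)%N == g (s + y)%N) = (gw x == gw y)) ->
  \tr (sel m (fun x => s <= x < s + k)%N *m loop m p f g) = \tr (loop k p fw gw).
Proof.
move=> skm fc gc ff gg.
have bnd (y : 'I_k) : (s + y < m)%N by apply: leq_trans skm; rewrite ltn_add2l.
pose io (y : 'I_k) : 'I_m := Ordinal (bnd y).
(* [J] embeds the window; it intertwines the kernels of [m] and of [k] points. *)
pose J : 'M[R]_(m, k) := \matrix_(x, y) (x == io y)%:R.
have io_inj : injective io by move=> y z /(congr1 val) /= /addnI /val_inj.
have JE n (A : 'M[R]_(n, m)) (x : 'I_n) y : (A *m J) x y = A x (io y).
  rewrite mxE (bigD1 (io y)) //= big1 ?addr0 ?mxE ?eqxx ?mulr1 // => z /negPf zy.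
  by rewrite mxE zy mulr0.
have inw (x : 'I_m) : (s <= x < s + k)%N -> exists y, x = io y.
  move=> /andP[sx xsk]; have xk : (x - s < k)%N by lia.
  by exists (Ordinal xk); apply/val_inj => /=; lia.
have JM n (A : 'M[R]_(k, n)) (y : 'I_k) j : (J *m A) (io y) j = A y j.
  rewrite mxE (bigD1 y) //= big1 ?addr0 ?mxE ?eqxx ?mul1r // => z zy.
  by rewrite mxE (inj_eq io_inj) eq_sym (negPf zy) mul0r.
have JM0 n (A : 'M[R]_(k, n)) (x : 'I_m) j : ~~ (s <= x < s + k)%N -> (J *m A) x j = 0.
  move=> xw; rewrite mxE big1 // => z _; rewrite mxE; case: eqP => [xz|]; last by rewrite mul0r.
  by exfalso; move: xw; rewrite xz /= ltn_add2l ltn_ord leq_addr.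
have avgJ (h hw : nat -> nat) :
    (forall x y, (s <= x < s + k)%N -> h x = h y -> (s <= y < s + k)%N) ->
    (forall x y, (x < k)%N -> (y < k)%N -> (h (s + x)%N == h (s + y)%N) = (hw x == hw y)) ->
    avg m h *m J = J *m avg k hw.
  move=> hc hh; apply/matrixP => x y; rewrite JE.
  have [xw|xw] := boolP (s <= x < s + k)%N; last first.
    rewrite JM0 // mxE; case: eqP => [hxy|]; last by rewrite mul0r.
    by case/negP: xw; apply: (hc (io y)) => //=; rewrite leq_addr ltn_add2l ltn_ord.
  have [z xz] := inw _ xw; rewrite xz JM !mxE /= hh //; congr (_ / _%:R).
  rewrite /class_size -(card_imset _ io_inj); apply: eq_card => w; rewrite inE.
  apply/idP/imsetP => [/eqP hw'|[v]]; last first.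
    by rewrite inE => hv -> /=; rewrite hh.
  have [v wv] : exists v, w = io v.
    by apply: inw; apply: (hc (s + z)%N) => //; rewrite leq_addr ltn_add2l ltn_ord.
  by exists v => //; rewrite inE -hh //; rewrite wv /= in hw'; apply/eqP.
have loopJ : loop m p f g *m J = J *m loop k p fw gw.
  rewrite /loop; elim: (p) => [|q IH]; first by rewrite !expr0 mul1mx mulmx1.
  by rewrite !exprSr -!mulmxA (avgJ g gw) // (mulmxA (avg m f)) (avgJ f fw) // !mulmxA IH -!mulmxA.
have JJ : J^T *m J = 1%:M.
  apply/matrixP => y z; rewrite JE !mxE; congr (_%:R); rewrite eq_sym.
  by rewrite (inj_eq io_inj) eq_sym.
have selE : sel m (fun x => s <= x < s + k)%N = J *m J^T.
  apply/matrixP => x y; rewrite !mxE.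
  have [xw|xw] := boolP (s <= x < s + k)%N; last first.
    rewrite mul0rn big1 // => z _; rewrite !mxE; case: eqP => [xz|]; last by rewrite mul0r.
    by exfalso; move: xw; rewrite xz /= ltn_add2l ltn_ord leq_addr.
  have [z ->] := inw _ xw.
  rewrite (bigD1 z) //= big1 ?addr0 => [|w wz]; rewrite !mxE.
    by rewrite eqxx mul1r eq_sym.
  by rewrite (inj_eq io_inj) eq_sym (negPf wz) mul0r.
by rewrite selE -mulmxA mxtrace_mulC -mulmxA loopJ mulmxA JJ mul1mx.
Qed.

Definition loop_trace k p f g : R := \tr (loop k p f g).

Lemma sum_cells m B j0 K (d : 'I_m -> R) :
  \sum_(x < m | (j0 * B <= x < (j0 + K) * B)%N) d x =
  \sum_(j0 <= j < j0 + K) \sum_(x < m | (j * B <= x < j * B + B)%N) d x.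
Proof.
elim: K => [|K IH].
  by rewrite addn0 big_geq // big1 // => x /andP[]; lia.
rewrite addnS big_nat_recr ?leq_addr //= -IH.
rewrite (bigID (fun x : 'I_m => (x < (j0 + K) * B)%N)) /=; congr (_ + _); apply: eq_bigl => x.
  rewrite mulSn; lia.
have := leq_mul (leq_addr K j0) (leqnn B); rewrite mulSn; lia.
Qed.

(** Cutting at the cell boundaries decouples the cells, each cut costing a
bounded amount; what remains is the classes that straddle the two ends. *)
Lemma block_cells m B p f g v0 v1 j0 j1 D0 D1 (fw gw : nat -> nat -> nat) :
  {homo f : x y / (x <= y)%N} -> {homo g : x y / (x <= y)%N} -> (j1 * B <= m)%N ->
  (f (j0 * B) < v0 + D0)%N -> (v1 <= f (j1 * B) + D1)%N ->
  (forall x, (j0 * B <= x < j1 * B)%N -> (v0 <= f x <= v1)%N) ->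
  (forall j x y, (x < B)%N -> (y < B)%N ->
     (f (j * B + x)%N == f (j * B + y)%N) = (fw j x == fw j y)) ->
  (forall j x y, (x < B)%N -> (y < B)%N ->
     (g (j * B + x)%N == g (j * B + y)%N) = (gw j x == gw j y)) ->
  `|\tr (sel m (fun x => v0 <= f x < v1)%N *m loop m p.+1 f g)
    - \sum_(j0 <= j < j1) loop_trace B p.+1 (fw j) (gw j)|
   <= (D0 + D1 + 1 + 4 * p.+1 * (j1 - j0).+1)%:R.
Proof.
move=> fm gm j1m f0 f1 fI ff gg.
pose I x := (j0 * B <= x < j1 * B)%N.
pose cs := [seq (j * B)%N | j <- iota j0 (j1 - j0).+1].
set L := loop m p.+1 f g; pose L' := loop m p.+1 (cuts f cs) (cuts g cs).
pose E x := (v0 <= f x < v1)%N.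
(* The points in the window but outside the whole cells, or conversely, carry
   few labels. *)
have sub1 : `|\tr (sel m E *m L) - \tr (sel m I *m L)| <= (D0 + D1 + 1)%:R.
  have sQ : substoch (avg m g *m loop m p f g).
    by apply: substochM (substoch_avg _ _) (substoch_loop _ _ _ _).
  rewrite !mxtrace_sel /L loopS.
  set Q := avg m f *m (avg m g *m loop m p f g).
  have lab (D : pred nat) v K : (forall x, (x < m)%N -> D x -> (v <= f x < v + K)%N) ->
      0 <= \sum_(x < m | D x) Q x x <= K%:R by move=> DK; apply: (trace_labels_le sQ DK).
  rewrite (bigID (fun x : 'I_m => I x)) /= [X in _ - X](bigID (fun x : 'I_m => E x)) /=.
  rewrite [X in _ - (X + _)](eq_bigl (fun x : 'I_m => E x && I x)); last by move=> x; rewrite andbC.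
  rewrite opprD addrACA subrr add0r.
  rewrite (bigID (fun x : 'I_m => (x < j0 * B)%N)) /=.
  have /andP[a0 a1] := lab (fun x => (E x && ~~ I x) && (x < j0 * B)%N) v0 D0
    (fun x _ H => ltac:(move: H (fm x (j0 * B)%N); rewrite /E; lia)).
  have /andP[b0 b1] := lab (fun x => (E x && ~~ I x) && ~~ (x < j0 * B)%N) (f (j1 * B)%N) D1
    (fun x _ H => ltac:(move: H (fm (j1 * B)%N x); rewrite /E /I; lia)).
  have /andP[c0 c1] := lab (fun x => I x && ~~ E x) v1 1%N
    (fun x _ H => ltac:(move: H (fI x); rewrite /E /I; lia)).
  rewrite !natrD ler_norml; apply/andP; split; lra.
have sub2 : `|\tr (sel m I *m L) - \tr (sel m I *m L')| <= (4 * p.+1 * (j1 - j0).+1)%:R.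
  have := trace_loop_cuts p.+1 cs fm gm (substoch_sel m I).
  by rewrite mulmxBr raddfB /= size_map size_iota.
have sub3 : \tr (sel m I *m L') = \sum_(j0 <= j < j1) loop_trace B p.+1 (fw j) (gw j).
  have [j10|j01] := leqP j1 j0.
    rewrite big_geq // mxtrace_sel big1 // => x; rewrite /I.
    by have := leq_mul j10 (leqnn B); lia.
  rewrite mxtrace_sel -(subnKC (ltnW j01)) /I -{1}(subnKC (ltnW j01)) sum_cells.
  rewrite big_nat [RHS]big_nat; apply: eq_bigr => j jb.
  have jB : (j * B + B <= j1 * B)%N.
    have : (j.+1 * B <= j1 * B)%N by apply: leq_mul => //; lia.
    by rewrite mulSn addnC.
  have closed (h : nat -> nat) : {homo h : x y / (x <= y)%N} ->
      forall x y, (j * B <= x < j * B + B)%N -> cuts h cs x = cuts h cs y -> (j * B <= y < j * B + B)%N.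
    move=> hm x y xj hxy.
    have cnt c (z w : nat) : c \in cs -> (z < c <= w)%N -> (cuts h cs z < cuts h cs w)%N.
      move=> ccs zcw; rewrite /cuts.
      have hzw : (h z <= h w)%N by apply: hm; lia.
      rewrite -addnS leq_add //.
      elim: (cs) ccs => //= c' cs' IH; rewrite inE => /orP[/eqP <-|/IH lt].
        have : (count (fun c => c <= z) cs' <= count (fun c => c <= w) cs')%N.
          by apply: sub_count => u /=; lia.
        by lia.
      have : ((c' <= z) <= (c' <= w))%N by lia.
      by lia.
    apply: contraT => yn; have [yj|yj] : (y < j * B)%N \/ (j * B + B <= y)%N by lia.
      have : (cuts h cs y < cuts h cs x)%N.
        apply: (cnt (j * B)%N); last by lia.
        by apply/mapP; exists j => //; rewrite mem_iota; lia.
      by rewrite hxy ltnn.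
    have : (cuts h cs x < cuts h cs y)%N.
      apply: (cnt (j.+1 * B)%N); last by rewrite mulSn; lia.
      by apply/mapP; exists j.+1 => //; rewrite mem_iota; lia.
    by rewrite hxy ltnn.
  have eqc (h hw : nat -> nat) :
     (forall x y, (x < B)%N -> (y < B)%N -> (h (j * B + x)%N == h (j * B + y)%N) = (hw x == hw y)) ->
     forall x y, (x < B)%N -> (y < B)%N ->
     (cuts h cs (j * B + x)%N == cuts h cs (j * B + y)%N) = (hw x == hw y).
    move=> hh x y xB yB; rewrite -hh // /cuts.
    have -> : count (fun c => c <= j * B + x)%N cs = count (fun c => c <= j * B + y)%N cs.
      apply: eq_in_count => c /mapP[i _ ->].
      have [ij|ji] := leqP i j.
        by have := leq_mul ij (leqnn B); lia.
      have := leq_mul ji (leqnn B); rewrite mulSn; lia.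
    by rewrite eqn_add2r.
  transitivity (\tr (sel m (fun x => j * B <= x < j * B + B)%N *m L')); first by rewrite mxtrace_sel.
  rewrite /L' /loop_trace; apply: trace_closed_classes.
  - by apply: leq_trans j1m.
  - exact: closed.
  - exact: closed.
  - by apply: eqc => x y; exact: ff.
  - by apply: eqc => x y; exact: gg.
rewrite -sub3 -(subrK (\tr (sel m I *m L)) (\tr (sel m E *m L))) -addrA natrD.
by apply: le_trans (ler_normD _ _) _; apply: lerD.
Qed.

Lemma loop_trace_bounds k p fw gw : {homo fw : x y / (x <= y)%N} ->
  0 <= loop_trace k p.+1 fw gw <= (fw k - fw 0%N).+1%:R.
Proof.
move=> fm; rewrite /loop_trace /mxtrace loopS.
apply: (@trace_labels_le k fw _ xpredT (fw 0%N)).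
  by apply: substochM (substoch_avg _ _) (substoch_loop _ _ _ _).
move=> x xk _; have := fm 0%N x; have := fm x k; lia.
Qed.
End Kernels.

(** * A lower bound for the trace on good windows *)

Section Good.
Context {R : realFieldType}.
Implicit Types (m : nat) (f g : nat -> nat).

(** Both labelings change on the stretches before and after [i * U, (i + 1) * U),
so that no class extends far beyond it, and they take few values on it. *)
Definition good_window f g U K i : bool :=
  [&& f (i.-1 * U) < f (i * U), f (i.+1 * U) < f (i.+2 * U),
      g (i.-1 * U) < g (i * U), g (i.+1 * U) < g (i.+2 * U)
    & f (i.+1 * U) + g (i.+1 * U) <= f (i * U) + g (i * U) + K]%N.

Lemma pigeonhole_label U K (h : nat -> nat) v0 :
  (forall x, (x < U)%N -> (v0 <= h x <= v0 + K)%N) ->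
  exists v, (U <= K.+1 * #|[set x : 'I_U | h x == v]%SET|)%N.
Proof.
move=> hb.
have [/existsP[i Hi]|/existsPn small] :=
  boolP [exists i : 'I_K.+1, (U <= K.+1 * #|[set x : 'I_U | h x == v0 + i]%SET|)%N].
  by exists (v0 + i)%N.
exfalso; have U0 : (0 < U)%N by have := small ord0; lia.
have tot : (\sum_(i < K.+1) #|[set x : 'I_U | h x == v0 + i]%SET| = U)%N.
  under eq_bigr do rewrite -sum1_card big_mkcond.
  rewrite exchange_big /= -[RHS](card_ord U) -sum1_card; apply: eq_bigr => x _.
  have hx := hb x (ltn_ord x).
  have iK : (h x - v0 < K.+1)%N by lia.
  rewrite (bigD1 (Ordinal iK)) //= big1 => [|j jn]; rewrite inE /=.
    by rewrite subnKC ?eqxx; lia.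
  case: eqP => // hj; case/eqP: jn; apply/val_inj => /=; lia.
have : (\sum_(i < K.+1) (K.+1 * #|[set x : 'I_U | h x == v0 + i]%SET|).+1 <= \sum_(i < K.+1) U)%N.
  by apply: leq_sum => i _; have := small i; lia.
rewrite sum_nat_const card_ord; under eq_bigr do rewrite -addn1.
by rewrite big_split /= -big_distrr /= tot sum_nat_const card_ord; lia.
Qed.

(** On a good window the classes that meet it have at most [3 U] points while, by
the pigeonhole principle, at least [U / (K + 1)] of its points agree in both
labels. *)
Lemma good_window_ge m f g U K i :
  {homo f : x y / (x <= y)%N} -> {homo g : x y / (x <= y)%N} ->
  (1 <= i)%N -> (i.+2 * U <= m)%N -> good_window f g U K i ->
  (9 * K.+1 ^ 2)%:R^-1 <= \sum_(x < m | (i * U <= x < i * U + U)%N) loop m 1 f g x x :> R.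
Proof.
move=> fm gm i1 iUm /and5P[fl fr gl gr fgK].
have iS : (i.+1 * U = i * U + U)%N by rewrite mulSn addnC.
have iSS : (i.+2 * U = i * U + 2 * U)%N by rewrite !mulSn; lia.
have iP : (i.-1 * U + U = i * U)%N by case: (i) i1 => //= j _; rewrite mulSn addnC.
have U0 : (0 < U)%N by case: (U) fl => //; rewrite !muln0 ltnn.
pose h x := (f (i * U + x) + g (i * U + x))%N.
have [|v vU] := @pigeonhole_label U K h (f (i * U) + g (i * U))%N.
  move=> x xU; rewrite /h.
  have := fm (i * U)%N (i * U + x)%N; have := gm (i * U)%N (i * U + x)%N.
  have := fm (i * U + x)%N (i.+1 * U)%N; have := gm (i * U + x)%N (i.+1 * U)%N.
  by rewrite iS in fgK *; lia.
set c := #|_| in vU.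
have mono_size (F : nat -> nat) x : {homo F : x y / (x <= y)%N} -> (F (i.-1 * U) < F (i * U))%N ->
    (F (i.+1 * U) < F (i.+2 * U))%N -> (i * U <= x < i * U + U)%N -> (class_size m F (F x) <= 3 * U)%N.
  move=> Fm Fl Fr xw; rewrite /class_size.
  have bnd (y : 'I_(3 * U)) : (i.-1 * U + y < m)%N by have := ltn_ord y; lia.
  rewrite -[leqRHS](card_ord (3 * U)).
  apply: leq_trans (leq_imset_card (fun y => Ordinal (bnd y)) _).
  apply: subset_leq_card; apply/fintype.subsetP => y; rewrite inE => /eqP Fyx.
  have [ylo yhi] : (i.-1 * U <= y)%N /\ (y < i.-1 * U + 3 * U)%N.
    have := Fm y (i.-1 * U)%N; have := Fm (i.+2 * U)%N y.
    have := Fm (i * U)%N x; have := Fm x (i.+1 * U)%N; lia.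
  have yi : (y - i.-1 * U < 3 * U)%N by lia.
  apply/imsetP; exists (Ordinal yi) => //; apply/val_inj => /=; lia.
have bnd (y : 'I_U) : (i * U + y < m)%N by have := ltn_ord y; lia.
pose io y : 'I_m := Ordinal (bnd y).
have io_inj : injective io by move=> y z /(congr1 val) /= /addnI /val_inj.
pose A := [set io y | y in [set x : 'I_U | h x == v]%SET]%SET.
have cA : #|A| = c by rewrite card_imset.
have Aw x : x \in A -> (i * U <= x < i * U + U)%N.
  by case/imsetP => y _ -> /=; have := ltn_ord y; lia.
have AA x y : x \in A -> y \in A -> f x = f y /\ g x = g y.
  move=> /imsetP[z + ->] /imsetP[w + ->]; rewrite !inE /h /= => /eqP h1 /eqP h2.
  have := fm (i * U + z)%N (i * U + w)%N; have := fm (i * U + w)%N (i * U + z)%N.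
  have := gm (i * U + z)%N (i * U + w)%N; have := gm (i * U + w)%N (i * U + z)%N.
  lia.
have lp x y : 0 <= avg m f x y * avg m g y x :> R by rewrite mulr_ge0 ?avg_ge0.
have U30 : 0 < (3 * U)%:R :> R by rewrite ltr0n; lia.
have ent x y : x \in A -> y \in A -> (3 * U)%:R^-1 ^+ 2 <= avg m f x y * avg m g y x :> R.
  move=> xA yA; have [fxy gxy] := AA x y xA yA; rewrite !mxE fxy gxy !eqxx !mul1r expr2.
  have csz (F : nat -> nat) : {homo F : x y / (x <= y)%N} -> (F (i.-1 * U) < F (i * U))%N ->
    (F (i.+1 * U) < F (i.+2 * U))%N -> (3 * U)%:R^-1 <= (class_size m F (F y))%:R^-1 :> R.
    move=> Fm Fl Fr; rewrite lef_pV2 ?posrE ?ltr0n ?class_size_gt0 //; last by lia.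
    by rewrite ler_nat; apply: mono_size => //; exact: Aw.
  by apply: ler_pM; rewrite ?invr_ge0 ?ler0n //; apply: csz.
apply: (@le_trans _ _ (\sum_(x in A) \sum_(y in A) (3 * U)%:R^-1 ^+ 2)).
  rewrite !sumr_const cA -!mulrnA -[leRHS]mulr_natr exprVn -natrX [leRHS]mulrC.
  rewrite ler_pdivlMr; last by rewrite ltr0n expn_gt0; lia.
  rewrite ler_pdivrMl; last by rewrite ltr0n muln_gt0 expn_gt0.
  by rewrite -natrM ler_nat; have := leq_mul vU vU; lia.
apply: (@le_trans _ _ (\sum_(x in A) loop m 1 f g x x)).
  apply: ler_sum => x xA; rewrite /loop expr1 mxE [X in _ <= X](bigID (mem A)) /=.
  rewrite -[X in X <= _]addr0 lerD //; first by apply: ler_sum => y yA; exact: ent.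
  by apply: sumr_ge0.
rewrite [X in _ <= X](bigID (mem A)) /= -[X in X <= _]addr0 lerD //.
  rewrite le_eqVlt; apply/orP; left; apply/eqP; apply: eq_bigl => x.
  by case xA : (x \in A); rewrite ?andbF //= Aw.
by apply: sumr_ge0 => x _; rewrite /loop expr1 mxE sumr_ge0.
Qed.

Lemma good_windows_trace m f g U K n :
  {homo f : x y / (x <= y)%N} -> {homo g : x y / (x <= y)%N} -> (n.+1 * U <= m)%N ->
  \sum_(1 <= i < n) (good_window f g U K i)%:R / (9 * K.+1 ^ 2)%:R <= loop_trace m 1 f g :> R.
Proof.
move=> fm gm nU; have d0 (x : 'I_m) : 0 <= loop m 1 f g x x :> R.
  rewrite /loop expr1 mxE sumr_ge0 // => y _; by rewrite mulr_ge0 ?avg_ge0.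
have [n1|n1] := leqP n 1; first by rewrite big_geq // /loop_trace sumr_ge0.
rewrite /loop_trace /mxtrace.
apply: (@le_trans _ _ (\sum_(x < m | (1 * U <= x < (1 + n.-1) * U)%N) loop m 1 f g x x)).
  rewrite sum_cells add1n prednK; last by lia.
  rewrite big_nat [X in _ <= X]big_nat; apply: ler_sum => i /andP[i1 iN].
  case gi : (good_window f g U K i); last by rewrite mul0r sumr_ge0.
  rewrite mul1r; apply: good_window_ge => //.
  by apply: leq_trans nU; rewrite leq_mul2r; lia.
rewrite [X in X <= _]big_mkcond /=; apply: ler_sum => x _; by case: ifP.
Qed.
End Good.

(** * The sampled overlap matrix *)

Section Bridge.
Context {R : realType}.
Variables (K M1 M2 : nat) (f g : nat -> nat).
Hypothesis fM : forall x, (x < K)%N -> (f x < M1)%N.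
Hypothesis gM : forall x, (x < K)%N -> (g x < M2)%N.

Definition joint_size (i j : nat) : nat := #|[set x : 'I_K | (f x == i) && (g x == j)]%SET|.

Definition sampled_G : 'M[R]_(M1, M2) := \matrix_(i, j)
  ((joint_size i j)%:R /
   (Num.sqrt (class_size K f i)%:R * Num.sqrt (class_size K g j)%:R)).

(** The square root of the averaging kernel: rows are sample points, columns are
intervals, and [label_mx M h *m (label_mx M h)^T] is [avg K h]. *)
Definition label_mx N (h : nat -> nat) : 'M[R]_(K, N) :=
  \matrix_(x, i) ((h x == i)%:R / Num.sqrt (class_size K h i)%:R).

Lemma label_mxE N h (E : pred nat) : (forall x, (x < K)%N -> (h x < N)%N) ->
  label_mx N h *m diag_mx (\row_(i < N) (E i)%:R) *m (label_mx N h)^T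
  = sel K (fun x => E (h x)) *m avg K h.
Proof.
move=> hN; apply/matrixP => x y; rewrite mul_diag_mx !mxE.
rewrite (bigD1 (Ordinal (hN x (ltn_ord x)))) //= big1 ?addr0 => [|i /negPf ix]; last first.
  rewrite mul_mx_diag !mxE; case: eqP => [hx|]; last by rewrite !mul0r.
  by move/eqP: ix; case; apply/val_inj.
rewrite mul_mx_diag !mxE /= eqxx [h y == _]eq_sym.
set c := class_size K h (h x).
have cc : Num.sqrt c%:R ^+ 2 = c%:R :> R by rewrite sqr_sqrtr.
have c0 : Num.sqrt c%:R != 0 :> R.
  by rewrite sqrtr_eq0 -ltNge ltr0n class_size_gt0.
have -> : (c%:R)^-1 = (Num.sqrt c%:R)^-1 * (Num.sqrt c%:R)^-1 :> R.
  by rewrite -invfM -expr2 cc.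
by case: (E _); case: (_ == _); rewrite ?mul0r ?mulr0 ?mul0r ?mul1r ?mulr1 ?mul1r.
Qed.

Lemma sampled_GE : sampled_G = (label_mx M1 f)^T *m label_mx M2 g.
Proof.
apply/matrixP => i j; rewrite !mxE /joint_size -sum1_card natr_sum mulr_suml.
rewrite big_mkcond; apply: eq_bigr => x _; rewrite !mxE inE.
case: (f x == i); case: (g x == j); rewrite ?mul0r ?mulr0 //=.
by rewrite !mul1r invfM.
Qed.

(** The overlap matrix is U^T V, where U and V are the label matrices of the two
grids; in the trace of (U^T V V^T U)^p, the outer factor U^T goes around and all
factors pair up to averaging kernels. *)
Lemma trace_sampled_G p (E : pred nat) :
  \tr (diag_mx (\row_(i < M1) (E i)%:R) *m (sampled_G *m sampled_G^T) ^+ p.+1)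
  = \tr (sel K (fun x => E (f x)) *m loop K p.+1 f g).
Proof.
set U := label_mx M1 f; set V := label_mx M2 g; set D := diag_mx _.
have one N h : (forall x, (x < K)%N -> (h x < N)%N) ->
    label_mx N h *m (label_mx N h)^T = avg K h.
  move=> hN; have := @label_mxE N h xpredT hN.
  have -> : sel K (fun=> true) = 1%:M :> 'M[R]_K.
    by apply/matrixP => x y; rewrite !mxE.
  rewrite mul1mx => <-; congr (_ *m _); rewrite -[LHS]mulmx1; congr (_ *m _).
  by apply/matrixP => x y; rewrite !mxE.
have pow q : (sampled_G *m sampled_G^T) ^+ q.+1 = U^T *m (avg K g *m (avg K f *m avg K g) ^+ q) *m U.
  elim: q => [|q IH].
    by rewrite expr1 expr0 mulmx1 sampled_GE trmx_mul trmxK -(one _ _ gM) !mulmxA.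
  rewrite exprSr IH exprSr sampled_GE trmx_mul trmxK -(one _ _ gM) -(one _ _ fM) -/U -/V.
  by rewrite -[LHS]/(_ *m _) -[X in _ = _ *m (_ *m X) *m _]/(_ *m _) !mulmxA.
rewrite pow !mulmxA mxtrace_mulC !mulmxA (@label_mxE M1 f E fM).
rewrite /loop exprS -[RHS]/(\tr (_ *m (avg K f *m avg K g *m (avg K f *m avg K g) ^+ p))).
by rewrite !mulmxA.
Qed.
End Bridge.

Section EntrywiseConvergence.
Context {R : realType}.

Definition mx_cvg a b (A_ : nat -> 'M[R]_(a, b)) (A : 'M[R]_(a, b)) : Prop :=
  forall i j, A_ r i j @[r --> \oo] --> A i j.

Lemma cvg_bigsum (I : Type) (s : seq I) (P : pred I) (F_ : nat -> I -> R) (F : I -> R) :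
  (forall i, P i -> F_ r i @[r --> \oo] --> F i) ->
  \sum_(i <- s | P i) F_ r i @[r --> \oo] --> \sum_(i <- s | P i) F i.
Proof.
move=> FF; elim: s => [|i s IH].
  by rewrite big_nil; under eq_fun do rewrite big_nil; exact: cvg_cst.
rewrite big_cons; under eq_fun do rewrite big_cons.
by case: ifP => // Pi; apply: cvgD => //; exact: FF.
Qed.

Lemma mx_cvg_cst a b (A : 'M[R]_(a, b)) : mx_cvg (fun=> A) A.
Proof. by move=> i j; exact: cvg_cst. Qed.

Lemma mx_cvgM a b c (A_ : nat -> 'M[R]_(a, b)) A (B_ : nat -> 'M[R]_(b, c)) B :
  mx_cvg A_ A -> mx_cvg B_ B -> mx_cvg (fun r => A_ r *m B_ r) (A *m B).
Proof.
move=> cA cB i j; rewrite mxE; under eq_fun do rewrite mxE.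
by apply: cvg_bigsum => k _; apply: cvgM.
Qed.

Lemma mx_cvgT a b (A_ : nat -> 'M[R]_(a, b)) A :
  mx_cvg A_ A -> mx_cvg (fun r => (A_ r)^T) A^T.
Proof. by move=> cA i j; rewrite mxE; under eq_fun do rewrite mxE; exact: cA. Qed.

Lemma mx_cvgX a (A_ : nat -> 'M[R]_a) A p :
  mx_cvg A_ A -> mx_cvg (fun r => A_ r ^+ p) (A ^+ p).
Proof.
move=> cA; elim: p => [|p IH]; first exact: mx_cvg_cst.
rewrite exprS; under eq_fun do rewrite exprS; exact: mx_cvgM.
Qed.

Lemma mx_cvg_trace a (A_ : nat -> 'M[R]_a) A :
  mx_cvg A_ A -> \tr (A_ r) @[r --> \oo] --> \tr A.
Proof. by move=> cA; apply: cvg_bigsum => i _; exact: cA. Qed.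
End EntrywiseConvergence.

(** * A pair of grids: counts, lengths and sampling *)

Lemma card_prefix m (p : pred nat) : (forall i j, (i <= j)%N -> p j -> p i) ->
  forall i, (i < m)%N -> (i < #|[set k : 'I_m | p k]%SET|)%N = p i.
Proof.
move=> pd.
have cardE : #|[set k : 'I_m | p k]%SET| = (\sum_(k < m) p k)%N.
  by rewrite -sum1_card big_mkcond /=; apply: eq_bigr => k _; rewrite inE; case: (p k).
rewrite cardE; elim: m {cardE} => // m IH i im.
rewrite big_ord_recr /=; case pm : (p m).
  have -> : (\sum_(k < m) p k = m)%N.
    rewrite -[RHS]card_ord -sum1_card; apply: eq_bigr => k _.
    by rewrite (pd k m) // ltnW.
  by rewrite addn1 im (pd i m).
rewrite addn0; have [lt|] := ltnP i m; first exact: IH.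
move=> mi; have -> : i = m by lia.
rewrite pm; apply/negbTE; rewrite -leqNgt -[leqRHS](card_ord m) -sum1_card.
by apply: leq_sum => k _; exact: leq_b1.
Qed.

Lemma ix_cases (l : 'I_2) : l = ix1 \/ l = ix2.
Proof. by case: l => -[|[|]] // i; [left|right]; apply/val_inj. Qed.

Lemma ix_all (Q : 'I_2 -> Prop) : Q ix1 -> Q ix2 -> forall l, Q l.
Proof. by move=> q1 q2 l; have [->|->] := ix_cases l. Qed.

Section GridFacts.
Context {R : realType}.

Definition is_grid (m : 'I_2 -> nat) (t : 'I_2 -> nat -> R) (T : R) : Prop :=
  forall l, [/\ t l 0%N = 0, forall i, (i < m l)%N -> t l i < t l i.+1 & t l (m l) = T].

Variables (m : 'I_2 -> nat) (t : 'I_2 -> nat -> R) (T : R).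
Hypothesis tgrid : is_grid m t T.

Lemma grid_lt l i j : (i < j <= m l)%N -> t l i < t l j.
Proof.
have [_ tS _] := tgrid l; elim: j => // j IH /andP[ij jm].
have [->|ne] := eqVneq i j; first exact: tS.
by apply: lt_trans (tS _ jm); apply: IH; lia.
Qed.

Lemma grid_le l i j : (i <= j <= m l)%N -> t l i <= t l j.
Proof.
move=> /andP[]; rewrite leq_eqVlt => /orP[/eqP -> //|ij jm].
by apply/ltW/grid_lt/andP.
Qed.

Lemma grid_lt_mono l i j : (i <= m l)%N -> (j <= m l)%N -> (t l i < t l j) = (i < j)%N.
Proof.
move=> im jm; case: ltnP => ij; first by rewrite grid_lt // ij.
by apply/negbTE; rewrite -leNgt grid_le // ij.
Qed.

Lemma obs_count_le l x : (obs_count m t l x <= m l)%N.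
Proof. by rewrite -[leqRHS](card_ord (m l)) max_card. Qed.

Lemma obs_countP l x i : (i < m l)%N -> (i < obs_count m t l x)%N = (t l i.+1 <= x).
Proof.
move=> im; rewrite /obs_count.
have -> : [set i : 'I_(m l) | t l i.+1 <= x]%SET =
    [set i : 'I_(m l) | (t l (minn i.+1 (m l)) <= x)]%SET.
  by apply/setP => j; rewrite !inE; rewrite (minn_idPl _) // ltn_ord.
rewrite (@card_prefix (m l) (fun i => t l (minn i.+1 (m l)) <= x)) //.
  by rewrite (minn_idPl _).
move=> a b ab; apply: le_trans; apply: grid_le; lia.
Qed.

Lemma obs_count_homo l : {homo obs_count m t l : x y / x <= y >-> (x <= y)%N}.
Proof.
move=> x y xy; apply: subset_leq_card; apply/fintype.subsetP => i; rewrite !inE => h.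
exact: le_trans xy.
Qed.

Lemma obs_count_label l x : 0 <= x -> x < T ->
  [/\ (obs_count m t l x < m l)%N, t l (obs_count m t l x) <= x
    & x < t l (obs_count m t l x).+1].
Proof.
move=> x0 xT; have [t0 _ tm] := tgrid l; set N := obs_count m t l x.
have Nm : (N < m l)%N.
  rewrite ltn_neqAle obs_count_le andbT; apply/eqP => NE.
  have m0 : (0 < m l)%N.
    by rewrite lt0n; apply/eqP => m0; move: tm; rewrite m0 t0 => E; move: xT; rewrite -E ltNge x0.
  have := @obs_countP l x (m l).-1; rewrite prednK // leqnn -/N NE => /(_ isT).
  by rewrite leqnn tm => /esym; rewrite leNgt xT.
split => //; last by have := obs_countP x Nm; rewrite ltnn => /esym /negbT; rewrite -ltNge.
case NE : N => [|k]; first by rewrite t0.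
by rewrite -obs_countP -/N ?NE; lia.
Qed.

Lemma obs_count_eq l x i : 0 <= x -> x < T -> (i < m l)%N ->
  (obs_count m t l x == i) = (t l i <= x < t l i.+1).
Proof.
move=> x0 xT im; have [Nm Nx xN] := obs_count_label l x0 xT.
apply/eqP/idP => [<-|/andP[ix xi]]; first by rewrite Nx xN.
have : t l i < t l (obs_count m t l x).+1 by apply: le_lt_trans ix xN.
have : t l (obs_count m t l x) < t l i.+1 by apply: le_lt_trans Nx xi.
rewrite !grid_lt_mono; lia.
Qed.

Lemma obs_count_full l x : T <= x -> obs_count m t l x = m l.
Proof.
move=> Tx; apply/eqP; rewrite eqn_leq obs_count_le /=.
have [m0|m0] := posnP (m l); first by rewrite m0.
have [_ _ tm] := tgrid l.
by have := @obs_countP l x (m l).-1; rewrite prednK // leqnn tm Tx => /(_ isT) ->.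
Qed.

Lemma obs_itvE l i : obs_itv t l i = `]t l i, t l i.+1]%classic.
Proof. by apply/seteqP; split=> x /=; rewrite in_itv. Qed.

Lemma in_blockE l i a b : (i < m l)%N ->
  in_block t a b l i = (obs_count m t l a <= i < obs_count m t l b)%N.
Proof.
move=> im; rewrite /in_block obs_itvE sup_itv; last first.
  by rewrite bnd_simp; apply: grid_lt; lia.
by rewrite obs_countP // leqNgt obs_countP // ltNge.
Qed.

Lemma len_interE l l' i j : (i < m l)%N -> (j < m l')%N ->
  len (obs_itv t l i `&` obs_itv t l' j) =
  Num.max 0 (Num.min (t l i.+1) (t l' j.+1) - Num.max (t l i) (t l' j)).
Proof.
move=> im jm; rewrite !obs_itvE /len -set_itvI lebesgue_measure_itv /=.
rewrite joinEtotal meetEtotal lte_fin; set a := Order.max _ _; set b := Order.min _ _.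
by case: (ltP a b) => ab /=; case: (ltP 0 (b - a)) => //; lra.
Qed.


Definition sample (dl : R) (l : 'I_2) (k : nat) : nat := obs_count m t l (k%:R * dl).

(** Rounding up to the sampling grid moves both ends of the interval in the same
direction, each by less than one step. *)
Lemma sample_count K (dl a b : R) : 0 < dl -> 0 <= a -> b <= K%:R * dl ->
  `|dl * #|[set k : 'I_K | a <= k%:R * dl < b]%SET|%:R - Num.max 0 (b - a)| <= dl.
Proof.
move=> dl0 a0 bK; have [ba|ab] := leP b a.
  rewrite (_ : [set _ | _]%SET = finset.set0) ?cards0; last first.
    by apply/setP => k; rewrite !inE; apply/negbTE/negP => /andP[h1 h2]; lra.
  by rewrite mulr0 max_l ?subr_le0 // subrr normr0 ltW.
pose q (c : R) := #|[set k : 'I_K | k%:R * dl < c]%SET|.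
have qb c : 0 <= c -> c <= K%:R * dl -> c <= (q c)%:R * dl <= c + dl.
  move=> c0 cK.
  have qP i : (i < K)%N -> (i < q c)%N = (i%:R * dl < c).
    apply: (@card_prefix K (fun i => i%:R * dl < c)) => u v uv; apply: le_lt_trans.
    by rewrite ler_pM2r // ler_nat.
  have qK : (q c <= K)%N by rewrite -[leqRHS](card_ord K) max_card.
  apply/andP; split.
    have [E|ne] := eqVneq (q c) K; first by rewrite E.
    have qlt : (q c < K)%N by rewrite ltn_neqAle ne.
    by have := qP _ qlt; rewrite ltnn => /esym/negbT; rewrite -leNgt.
  case E : (q c) => [|j]; first by rewrite mul0r; lra.
  have jK : (j < K)%N by rewrite -E.
  have := qP _ jK; rewrite E ltnSn => /esym jc.
  by rewrite -natr1 mulrDl mul1r lerD2r ltW.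
have -> : #|[set k : 'I_K | a <= k%:R * dl < b]%SET| = (q b - q a)%N.
  rewrite /q; set B := [set k | _ < b]%SET; set A := [set k | _ < a]%SET.
  have -> : [set k : 'I_K | a <= k%:R * dl < b]%SET = (B :\: A)%SET.
    by apply/setP => k; rewrite !inE -leNgt.
  rewrite cardsD (finset.setIidPr _) //; apply/fintype.subsetP => k; rewrite !inE => h.
  exact: lt_trans ab.
have qab : (q a <= q b)%N.
  apply: subset_leq_card; apply/fintype.subsetP => k; rewrite !inE => h.
  exact: lt_trans ab.
rewrite natrB // mulrBr max_r; last by rewrite subr_ge0 ltW.
have /andP[h1 h2] := qb a a0 (le_trans (ltW ab) bK).
have /andP[h3 h4] := qb b (le_trans a0 (ltW ab)) bK.
rewrite ![dl * _]mulrC ler_norml; apply/andP; split; lra.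
Qed.

Lemma joint_sizeE K dl i j : 0 < dl -> K%:R * dl = T -> (i < m ix1)%N -> (j < m ix2)%N ->
  joint_size K (sample dl ix1) (sample dl ix2) i j =
  #|[set k : 'I_K | Num.max (t ix1 i) (t ix2 j) <= k%:R * dl
                    < Num.min (t ix1 i.+1) (t ix2 j.+1)]%SET|.
Proof.
move=> dl0 KT im jm; apply: eq_card => k; rewrite !inE.
have kT : k%:R * dl < T by rewrite -KT ltr_pM2r // ltr_nat.
have k0 : 0 <= k%:R * dl by rewrite mulr_ge0 // ltW.
rewrite !obs_count_eq // ge_max lt_min.
by rewrite -!andbA; congr (_ && _); rewrite andbCA.
Qed.

Lemma class_sizeE K dl l i : 0 < dl -> K%:R * dl = T -> (i < m l)%N ->
  class_size K (sample dl l) i = #|[set k : 'I_K | t l i <= k%:R * dl < t l i.+1]%SET|.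
Proof.
move=> dl0 KT im; apply: eq_card => k; rewrite !inE.
have kT : k%:R * dl < T by rewrite -KT ltr_pM2r // ltr_nat.
have k0 : 0 <= k%:R * dl by rewrite mulr_ge0 // ltW.
by rewrite !obs_count_eq.
Qed.

Lemma grid_ge0 l i : (i <= m l)%N -> 0 <= t l i.
Proof. by move=> im; have [<- _ _] := tgrid l; apply: grid_le. Qed.

Lemma grid_leT l i : (i <= m l)%N -> t l i <= T.
Proof. by move=> im; have [_ _ <-] := tgrid l; apply: grid_le; rewrite im leqnn. Qed.

Lemma len_itvE l i : (i < m l)%N -> len (obs_itv t l i) = t l i.+1 - t l i.
Proof.
move=> im; rewrite -[obs_itv t l i]setIid len_interE // minxx maxxx max_r //.
by rewrite subr_ge0 grid_le //; lia.
Qed.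

Section SampleCvg.
Variables (K : nat -> nat) (dl : nat -> R).
Hypotheses (dl0 : forall r, 0 < dl r) (KT : forall r, (K r)%:R * dl r = T).
Hypothesis (dlcvg : dl r @[r --> \oo] --> (0 : R)).

Lemma cvg_of_dist (u : nat -> R) c : (forall r, `|u r - c| <= dl r) -> u r @[r --> \oo] --> c.
Proof.
move=> uc; apply/cvgrPdist_le => e e0.
move/cvgrPdist_le: dlcvg => /(_ e e0); apply: filterS => r.
by rewrite sub0r normrN gtr0_norm // distrC => le; exact: le_trans (uc r) le.
Qed.

Lemma joint_size_cvg i j : (i < m ix1)%N -> (j < m ix2)%N ->
  dl r * (joint_size (K r) (sample (dl r) ix1) (sample (dl r) ix2) i j)%:R
    @[r --> \oo] --> len (obs_itv t ix1 i `&` obs_itv t ix2 j).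
Proof.
move=> im jm; apply: cvg_of_dist => r.
rewrite joint_sizeE // len_interE //; apply: sample_count => //.
  by rewrite le_max grid_ge0 //; lia.
by rewrite KT ge_min grid_leT.
Qed.

Lemma class_size_cvg l i : (i < m l)%N ->
  dl r * (class_size (K r) (sample (dl r) l) i)%:R @[r --> \oo] --> len (obs_itv t l i).
Proof.
move=> im; apply: cvg_of_dist => r.
have -> : len (obs_itv t l i) = Num.max 0 (t l i.+1 - t l i).
  by rewrite len_itvE // max_r // subr_ge0 grid_le //; lia.
rewrite class_sizeE //; apply: sample_count => //; first by apply: grid_ge0; lia.
by rewrite KT grid_leT.
Qed.

Lemma sampled_G_cvg : mx_cvg
  (fun r => sampled_G (K r) (m ix1) (m ix2) (sample (dl r) ix1) (sample (dl r) ix2)) (Gmx m t).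
Proof.
move=> i j; rewrite mxE.
have pos l (k : 'I_(m l)) : Num.sqrt (len (obs_itv t l k)) != 0.
  by rewrite sqrtr_eq0 -ltNge len_itvE // subr_gt0 grid_lt //; have := ltn_ord k; lia.
have csqrt l (k : 'I_(m l)) :
  Num.sqrt (dl r * (class_size (K r) (sample (dl r) l) k)%:R) @[r --> \oo]
    --> Num.sqrt (len (obs_itv t l k)).
  by apply: continuous_cvg; [exact: sqrt_continuous|exact: class_size_cvg].
have -> : (fun r => sampled_G (K r) (m ix1) (m ix2) (sample (dl r) ix1) (sample (dl r) ix2) i j) =
  (fun r => dl r * (joint_size (K r) (sample (dl r) ix1) (sample (dl r) ix2) i j)%:R /
    (Num.sqrt (dl r * (class_size (K r) (sample (dl r) ix1) i)%:R) *
     Num.sqrt (dl r * (class_size (K r) (sample (dl r) ix2) j)%:R))).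
  apply/funext => r; rewrite mxE !sqrtrM ?ltW // mulrACA -expr2 sqr_sqrtr ?ltW //.
  by rewrite -mulf_div divff ?mul1r // gt_eqF.
apply: cvgM; first exact: joint_size_cvg.
by apply: cvgV; [rewrite mulf_neq0|apply: cvgM].
Qed.

Lemma sampled_trace_cvg p a b :
  \tr (sel (K r) (fun x => obs_count m t ix1 a <= sample (dl r) ix1 x < obs_count m t ix1 b)%N
      *m loop (K r) p.+1 (sample (dl r) ix1) (sample (dl r) ix2)) @[r --> \oo]
    --> block_trace m t p.+1 a b.
Proof.
pose E i := (obs_count m t ix1 a <= i < obs_count m t ix1 b)%N.
have -> : block_trace m t p.+1 a b =
    \tr (diag_mx (\row_(i < m ix1) (E i)%:R) *m (Gmx m t *m (Gmx m t)^T) ^+ p.+1).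
  rewrite /block_trace; congr (\tr (_ *m _)); rewrite /block_proj; congr diag_mx.
  by apply/rowP => i; rewrite !mxE in_blockE // /E; case: ifP.
have lab r l x : (x < K r)%N -> (sample (dl r) l x < m l)%N.
  move=> xK; have [] // := @obs_count_label l (x%:R * dl r); last by rewrite -(KT r) ltr_pM2r // ltr_nat.
  by rewrite mulr_ge0 // ltW.
pose G r := sampled_G (K r) (m ix1) (m ix2) (sample (dl r) ix1) (sample (dl r) ix2) : 'M[R]_(_, _).
have trE r : \tr (sel (K r) (fun x => E (sample (dl r) ix1 x))
      *m loop (K r) p.+1 (sample (dl r) ix1) (sample (dl r) ix2)) =
     \tr (diag_mx (\row_(i < m ix1) (E i)%:R) *m (G r *m (G r)^T) ^+ p.+1).
  by rewrite (@trace_sampled_G R (K r) (m ix1) (m ix2)) // => x; exact: lab.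
under eq_fun do rewrite trE.
apply: mx_cvg_trace; apply: mx_cvgM; first exact: mx_cvg_cst.
by apply: mx_cvgX; apply: mx_cvgM; [|apply: mx_cvgT]; exact: sampled_G_cvg.
Qed.
End SampleCvg.

(** An overlap written as an increment, so that overlaps with consecutive
intervals telescope. *)
Lemma overlap_clamp (a b c e : R) : a <= b -> c <= e ->
  Num.max 0 (Num.min b e - Num.max a c) =
  Num.min b (Num.max a e) - Num.min b (Num.max a c).
Proof.
move=> ab ce; have mba : Num.min b a = a by apply: min_r.
case: (leP a c) => ac; case: (leP a e) => ae; rewrite ?mba; case: (leP b e) => be;
  (try case: (leP b c) => bc); match goal with |- Num.max 0 ?x = _ => case: (leP 0 x) end => ?; lra.
Qed.

Lemma sum_overlap l l' i : (i < m l)%N ->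
  \sum_(j < m l') len (obs_itv t l i `&` obs_itv t l' j) = len (obs_itv t l i).
Proof.
move=> im; have [t0 _ tm] := tgrid l'.
have li : t l i <= t l i.+1 by apply: grid_le; lia.
pose F j := Num.min (t l i.+1) (Num.max (t l i) (t l' j)).
rewrite (eq_bigr (fun j : 'I__ => F j.+1 - F j)); last first.
  by move=> j _; rewrite len_interE // overlap_clamp // grid_le //; have := ltn_ord j; lia.
rewrite -(big_mkord xpredT (fun j => F j.+1 - F j)) telescope_sumr // len_itvE // /F t0 tm.
have ti0 : 0 <= t l i by apply: grid_ge0; lia.
have tiT : t l i <= T by apply: grid_leT; lia.
have tST : t l i.+1 <= T by apply: grid_leT; lia.
by rewrite (max_l ti0) (max_r tiT) (min_l tST) (min_r li).
Qed.

Lemma sqrt_len_neq0 l (i : 'I_(m l)) : Num.sqrt (len (obs_itv t l i)) != 0.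
Proof. by rewrite sqrtr_eq0 -ltNge len_itvE // subr_gt0 grid_lt //; have := ltn_ord i; lia. Qed.

Lemma sqr_sqrt_len l (i : 'I_(m l)) :
  Num.sqrt (len (obs_itv t l i)) * Num.sqrt (len (obs_itv t l i)) = len (obs_itv t l i).
Proof. by rewrite -expr2 sqr_sqrtr // len_itvE // subr_ge0 grid_le //; have := ltn_ord i; lia. Qed.

Lemma len_div_sqrt l (i : 'I_(m l)) :
  len (obs_itv t l i) / Num.sqrt (len (obs_itv t l i)) = Num.sqrt (len (obs_itv t l i)).
Proof. by rewrite -{1}sqr_sqrt_len mulfK // sqrt_len_neq0. Qed.

(** Both grids partition the same interval, so that averaging the length of the
overlaps gives back the lengths. *)
Lemma Gmx_sqrt_len : Gmx m t *m sqrt_len m t ix2 = sqrt_len m t ix1.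
Proof.
apply/colP => i; rewrite !mxE.
under eq_bigr => j _.
  rewrite !mxE invfM mulrA -[_ * _ * Num.sqrt _]mulrA mulVf ?sqrt_len_neq0 // mulr1.
  over.
by rewrite -mulr_suml sum_overlap // len_div_sqrt.
Qed.

Lemma Gmx_tr_sqrt_len : (Gmx m t)^T *m sqrt_len m t ix1 = sqrt_len m t ix2.
Proof.
apply/colP => i; rewrite !mxE.
under eq_bigr => j _.
  rewrite !mxE setIC invfM mulrAC -!mulrA [X in _ * X]mulrA.
  rewrite divff ?sqrt_len_neq0 // mul1r.
  over.
by rewrite -mulr_suml sum_overlap // len_div_sqrt.
Qed.

Lemma GGt_fix p : (Gmx m t *m (Gmx m t)^T) ^+ p *m sqrt_len m t ix1 = sqrt_len m t ix1.
Proof.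
elim: p => [|p IH]; first by rewrite expr0 mul1mx.
by rewrite exprS -mulmxA IH -mulmxA Gmx_tr_sqrt_len Gmx_sqrt_len.
Qed.

Lemma GtG_fix p : ((Gmx m t)^T *m Gmx m t) ^+ p *m sqrt_len m t ix2 = sqrt_len m t ix2.
Proof.
elim: p => [|p IH]; first by rewrite expr0 mul1mx.
by rewrite exprS -mulmxA IH -mulmxA Gmx_sqrt_len Gmx_tr_sqrt_len.
Qed.

Lemma block_len l a b : a <= b ->
  ((sqrt_len m t l)^T *m block_proj m t l a b *m sqrt_len m t l) 0 0
  = t l (obs_count m t l b) - t l (obs_count m t l a).
Proof.
move=> ab; set Na := obs_count m t l a; set Nb := obs_count m t l b.
have NN : (Na <= Nb)%N by apply: obs_count_homo.
rewrite mxE -(telescope_sumr _ NN) (big_nat_widen _ _ (m l)) ?obs_count_le // (big_nat_widenl _ 0%N) //=.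
rewrite big_mkord [RHS]big_mkcond /=; apply: eq_bigr => i _.
rewrite mul_mx_diag !mxE in_blockE // -/Na -/Nb andbC.
by case: ifP => _; rewrite ?mulr1 ?sqr_sqrt_len ?len_itvE // mulr0 mul0r.
Qed.

Lemma len_le_mesh l i : (i < m l)%N -> len (obs_itv t l i) <= mesh m t.
Proof.
move=> im; rewrite /mesh.
have := @le_bigmax _ _ _ 0 (fun l : 'I_2 => \big[Num.max/0]_(i < m l) len (obs_itv t l i)) l.
by apply: le_trans; exact: (@le_bigmax _ _ _ 0 (fun i : 'I_(m l) => len (obs_itv t l i)) (Ordinal im)).
Qed.

Lemma mesh_gtP e : 0 <= e -> e < mesh m t -> exists l i, (i < m l)%N /\ e < len (obs_itv t l i).
Proof.
move=> e0; rewrite /mesh => h.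
have [l hl] : exists l : 'I_2, e < \big[Num.max/0]_(i < m l) len (obs_itv t l i).
  apply: contrapT => /forallNP n; move: h; apply/negP; rewrite -leNgt.
  by apply: bigmax_le => // l _; rewrite leNgt; apply/negP/n.
exists l; apply: contrapT => /forallNP n; move: hl; apply/negP; rewrite -leNgt.
by apply: bigmax_le => // i _; rewrite leNgt; apply/negP => lt; apply: (n i).
Qed.

Lemma grid_gap l x : 0 <= x <= T -> 0 <= x - t l (obs_count m t l x) <= mesh m t.
Proof.
move=> /andP[x0]; rewrite le_eqVlt => /orP[/eqP xT|xT].
  have [_ _ tm] := tgrid l; rewrite obs_count_full xT // tm subrr lexx /=.
  by rewrite /mesh; apply: bigmax_ge_id.
have [Nm Nx xN] := obs_count_label l x0 xT; rewrite subr_ge0 Nx /=.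
by apply: le_trans (len_le_mesh Nm); rewrite len_itvE // lerD2r ltW.
Qed.

Lemma block_len_dev l a b : 0 <= a -> a <= b -> b <= T ->
  `|t l (obs_count m t l b) - t l (obs_count m t l a) - (b - a)| <= mesh m t.
Proof.
move=> a0 ab bT.
have /andP[h1 h2] := @grid_gap l a ltac:(apply/andP; split; lra).
have /andP[h3 h4] := @grid_gap l b ltac:(apply/andP; split; lra).
rewrite ler_norml; apply/andP; split; lra.
Qed.

Lemma block_form11E p a b : a <= b -> block_form11 m t p a b =
  t ix1 (obs_count m t ix1 b) - t ix1 (obs_count m t ix1 a).
Proof. by move=> ab; rewrite /block_form11 -mulmxA GGt_fix block_len. Qed.

Lemma block_form12E p a b : a <= b -> block_form12 m t p a b =
  t ix1 (obs_count m t ix1 b) - t ix1 (obs_count m t ix1 a).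
Proof.
by move=> ab; rewrite /block_form12 -mulmxA Gmx_sqrt_len -mulmxA GGt_fix block_len.
Qed.

Lemma block_form22E p a b : a <= b -> block_form22 m t p a b =
  t ix2 (obs_count m t ix2 b) - t ix2 (obs_count m t ix2 a).
Proof. by move=> ab; rewrite /block_form22 -mulmxA GtG_fix block_len. Qed.

Lemma block_countE l a b :
  block_count m t l a b = (obs_count m t l b - obs_count m t l a)%N.
Proof.
rewrite /block_count -sum1_card big_mkcond /=.
transitivity (\sum_(i < m l | (obs_count m t l a <= i < obs_count m t l b)%N) 1)%N.
  rewrite [RHS]big_mkcond /=; apply: eq_bigr => i _.
  by rewrite inE in_blockE.
rewrite -[RHS]muln1 -sum_nat_const_nat (big_nat_widen _ _ (m l)) ?obs_count_le //.
by rewrite (big_nat_widenl _ 0%N) //= big_mkord; apply: eq_bigl => i; rewrite andbC.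
Qed.
End GridFacts.

(** * Integer valued variables with summable dependence *)

(** Measurability of a countable valued variable with respect to a sigma-algebra
that need not be the ambient one. Asking it for all sets [B], with no
sigma-algebra on [V], lets it pass through arbitrary functions of the variable. *)
Definition discrete_in (T V : Type) (SS : set (set T)) (Y : T -> V) : Prop :=
  forall B : set V, SS (Y @^-1` B).

Section Discrete.
Context {T : Type} (SS : set (set T)).
Hypothesis sSS : sigma_algebra [set: T] SS.

Lemma sigma_setI A B : SS A -> SS B -> SS (A `&` B).
Proof.
have [S0 SC SU] := sSS => SA SB.
have SCC C : SS C -> SS (~` C) by move=> hC; rewrite -setTD; apply: SC.
rewrite -[A `&` B]setCK setCI; apply: (SCC).
by rewrite -bigcup2E; apply: SU => -[|[|k]] //=; apply: SCC.
Qed.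

Lemma discrete_comp (V W : Type) (f : V -> W) (Y : T -> V) :
  discrete_in SS Y -> discrete_in SS (f \o Y).
Proof. by move=> dY B; exact: (dY (f @^-1` B)). Qed.

Lemma discrete_countable (V : countType) (Y : T -> V) :
  (forall v, SS (Y @^-1` [set v])) -> discrete_in SS Y.
Proof.
move=> Yv B; have [S0 SC SU] := sSS.
pose A k := if unpickle k is Some v then (if v \in B then Y @^-1` [set v] else set0) else set0.
have -> : Y @^-1` B = \bigcup_k A k.
  apply/seteqP; split=> [w /= Bw|w [k _]].
    by exists (pickle (Y w)) => //; rewrite /A pickleK mem_set.
  rewrite /A; case: unpickle => // v; case: ifP => // /set_mem Bv Ywv; rewrite /preimage /= Ywv; exact: Bv.
by apply: SU => k; rewrite /A; case: unpickle => [v|]; [case: ifP|].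
Qed.

Lemma discrete_pair (V W : countType) (Y : T -> V) (Z : T -> W) :
  discrete_in SS Y -> discrete_in SS Z -> discrete_in SS (fun w => (Y w, Z w)).
Proof.
move=> dY dZ; apply: discrete_countable => -[v u].
rewrite (_ : _ @^-1` _ = Y @^-1` [set v] `&` Z @^-1` [set u]); first exact: sigma_setI.
by apply/seteqP; split=> w /= [-> ->].
Qed.

Lemma discrete_cst (V : Type) (v : V) : discrete_in SS (fun=> v).
Proof.
move=> B; have [S0 SC SU] := sSS; rewrite preimage_cst; case: ifP => // _.
by have := SC _ S0; rewrite setD0.
Qed.

Lemma discrete_seq (V : countType) (Y : nat -> T -> V) (s : seq nat) :
  (forall i, i \in s -> discrete_in SS (Y i)) -> discrete_in SS (fun w => [seq Y i w | i <- s]).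
Proof.
elim: s => [|i s IH] dY; first exact: discrete_cst.
apply: (@discrete_comp _ _ (fun z => z.1 :: z.2) (fun w => (Y i w, [seq Y i w | i <- s]))).
apply: discrete_pair; first by apply: dY; rewrite mem_head.
by apply: IH => j js; apply: dY; rewrite inE js orbT.
Qed.
End Discrete.

Section DiscreteMeasurable.
Context {d : measure_display} {T : measurableType d} {R : realType}.

Lemma discrete_measurable (Y : T -> R) : discrete_in measurable Y -> measurable_fun [set: T] Y.
Proof. by move=> dY _ B _; rewrite setTI; exact: dY. Qed.

Lemma discrete_natP (Y : T -> nat) : discrete_in measurable Y <-> measurable_fun [set: T] Y.
Proof.
split=> [dY _ B _|mY B]; first by rewrite setTI; exact: dY.
by rewrite -[_ @^-1` _]setTI; exact: mY.
Qed.

Lemma nat_measurable (Y : T -> nat) (f : nat -> R) :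
  measurable_fun [set: T] Y -> measurable_fun [set: T] (fun w => f (Y w)).
Proof. by move=> /discrete_natP dY; apply: discrete_measurable; exact: (discrete_comp f). Qed.

Lemma nat_measurable_set (Y : T -> nat) (B : set nat) :
  measurable_fun [set: T] Y -> measurable (Y @^-1` B).
Proof. by move=> /discrete_natP; exact. Qed.

Lemma measurable_norm_ge (f : T -> R) (e : R) : measurable_fun [set: T] f ->
  measurable [set w | e <= `|f w|].
Proof.
move=> mf; have mH : measurable_fun [set: T] (fun w => `|f w|).
  by apply: measurableT_comp => //; exact: normr_measurable.
rewrite [X in measurable X](_ : _ = (fun w => `|f w|) @^-1` `[e, +oo[%classic).
  by rewrite -[_ @^-1` _]setTI; apply: mH.
by apply/seteqP; split=> w /=; rewrite in_itv /= andbT.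
Qed.

Lemma measurable_norm_gt (f : T -> R) (e : R) : measurable_fun [set: T] f ->
  measurable [set w | e < `|f w|].
Proof.
move=> mf; have mH : measurable_fun [set: T] (fun w => `|f w|).
  by apply: measurableT_comp => //; exact: normr_measurable.
rewrite [X in measurable X](_ : _ = (fun w => `|f w|) @^-1` `]e, +oo[%classic).
  by rewrite -[_ @^-1` _]setTI; apply: mH.
by apply/seteqP; split=> w /=; rewrite in_itv /= andbT.
Qed.
End DiscreteMeasurable.

Section Concentration.
Context {d : measure_display} {T : measurableType d} {R : realType}.
Variable P : probability T R.
Implicit Types Y : T -> nat.
Local Open Scope ereal_scope.

Lemma integral_prob_cst (c : R) : \int[P]_w (cst c%:E w) = c%:E.
Proof.
rewrite integral_cst //; transitivity (c%:E * 1); last by rewrite mule1.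
by congr (_ * _); exact: (@probability_setT _ _ _ P).
Qed.

Lemma indic_sum_nat (n : nat) : (n%:R%:E : \bar R) = \sum_(0 <= i <oo) ((i < n)%N%:R)%:E.
Proof.
rewrite (@nneseries_split _ _ 0 n) //.
rewrite add0n eseries0 ?adde0; last first.
  by move=> i ni _; rewrite ltnNge ni.
rewrite sumEFin big_nat (eq_bigr (fun=> 1%R)); last by move=> i /andP[_ ->].
by rewrite -big_nat sumr_const_nat subn0.
Qed.

Lemma integral_nat_on Y (D : set T) : measurable D -> measurable_fun [set: T] Y ->
  \int[P]_(w in D) (Y w)%:R%:E = \sum_(0 <= i <oo) P ([set w | (i < Y w)%N] `&` D).
Proof.
move=> mD mY; have mYi i : measurable [set w | (i < Y w)%N].
  exact: (nat_measurable_set [set k | (i < k)%N] mY).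
transitivity (\int[P]_(w in D) \sum_(0 <= i <oo) (\1_[set w | (i < Y w)%N] w)%:E).
  apply: eq_integral => w _; rewrite indic_sum_nat; apply: eq_eseriesr => i _.
  by rewrite indicE; congr ((nat_of_bool _)%:R%:E); apply/esym; apply/idP/idP => [/set_mem|/mem_set].
rewrite integral_nneseries //; last by move=> n; apply/measurable_EFinP/measurable_indic.
by apply: eq_eseriesr => i _; rewrite integral_indic.
Qed.

Lemma integral_natM Y Z : measurable_fun [set: T] Y -> measurable_fun [set: T] Z ->
  \int[P]_w ((Y w)%:R * (Z w)%:R)%:E =
  \sum_(0 <= k <oo) \sum_(0 <= i <oo) P ([set w | (i < Y w)%N] `&` [set w | (k < Z w)%N]).
Proof.
move=> mY mZ; have mZi i : measurable [set w | (i < Z w)%N].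
  exact: (nat_measurable_set [set k | (i < k)%N] mZ).
have mYR : measurable_fun [set: T] (fun w => (Y w)%:R : R)%R by exact: (nat_measurable (fun n => n%:R%R) mY).
transitivity (\int[P]_w \sum_(0 <= k <oo) ((Y w)%:R * \1_[set w | (k < Z w)%N] w)%:E).
  apply: eq_integral => w _; rewrite EFinM [(Z w)%:R%:E]indic_sum_nat -nneseriesZl //.
  apply: eq_eseriesr => i _; rewrite -EFinM indicE; congr (_ * (nat_of_bool _)%:R)%:E.
  by apply/esym; apply/idP/idP => [/set_mem|/mem_set].
rewrite integral_nneseries //; last first.
  by move=> n; apply/measurable_EFinP; apply: measurable_funM => //; exact: measurable_indic.
apply: eq_eseriesr => k _; rewrite -integral_nat_on //.
by rewrite [RHS]integral_mkcond; apply: eq_integral => w _; rewrite /= patchE indicE; case: ifP; rewrite ?mulr1 ?mulr0.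
Qed.

Lemma sum_inv_sqr n : (\sum_(0 <= i < n) (i.+1%:R ^+ 2)^-1 <= 2 :> R)%R.
Proof.
suff H : (\sum_(0 <= i < n.+1) (i.+1%:R ^+ 2)^-1 <= 2 - n.+1%:R^-1 :> R)%R.
  apply: (@le_trans _ _ (\sum_(0 <= i < n.+1) (i.+1%:R ^+ 2)^-1)%R).
    by rewrite big_nat_recr //= lerDl invr_ge0 exprn_ge0.
  by apply: le_trans H _; rewrite gerBl invr_ge0.
elim: n => [|n IH]; first by rewrite big_nat1 expr1n invr1; lra.
rewrite big_nat_recr //=; apply: le_trans (lerD IH (lexx _)) _.
set x : R := n.+1%:R; have x0 : (0 < x)%R by rewrite ltr0n.
have -> : n.+2%:R = (x + 1)%R :> R by rewrite -natr1.
rewrite -subr_ge0.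
have -> : (2 - (x + 1)^-1 - (2 - x^-1 + ((x + 1) ^+ 2)^-1) = (x * (x + 1) ^+ 2)^-1 :> R)%R.
  by field; apply/andP; split; apply: lt0r_neq0; lra.
by rewrite invr_ge0 mulr_ge0 ?sqr_ge0 // ltW.
Qed.

Lemma nneseries_le (u : nat -> R) (c : R) : (forall i, 0 <= u i)%R ->
  (forall n, \sum_(0 <= i < n) u i <= c)%R -> \sum_(0 <= i <oo) (u i)%:E <= c%:E.
Proof.
move=> u0 uc; apply: lime_le; first by apply: is_cvg_nneseries => i _ _; rewrite lee_fin.
by near=> n; rewrite sumEFin lee_fin.
Unshelve. all: by end_near. Qed.

(** A nonnegative number bounded by three others is at most the product of their
cube roots. Here the number is the dependence [x - p * q], and the three bounds
are the two tails and the mixing rate. *)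
Lemma cube_interpolation (x p q a b c : R) : (0 <= a -> 0 <= b -> 0 <= c ->
  0 <= p -> 0 <= q -> x <= p -> x <= q -> p <= a ^+ 3 -> q <= b ^+ 3 ->
  x <= p * q + c ^+ 3 -> x <= p * q + c * (b * a))%R.
Proof.
move=> a0 b0 c0 p0 q0 xp xq pa qb xc.
have [//|lt] := leP x (p * q + c * (b * a))%R; exfalso.
pose y := (x - p * q)%R; have pq : (0 <= p * q)%R by rewrite mulr_ge0.
have y0 : (c * (b * a) < y)%R by rewrite /y; lra.
have abc : (0 <= c * (b * a))%R by rewrite !mulr_ge0.
have : ((c * (b * a)) ^+ 3 < y ^+ 3)%R by rewrite ltrXn2r // ?nnegrE; lra.
have ya : (y <= a ^+ 3)%R by rewrite /y; lra.
have yb : (y <= b ^+ 3)%R by rewrite /y; lra.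
have yc : (y <= c ^+ 3)%R by rewrite /y; lra.
rewrite !exprMn ltNge => /negP; apply.
have y0' : (0 <= y)%R by lra.
have -> : (y ^+ 3 = y * (y * y) :> R)%R by rewrite !exprS expr0 mulr1.
by rewrite !ler_pM // !mulr_ge0.
Qed.

Section Sums.
Variables (X : nat -> T -> nat) (k : R) (be : nat -> R) (B : R).
Let Pr (A : set T) : R := fine (P A).
Hypothesis mX : forall j, measurable_fun [set: T] (X j).
Hypothesis k0 : (0 <= k)%R.
Hypothesis tail : forall j i, P [set w | (i < X j w)%N] <= ((k / i.+1%:R ^+ 2) ^+ 3)%:E.
Hypothesis stat : forall j i, P [set w | (i < X j w)%N] = P [set w | (i < X 0%N w)%N].
Hypothesis be0 : forall n, (0 <= be n)%R.
Hypothesis mix : forall j j' i i', (j <= j')%N ->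
  P ([set w | (i < X j w)%N] `&` [set w | (i' < X j' w)%N])
  <= P [set w | (i < X j w)%N] * P [set w | (i' < X j' w)%N] + (be (j' - j) ^+ 3)%:E.
Hypothesis sum_be : forall n, (\sum_(0 <= i < n) be i <= B)%R.

Let mXi j i : measurable [set w | (i < X j w)%N].
Proof. exact: (nat_measurable_set [set k | (i < k)%N] (mX j)). Qed.

Let PrE A : measurable A -> P A = (Pr A)%:E.
Proof. by move=> mA; rewrite /Pr fineK // fin_num_measure. Qed.

Let a i : R := (k / i.+1%:R ^+ 2)%R.
Let a_ge0 i : (0 <= a i)%R. Proof. by rewrite divr_ge0 // exprn_ge0. Qed.
Let sum_a n : (\sum_(0 <= i < n) a i <= 2 * k)%R.
Proof.
rewrite /a -mulr_sumr mulrC ler_wpM2r // (le_trans _ (sum_inv_sqr n)) //.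
Qed.

Definition rv_mean : R := fine (\int[P]_w (X 0%N w)%:R%:E).

Let integralE j : \int[P]_w (X j w)%:R%:E = \sum_(0 <= n <oo) (Pr [set w | (n < X 0%N w)%N])%:E.
Proof. by rewrite integral_nat_on //; apply: eq_eseriesr => n _; rewrite setIT stat PrE. Qed.

Let integral_le : \int[P]_w (X 0%N w)%:R%:E <= (k ^+ 2 * (2 * k))%:E.
Proof.
rewrite integralE; apply: (@le_trans _ _ (\sum_(0 <= n <oo) (a n ^+ 3)%:E)).
  apply: lee_nneseries => [n _ _|n _]; first by rewrite lee_fin fine_ge0.
  by rewrite -PrE //; exact: tail.
apply: nneseries_le => [i|n]; first by rewrite exprn_ge0.
apply: (@le_trans _ _ (k ^+ 2 * \sum_(0 <= i < n) a i)%R); last by rewrite ler_wpM2l // exprn_ge0.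
rewrite mulr_sumr; apply: ler_sum => i _; rewrite exprSr ler_wpM2r //.
rewrite lerXn2r ?nnegrE // /a ler_pdivrMr ?exprn_gt0 // ler_peMr // exprn_ege1 //.
by rewrite ler1n.
Qed.

Lemma rv_meanE j : \int[P]_w (X j w)%:R%:E = rv_mean%:E.
Proof.
have -> : \int[P]_w (X j w)%:R%:E = \int[P]_w (X 0%N w)%:R%:E by rewrite !integralE.
rewrite /rv_mean fineK // ge0_fin_numE; last by apply: integral_ge0 => w _; rewrite lee_fin.
exact: le_lt_trans integral_le (ltry _).
Qed.

Lemma rv_mean_le : (rv_mean <= k ^+ 2 * (2 * k))%R.
Proof. by rewrite -lee_fin -(rv_meanE 0). Qed.

Lemma rv_mean_ge0 : (0 <= rv_mean)%R.
Proof. by rewrite /rv_mean fine_ge0 //; apply: integral_ge0 => w _; rewrite lee_fin. Qed.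

Let sum_p j : \sum_(0 <= n <oo) (Pr [set w | (n < X j w)%N])%:E = rv_mean%:E.
Proof.
rewrite -(rv_meanE j) integral_nat_on //; apply: eq_eseriesr => n _.
by rewrite setIT PrE.
Qed.

(** The covariance is the double sum over [i] and [n] of the dependence between
the events X j > i and X j' > n. The interpolation bounds a term by a product
of a function of [i], a function of [n] and the mixing rate. *)
Lemma second_moment_le j j' : (j <= j')%N ->
  \int[P]_w ((X j w)%:R * (X j' w)%:R)%:E
  <= (rv_mean ^+ 2 + be (j' - j) * (2 * k) ^+ 2)%:E.
Proof.
move=> jj; rewrite integral_natM //; set c := be (j' - j)%N.
have c0 : (0 <= c)%R by exact: be0.
pose p i := Pr [set w | (i < X j w)%N]; pose q i := Pr [set w | (i < X j' w)%N].
have p0 i : (0 <= p i)%R by rewrite fine_ge0.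
have q0 i : (0 <= q i)%R by rewrite fine_ge0.
have sa : \sum_(0 <= i <oo) (a i)%:E <= (2 * k)%:E by apply: nneseries_le.
apply: (@le_trans _ _ (\sum_(0 <= n <oo) (rv_mean%:E * (q n)%:E + (c * (2 * k))%:E * (a n)%:E))).
  apply: lee_nneseries => [n _ _|n _]; first exact: nneseries_ge0.
  apply: (@le_trans _ _ (\sum_(0 <= i <oo) ((q n)%:E * (p i)%:E + (c * a n)%:E * (a i)%:E))).
    apply: lee_nneseries => [i _ _|i _]; first by [].
    set A := [set w | (i < X j w)%N]; set D := [set w | (n < X j' w)%N].
    have mA : measurable A by exact: mXi.
    have mD : measurable D by exact: mXi.
    have mAD : measurable (A `&` D) by exact: measurableI.
    rewrite PrE // -!EFinM -EFinD lee_fin [(q n * p i)%R]mulrC -mulrA.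
    apply: cube_interpolation => //.
    - by rewrite -lee_fin /p -!PrE //; apply: le_measure; rewrite ?inE //; exact: subIsetl.
    - by rewrite -lee_fin /q -!PrE //; apply: le_measure; rewrite ?inE //; exact: subIsetr.
    - by rewrite -lee_fin /p -PrE //; exact: tail.
    - by rewrite -lee_fin /q -PrE //; exact: tail.
    - by rewrite -lee_fin EFinD EFinM /p /q -!PrE //; exact: mix.
  rewrite nneseriesD; try by (move=> i _ _; rewrite -EFinM lee_fin !mulr_ge0).
  rewrite !nneseriesZl; try by (move=> i _; rewrite lee_fin).
  rewrite sum_p; apply: leeD; first by rewrite muleC.
  apply: (@le_trans _ _ ((c * a n)%:E * (2 * k)%:E)).
    by apply: lee_wpmul2l => //; rewrite lee_fin mulr_ge0.
  rewrite -!EFinM lee_fin le_eqVlt; apply/orP; left; apply/eqP.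
  by rewrite mulrAC.
rewrite nneseriesD; try by (move=> i _ _; rewrite -EFinM lee_fin !mulr_ge0 // rv_mean_ge0).
rewrite !nneseriesZl; try by (move=> i _; rewrite lee_fin).
rewrite sum_p EFinD; apply: leeD; first by rewrite -EFinM lee_fin expr2.
apply: (@le_trans _ _ ((c * (2 * k))%:E * (2 * k)%:E)).
  by apply: lee_wpmul2l => //; rewrite lee_fin !mulr_ge0.
by rewrite -!EFinM lee_fin le_eqVlt; apply/orP; left; apply/eqP; ring.
Qed.

Definition window_sum j0 J (w : T) : R := (\sum_(j0 <= j < j0 + J) (X j w)%:R)%R.

Lemma measurable_window_sum j0 J : measurable_fun [set: T] (window_sum j0 J).
Proof.
rewrite /window_sum; elim: J => [|J IH].
  by rewrite addn0; under eq_fun do rewrite big_geq //; exact: measurable_cst.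
under eq_fun do rewrite addnS big_nat_recr ?leq_addr //=.
apply: measurable_funD => //; exact: (nat_measurable (fun n => n%:R%R) (mX _)).
Qed.

Lemma window_sum_ge0 j0 J w : (0 <= window_sum j0 J w)%R.
Proof. by apply: sumr_ge0. Qed.

Let mXR j : measurable_fun [set: T] (fun w => (X j w)%:R : R)%R.
Proof. exact: (nat_measurable (fun n => n%:R%R) (mX j)). Qed.

Lemma window_sum_mean j0 J : \int[P]_w (window_sum j0 J w)%:E = (J%:R * rv_mean)%:E.
Proof.
under eq_integral do rewrite /window_sum -sumEFin.
rewrite ge0_integral_sum //; last first.
  by move=> j; apply/measurable_EFinP; exact: mXR.
under eq_bigr do rewrite rv_meanE.
by rewrite sumEFin sumr_const_nat addKn mulr_natl.
Qed.

Lemma sum_be_row j0 J j : (j0 <= j < j0 + J)%N ->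
  (\sum_(j0 <= i < j0 + J) be ((i - j) + (j - i)) <= 2 * B)%R.
Proof.
move=> /andP[j0j jJ]; rewrite (big_cat_nat j0j (ltnW jJ)) /=.
suff [h1 h2] : (\sum_(j0 <= i < j) be ((i - j) + (j - i)) <= B /\
  \sum_(j <= i < j0 + J) be ((i - j) + (j - i)) <= B)%R by lra.
split.
  rewrite big_nat_rev /= -{1}[j0]add0n big_addn.
  apply: le_trans (sum_be (j - j0).+1); rewrite big_nat_recl //= -[leLHS]add0r lerD //.
  rewrite big_nat [leRHS]big_nat; apply: ler_sum => i ij.
  by rewrite (_ : _ + _ = i.+1)%N //; lia.
rewrite -{1}[j]add0n big_addn; apply: le_trans (sum_be (j0 + J - j)).
rewrite big_nat [leRHS]big_nat; apply: ler_sum => i ij.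
by rewrite (_ : _ + _ = i)%N //; lia.
Qed.

Lemma window_sum_sqr j0 J : \int[P]_w ((window_sum j0 J w) ^+ 2)%:E
  <= ((J%:R * rv_mean) ^+ 2 + (2 * k) ^+ 2 * (2 * B) * J%:R)%:E.
Proof.
have mXX j j' : measurable_fun [set: T] (fun w => ((X j w)%:R * (X j' w)%:R)%:E : \bar R).
  by apply/measurable_EFinP; apply: measurable_funM; exact: mXR.
have -> : \int[P]_w ((window_sum j0 J w) ^+ 2)%:E =
   \sum_(j0 <= j < j0 + J) \sum_(j0 <= j' < j0 + J) \int[P]_w ((X j w)%:R * (X j' w)%:R)%:E.
  transitivity (\int[P]_w \sum_(j0 <= j < j0 + J) \sum_(j0 <= j' < j0 + J) ((X j w)%:R * (X j' w)%:R)%:E).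
    apply: eq_integral => w _; rewrite expr2 /window_sum big_distrlr /= -sumEFin.
    by apply: eq_bigr => j _; rewrite sumEFin.
  rewrite ge0_integral_sum //; last 2 first.
  - by move=> j; apply: emeasurable_sum => j'.
  - by move=> j w _; apply: sume_ge0 => j' _; rewrite lee_fin mulr_ge0.
  by apply: eq_bigr => j _; rewrite ge0_integral_sum.
apply: (@le_trans _ _ (\sum_(j0 <= j < j0 + J) (J%:R * rv_mean ^+ 2 + (2 * k) ^+ 2 * (2 * B))%:E)).
  rewrite big_nat [leRHS]big_nat; apply: lee_sum => j jJ.
  apply: (@le_trans _ _ (\sum_(j0 <= j' < j0 + J)
     (rv_mean ^+ 2 + be ((j' - j) + (j - j')) * (2 * k) ^+ 2)%:E)).
    apply: lee_sum => j' _; have [jj|jj] := leqP j j'.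
      by rewrite (_ : j - j' = 0)%N ?addn0; [exact: second_moment_le|lia].
    under eq_integral do rewrite mulrC.
    by rewrite (_ : j' - j = 0)%N ?add0n; [exact: (second_moment_le (ltnW jj))|lia].
  rewrite sumEFin lee_fin big_split /=; apply: lerD; first by rewrite sumr_const_nat addKn mulr_natl.
  by rewrite -mulr_suml mulrC ler_wpM2l ?sqr_ge0 //; exact: sum_be_row.
rewrite sumEFin lee_fin sumr_const_nat addKn -[leLHS]mulr_natl le_eqVlt.
by apply/orP; left; apply/eqP; ring.
Qed.

(** Bienayme and Chebyshev for the partial sums: the covariances are summable,
so that the variance of the sum of [J] terms is at most of order [J]. *)
Lemma window_sum_concentration j0 J (e : R) : (0 < e)%R ->
  P [set w | (e <= `|window_sum j0 J w - J%:R * rv_mean|)%R]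
  <= ((2 * k) ^+ 2 * (2 * B) * J%:R / e ^+ 2)%:E.
Proof.
move=> e0; set c := (J%:R * rv_mean)%R; set V := ((2 * k) ^+ 2 * (2 * B) * J%:R)%R.
have c0 : (0 <= c)%R by rewrite mulr_ge0 // rv_mean_ge0.
have mS := measurable_window_sum j0 J; set S := window_sum j0 J in mS *.
have S0 w : (0 <= S w)%R by exact: window_sum_ge0.
have mD : measurable_fun [set: T] (fun w => (S w - c) ^+ 2)%R.
  by apply: measurable_funX; apply: measurable_funB => //; exact: measurable_cst.
have var : \int[P]_w ((S w - c) ^+ 2)%:E <= V%:E.
  have E : \int[P]_w ((S w - c) ^+ 2)%:E + (2 * c * c)%:E = \int[P]_w ((S w) ^+ 2)%:E + (c ^+ 2)%:E.
    have <- : \int[P]_w (2 * c * S w)%:E = (2 * c * c)%:E.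
      under eq_integral do rewrite EFinM.
      rewrite ge0_integralZl_EFin //; last 3 first.
      - by move=> w _; rewrite lee_fin window_sum_ge0.
      - exact/measurable_EFinP.
      - by rewrite mulr_ge0.
      by rewrite window_sum_mean -EFinM.
    have <- := integral_prob_cst (c ^+ 2).
    have n1 w : [set: T] w -> 0 <= ((S w - c) ^+ 2)%:E by rewrite lee_fin sqr_ge0.
    have n2 w : [set: T] w -> 0 <= (2 * c * S w)%:E.
      by move=> _; rewrite lee_fin; apply: mulr_ge0; [exact: mulr_ge0|exact: S0].
    have n3 w : [set: T] w -> 0 <= (S w ^+ 2)%:E by rewrite lee_fin sqr_ge0.
    have n4 w : [set: T] w -> 0 <= cst (c ^+ 2)%:E w by rewrite lee_fin sqr_ge0.
    have m1 : measurable_fun [set: T] (fun w => ((S w - c) ^+ 2)%:E) by exact/measurable_EFinP.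
    have m2 : measurable_fun [set: T] (fun w => (2 * c * S w)%:E).
      by apply/measurable_EFinP; apply: measurable_funM => //; exact: measurable_cst.
    have m3 : measurable_fun [set: T] (fun w => (S w ^+ 2)%:E).
      by apply/measurable_EFinP; apply: measurable_funX.
    rewrite -(ge0_integralD P measurableT n1 m1 n2 m2).
    rewrite -(ge0_integralD P measurableT n3 m3 n4 (measurable_cst _)).
    apply: eq_integral => w _; rewrite -!EFinD; congr EFin; ring.
  have le2 := window_sum_sqr j0 J; rewrite -/S -/c -/V in le2.
  rewrite -(@leeD2rE _ (2 * c * c)%:E) // E.
  apply: le_trans (leeD2r _ le2) _; rewrite -!EFinD lee_fin; lra.
have mA : measurable [set w | (e <= `|S w - c|)%R].
  by apply: measurable_norm_ge; apply: measurable_funB => //; exact: measurable_cst.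
have e2 : (0 < e ^+ 2)%R by rewrite exprn_gt0.
rewrite -(@lee_pmul2l _ (e ^+ 2)%:E) ?lte_fin //.
rewrite -EFinM [X in _ <= X%:E]mulrC divfK ?gt_eqF //.
apply: le_trans var; rewrite -integral_cst //.
apply: (@le_trans _ _ (\int[P]_(w in [set w | (e <= `|S w - c|)%R]) ((S w - c) ^+ 2)%:E)).
  apply: ge0_le_integral => //.
  - by move=> w _; rewrite lee_fin ltW.
  - by apply/measurable_EFinP; exact: measurable_funTS.
  - move=> w /= h; rewrite lee_fin -[((S w - c) ^+ 2)%R]real_normK ?num_real //.
    by rewrite lerXn2r // ?nnegrE // ltW.
apply: ge0_subset_integral => //; first exact/measurable_EFinP.
by move=> w _; rewrite lee_fin sqr_ge0.
Qed.
End Sums.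
End Concentration.

(** * The point process: mixing rates and tails *)

Section Bounds.
Context {d : measure_display} {T : measurableType d} {R : realType}.
Variables (P : probability T R) (barN : 'I_2 -> R -> T -> nat).

Definition mixing_with (c1 c2 : R) : Prop :=
  forall (u k : R) (A B : set T), 0 <= u -> 0 <= k ->
  sigma_incr barN (fun s t => 0 <= s /\ t <= u) A ->
  sigma_incr barN (fun s t => u + k <= s) B ->
  (`| P (A `&` B) - P A * P B | <= (c1 * expR (- c2 * k))%:E)%E.

(** The exponent 6 leaves, after the cube root taken in the covariance bound,
a summable tail of order -2. *)
Definition unit_tail_bound (cm : R) : Prop := forall l i,
  (P [set w | (i < barN l 1 w)%N] <= (cm / i.+1%:R ^+ 6)%:E)%E.

Definition void_bound (cv : R) (n0 : nat) : Prop :=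
  forall l (v : nat), (n0 <= v)%N -> (0 < v)%N ->
  (P [set w | barN l v%:R w = 0%N] <= (cv / v%:R ^+ 2)%:E)%E.
End Bounds.

Section PointProcess.
Context {d : measure_display} {T : measurableType d} {R : realType}.
Variables (P : probability T R) (barN : 'I_2 -> R -> T -> nat).
Hypothesis barN_point : forall l, point_process (barN l).

Lemma barN_homo l w s t : 0 <= s -> s <= t -> (barN l s w <= barN l t w)%N.
Proof. by have [_ /(_ w) [_ Nh _ _]] := barN_point l; exact: Nh. Qed.

Lemma barN_start l w : barN l 0 w = 0%N.
Proof. by have [_ /(_ w) [-> _ _ _]] := barN_point l. Qed.

Lemma discrete_barN l t : 0 <= t -> discrete_in measurable (barN l t).
Proof. by move=> t0; apply/discrete_natP; have [+ _] := barN_point l; exact. Qed.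

Lemma discrete_incr l s t : 0 <= s -> 0 <= t -> discrete_in measurable (incr (barN l) s t).
Proof.
move=> s0 t0; apply: (@discrete_comp T measurable _ _ (fun z => z.1 - z.2)%N (fun w => (barN l t w, barN l s w))).
by apply: discrete_pair; [exact: sigma_algebra_measurable| |]; exact: discrete_barN.
Qed.

Section Mixing.
Variables (c1 c2 : R).
Hypotheses (c1_gt0 : 0 < c1) (c2_gt0 : 0 < c2).
Hypothesis mixing : mixing_with P barN c1 c2.

(** Chosen so that the cube of [mix_rate k] bounds the dependence between two
cells whose indices differ by [k], adjacent and equal cells included. *)
Definition mix_rate (k : nat) : R :=
  (1 + c1) * expR (c2 / 3) * expR (- (c2 / 3)) ^+ k.

Definition mix_total : R := (1 + c1) * expR (c2 / 3) / (1 - expR (- (c2 / 3))).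

Let q_lt1 : expR (- (c2 / 3)) < 1.
Proof. by rewrite expR_lt1 oppr_lt0 divr_gt0. Qed.

Lemma mix_rate_ge0 k : 0 <= mix_rate k.
Proof. by rewrite /mix_rate !mulr_ge0 ?exprn_ge0 ?expR_ge0 // addr_ge0 // ltW. Qed.

Lemma mix_total_ge0 : 0 <= mix_total.
Proof.
rewrite /mix_total divr_ge0 //; last by rewrite subr_ge0 ltW.
by rewrite mulr_ge0 ?expR_ge0 // addr_ge0 // ltW.
Qed.

Lemma sum_mix_rate n : \sum_(0 <= i < n) mix_rate i <= mix_total.
Proof.
have q1 := q_lt1; set q := expR _ in q1.
rewrite /mix_rate -mulr_sumr -/q /mix_total -/q ler_wpM2l //.
  by rewrite mulr_ge0 ?expR_ge0 // addr_ge0 // ltW.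
rewrite big_mkord -[leRHS]mul1r ler_pdivlMr ?subr_gt0 //.
have -> : (\sum_(i < n) q ^+ i) * (1 - q) = 1 - q ^+ n.
  by have := subrX1 q n; rewrite -[q - 1]opprB mulNr => /(congr1 -%R); rewrite opprB opprK mulrC => ->.
by rewrite gerBl exprn_ge0 // expR_ge0.
Qed.

Lemma cube_ge1D (c : R) : 0 <= c -> 1 + c <= (1 + c) ^+ 3.
Proof. by move=> c0; rewrite -[leLHS]expr1 ler_weXn2l //; lra. Qed.

Lemma mix_rate_cube k : c1 * expR (- c2 * k%:R) <= mix_rate k.+1 ^+ 3.
Proof.
have -> : mix_rate k.+1 = (1 + c1) * expR (- (c2 / 3)) ^+ k.
  rewrite /mix_rate exprS mulrA -[_ * _ * expR (- _)]mulrA -expRD subrr.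
  by rewrite expR0 mulr1.
have -> : expR (- c2 * k%:R) = (expR (- (c2 / 3)) ^+ k) ^+ 3.
  rewrite -exprM -expRM_natl; congr expR; rewrite natrM; lra.
rewrite exprMn ler_wpM2r ?exprn_ge0 ?expR_ge0 //.
by apply: le_trans (cube_ge1D (ltW c1_gt0)); lra.
Qed.

Lemma mix_rate0_cube : 1 <= mix_rate 0 ^+ 3.
Proof.
apply: exprn_ege1; rewrite /mix_rate expr0 mulr1.
have : 1 <= expR (c2 / 3) by rewrite -expR0 ler_expR divr_ge0 // ltW.
by move=> h; apply: le_trans h _; rewrite ler_peMl ?expR_ge0 //; rewrite lerDl ltW.
Qed.

(** Stated with the past of the end of the cell [j * b, (j + 1) * b] and the future
of its start, since these are the sigma-algebras that mixing compares. *)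
Definition adapted (b : nat) (X : nat -> T -> nat) : Prop := forall j,
  discrete_in (sigma_incr barN (fun s t => 0 <= s /\ t <= (j.+1 * b)%:R)) (X j) /\
  discrete_in (sigma_incr barN (fun s t => (j * b)%:R <= s)) (X j).

Lemma sigma_incr_measurable (D : R -> R -> Prop) :
  (forall s t, D s t -> 0 <= s) -> sigma_incr barN D `<=` measurable.
Proof.
move=> Dpos; apply: smallest_sub; first exact: sigma_algebra_measurable.
move=> _ [l [s [t [B [st Dst ->]]]]]; have s0 := Dpos _ _ Dst.
by apply: discrete_incr => //; apply: le_trans s0 (ltW st).
Qed.

Lemma adapted_measurable b X j : adapted b X -> measurable_fun [set: T] (X j).
Proof.
move=> /(_ j) [aX _]; apply/discrete_natP => B.
by apply: (@sigma_incr_measurable (fun s t => 0 <= s /\ t <= (j.+1 * b)%:R)) => [s t []|//].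
Qed.

(** Cells [j] and [j + k + 1] are separated by [k * b] units of time. For equal
cells the bound is trivial. *)
Lemma adapted_mixing b X : (0 < b)%N -> adapted b X -> forall j j' i i', (j <= j')%N ->
  (P ([set w | (i < X j w)%N] `&` [set w | (i' < X j' w)%N])
  <= P [set w | (i < X j w)%N] * P [set w | (i' < X j' w)%N] + (mix_rate (j' - j) ^+ 3)%:E)%E.
Proof.
move=> b0 aX j j' i i'.
have mX q n : measurable [set w | (n < X q w)%N].
  exact: (nat_measurable_set [set k | (n < k)%N] (adapted_measurable _ aX)).
have mA := mX j i; have mB := mX j' i'.
set A := [set w | (i < X j w)%N] in mA *; set B := [set w | (i' < X j' w)%N] in mB *.
rewrite leq_eqVlt => /orP[/eqP <-|jj].
  rewrite subnn; apply: (@le_trans _ _ 1%E); first by apply: probability_le1; exact: measurableI.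
  by apply: (le_trans _ (leeDr _ _)); rewrite ?lee_fin ?mix_rate0_cube // mule_ge0.
have [k jk] : exists k, (j' = j.+1 + k)%N by exists (j' - j.+1)%N; lia.
have -> : (j' - j = k.+1)%N by lia.
have fAB : P (A `&` B) \is a fin_num by apply: fin_num_measure; exact: measurableI.
have fA : P A \is a fin_num by apply: fin_num_measure.
have fB : P B \is a fin_num by apply: fin_num_measure.
have AB : (`| P (A `&` B) - P A * P B | <= (c1 * expR (- c2 * (k * b)%:R))%:E)%E.
  apply: (@mixing (j.+1 * b)%:R (k * b)%:R) => //.
    by have [aA _] := aX j; apply: (aA [set n | (i < n)%N]).
  have [_ aB] := aX j'; have := aB [set n | (i' < n)%N].
  by rewrite -natrD -mulnDl -jk.
rewrite -(fineK fAB) -(fineK fA) -(fineK fB) -!EFinM -!EFinD !lee_fin in AB *.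
apply: (@le_trans _ _ (fine (P A) * fine (P B) + c1 * expR (- c2 * (k * b)%:R))).
  by rewrite -lerBlDl; apply: le_trans (ler_norm _) AB.
rewrite lerD2l; apply: le_trans (mix_rate_cube k).
rewrite ler_wpM2l ?(ltW c1_gt0) // ler_expR !mulNr lerN2 ler_wpM2l ?(ltW c2_gt0) //.
by rewrite ler_nat leq_pmulr.
Qed.
End Mixing.

Section Stationarity.
Hypothesis stationary : stationary_increments P barN.

Lemma incr_tail_stationary l (v s s' : R) (B : set nat) : 0 < v -> 0 <= s -> 0 <= s' ->
  P (incr (barN l) s (s + v) @^-1` B) = P (incr (barN l) s' (s' + v) @^-1` B).
Proof.
move=> v0 s0 s0'.
have := @stationary 1 (fun k => k%:R * v) (leqnn _).
rewrite mul0r lexx => /(_ isT) /(_ _) st.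
have {}st := st (fun k _ => ltac:(by rewrite ltr_pM2r // ltr_nat))
  [set f : 'I_2 -> 'I_1 -> nat | B (f l ord0)] s s' s0 s0'.
have E x : (incr (barN l) x (x + v)) @^-1` B =
   (fun w => fun (l : 'I_2) (k : 'I_1) => incr (barN l) (x + k%:R * v) (x + k.+1%:R * v) w) @^-1`
   [set f : 'I_2 -> 'I_1 -> nat | B (f l ord0)].
  by apply/seteqP; split=> w /=; rewrite mul0r addr0 mul1r.
by rewrite !E.
Qed.

Definition cell_incr b l j (w : T) : nat := incr (barN l) (j * b)%:R (j.+1 * b)%:R w.

Section Void.
Variables (cv : R) (n0 : nat).
Hypothesis void : void_bound P barN cv n0.

Lemma cell_void l v j : (n0 <= v)%N -> (0 < v)%N ->
  (P [set w | cell_incr v l j w = 0%N] <= (cv / v%:R ^+ 2)%:E)%E.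
Proof.
move=> vn v0.
have := @incr_tail_stationary l v%:R (j * v)%:R 0 [set 0%N].
rewrite ltr0n v0 lexx ler0n -natrD => /(_ isT isT isT).
rewrite addnC -mulSn add0r => E.
have -> : P [set w | cell_incr v l j w = 0%N] = P (incr (barN l) 0 v%:R @^-1` [set 0%N]) by [].
have -> : incr (barN l) 0 v%:R @^-1` [set 0%N] = [set w | barN l v%:R w = 0%N].
  by apply/seteqP; split => w /=; rewrite /incr barN_start // subn0.
exact: void.
Qed.

Lemma void_length (eps : R) : 0 < eps ->
  exists u, [/\ (0 < u)%N, (n0 <= u)%N & cv / u%:R ^+ 2 <= eps].
Proof.
move=> e0; pose u := maxn n0 (Num.truncn (`|cv| / eps)).+1; exists u.
have u0 : (0 < u)%N by rewrite leq_max orbT.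
split=> //; first by rewrite leq_maxl.
have u1 : 1 <= u%:R :> R by rewrite ler1n.
rewrite ler_pdivrMr ?exprn_gt0 ?ltr0n // mulrC -ler_pdivrMr //.
apply: (@le_trans _ _ (`|cv| / eps)); first by rewrite ler_pM2r ?invr_gt0 // ler_norm.
apply: (@le_trans _ _ u%:R); last by rewrite expr2 ler_peMr.
by apply/ltW/(lt_le_trans (truncnS_gt _)); rewrite ler_nat leq_maxr.
Qed.
End Void.

Variable cm : R.
Hypothesis cm0 : 0 <= cm.
Hypothesis unit_tail : unit_tail_bound P barN cm.

Definition tail_cst b : R := 1 + 64 * cm * b%:R ^+ 7.

Lemma tail_cst_ge0 b : 0 <= tail_cst b.
Proof. by rewrite /tail_cst addr_ge0 // !mulr_ge0 // exprn_ge0. Qed.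

Lemma discrete_cell_incr b l j : discrete_in measurable (cell_incr b l j).
Proof. by apply: discrete_incr. Qed.

(** An increment over [b] units of time reaches [i] only if one of the unit
increments reaches [i / b]. The successor makes the bound apply to the trace over
the cell as well, which may exceed the increment by one. *)
Lemma cell_incr_tail b l j i : (0 < b)%N ->
  (P [set w | (i < (cell_incr b l j w).+1)%N] <= ((tail_cst b / i.+1%:R ^+ 2) ^+ 3)%:E)%E.
Proof.
move=> b0; have kge0 := tail_cst_ge0 b.
have k1 : 1 <= tail_cst b by rewrite /tail_cst lerDl !mulr_ge0 // exprn_ge0.
have mI : measurable [set w | (i < (cell_incr b l j w).+1)%N].
  exact: (discrete_cell_incr b l j [set n | (i < n.+1)%N]).
case: i mI => [|i] mI.
  apply: (le_trans (probability_le1 P mI)).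
  by rewrite expr1n divr1 lee_fin exprn_ege1.
pose U q := [set w | (i.+1 <= b * incr (barN l) (j * b + q)%:R (j * b + q).+1%:R w)%N].
have mU q : measurable (U q).
  by apply: (@discrete_incr l (j * b + q)%:R (j * b + q).+1%:R _ _ [set n | (i.+1 <= b * n)%N]).
have PU q : (P (U q) <= (cm * b%:R ^+ 6 * 64 / i.+2%:R ^+ 6)%:E)%E.
  have -> : P (U q) = P [set w | (i.+1 <= b * barN l 1 w)%N].
    have := @incr_tail_stationary l 1 (j * b + q)%:R 0 [set n | (i.+1 <= b * n)%N].
    rewrite ltr01 lexx ler0n => /(_ isT isT isT).
    rewrite /U -natr1 => ->; congr (P _); apply/seteqP.
    by split=> w /=; rewrite /incr add0r barN_start subn0.
  pose i' := (i %/ b)%N.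
  apply: (@le_trans _ _ (P [set w | (i' < barN l 1 w)%N])).
    apply: le_measure; rewrite ?inE.
    - exact: (@discrete_barN l 1 ler01 [set n | (i.+1 <= b * n)%N]).
    - exact: (@discrete_barN l 1 ler01 [set n | (i' < n)%N]).
    - by move=> w /= h; rewrite /i' ltn_divLR // mulnC.
  apply: le_trans (unit_tail l i') _; rewrite lee_fin.
  have b0' : 0 < b%:R :> R by rewrite ltr0n.
  have -> : cm * b%:R ^+ 6 * 64 / i.+2%:R ^+ 6 = cm * (b%:R * 2 / i.+2%:R) ^+ 6 :> R.
    by rewrite !exprMn exprVn -!mulrA; congr (_ * (_ * (_ * _))); ring.
  rewrite ler_wpM2l //.
  rewrite -exprVn lerXn2r ?nnegrE ?invr_ge0 // ler_pdivlMr ?ltr0n //.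
  rewrite mulrC ler_pdivrMr ?ltr0n // -!natrM ler_nat.
  have := ltn_ceil i b0; rewrite /i'; set z := (i %/ b)%N; nia.
have sub : [set w | (i.+1 < (cell_incr b l j w).+1)%N] `<=` \big[setU/set0]_(q < b) U q.
  move=> w /= h; apply: contrapT => nU.
  have small q : (q < b)%N -> (b * incr (barN l) (j * b + q)%:R (j * b + q).+1%:R w <= i)%N.
    move=> qb; rewrite leqNgt; apply/negP => hq; apply: nU.
    by rewrite (bigD1 (Ordinal qb)) //=; left.
  have tele n : (n <= b)%N -> (b * incr (barN l) (j * b)%:R (j * b + n)%:R w <= n * i)%N.
    elim: n => [|n IH] nb; first by rewrite addn0 /incr subnn muln0.
    have := IH (ltnW nb); have := small n nb; rewrite /incr addnS.
    have := @barN_homo l w (j * b)%:R (j * b + n)%:R (ler0n _ _).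
    have := @barN_homo l w (j * b + n)%:R (j * b + n).+1%:R (ler0n _ _).
    rewrite !ler_nat leqnSn leq_addr => /(_ isT) h1 /(_ isT) h2.
    by rewrite mulSn; nia.
  have := tele b (leqnn _); move: h; rewrite /cell_incr mulSn addnC ltnS; nia.
apply: (@le_trans _ _ (P (\big[setU/set0]_(q < b) U q))).
  by apply: le_measure; rewrite ?inE //; apply: bigsetU_measurable.
apply: (le_trans (@Boole_inequality _ _ _ P U b (fun q _ => mU q))).
apply: (@le_trans _ _ (\sum_(q < b) (cm * b%:R ^+ 6 * 64 / i.+2%:R ^+ 6)%:E)%E).
  by apply: lee_sum => q _; exact: PU.
rewrite sumEFin lee_fin sumr_const card_ord -[leLHS]mulr_natl exprMn exprVn -exprM.
rewrite mulrA ler_wpM2r ?invr_ge0 ?exprn_ge0 //.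
have c0 : 0 <= 64 * cm * b%:R ^+ 7 by rewrite !mulr_ge0 // exprn_ge0.
apply: le_trans (cube_ge1D c0).
have -> : b%:R * (cm * b%:R ^+ 6 * 64) = 64 * cm * b%:R ^+ 7 by ring.
lra.
Qed.
End Stationarity.
End PointProcess.

(** * Cells *)

Section Cells.
Context {d : measure_display} {T : measurableType d} {R : realType}.
Variables (P : probability T R) (barN : 'I_2 -> R -> T -> nat).
Hypothesis barN_point : forall l, point_process (barN l).

(** The labels inside a cell, counted from its start: they determine the classes
and depend on the increments only. *)
Definition cell_path K (v : 'I_2 -> 'I_K -> nat) (l : 'I_2) (y : nat) : nat :=
  (\sum_(k < K | (k < y)%N) v l k)%N.

Definition cell_trace p K (v : 'I_2 -> 'I_K -> nat) : R :=
  loop_trace K p.+1 (cell_path v ix1) (cell_path v ix2).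

Definition incr_vec (r K : nat) (s : R) (w : T) : 'I_2 -> 'I_K -> nat :=
  fun l k => incr (barN l) (s + k%:R / r.+1%:R) (s + k.+1%:R / r.+1%:R) w.

(** The integer part is taken because the moments of integer valued variables
are plain sums of probabilities; the error is at most one per cell. *)
Definition cell_rv (p r b j : nat) (w : T) : nat :=
  Num.truncn (cell_trace p (@incr_vec r (b * r.+1) (j * b)%:R w)).

Lemma discrete_incr_vec (SS : set (set T)) r K s : sigma_algebra [set: T] SS ->
  (forall l k, (k < K)%N ->
     discrete_in SS (incr (barN l) (s + k%:R / r.+1%:R) (s + k.+1%:R / r.+1%:R))) ->
  discrete_in SS (@incr_vec r K s).
Proof.
move=> sSS dI.
pose Y l k := incr (barN l) (s + k%:R / r.+1%:R) (s + k.+1%:R / r.+1%:R).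
pose dec (z : seq nat * seq nat) : 'I_2 -> 'I_K -> nat :=
  fun l k => nth 0%N (if l == ix1 then z.1 else z.2) k.
have -> : @incr_vec r K s = dec \o (fun w => ([seq Y ix1 i w | i <- iota 0 K], [seq Y ix2 i w | i <- iota 0 K])).
  apply/funext => w; apply/funext => l; apply/funext => k; rewrite /dec /=.
  by have [->|->] := ix_cases l; rewrite (nth_map 0%N) ?size_iota // nth_iota.
apply: discrete_comp; apply: discrete_pair => //; apply: discrete_seq => // i;
  by rewrite mem_iota => /andP[_ iK]; exact: dI.
Qed.

Lemma cell_rv_adapted p r b : (0 < b)%N -> adapted barN b (cell_rv p r b).
Proof.
move=> b0 j.
have dv (D : R -> R -> Prop) :
    (forall k : nat, (k < b * r.+1)%N ->
      D ((j * b)%:R + k%:R / r.+1%:R) ((j * b)%:R + k.+1%:R / r.+1%:R)) ->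
    discrete_in (sigma_incr barN D) (cell_rv p r b j).
  move=> Dk; apply: (@discrete_comp _ _ _ _ (fun v => Num.truncn (cell_trace p v))
    (@incr_vec r (b * r.+1) (j * b)%:R)).
  apply: discrete_incr_vec; first exact: smallest_sigma_algebra.
  move=> l k kK B; apply: sub_sigma_algebra.
  exists l, ((j * b)%:R + k%:R / r.+1%:R), ((j * b)%:R + k.+1%:R / r.+1%:R), B.
  by split=> //; [rewrite ltrD2l ltr_pM2r ?invr_gt0 ?ltr0n // ltr_nat|exact: Dk].
split; apply: dv => k kK.
  split; first by rewrite addr_ge0 // divr_ge0.
  rewrite mulSn addnC natrD lerD2l ler_pdivrMr ?ltr0n //.
  by rewrite -natrM ler_nat.
by rewrite lerDl divr_ge0.
Qed.

Lemma cell_path_telescope r K s w l y : 0 <= s -> (y <= K)%N ->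
  (barN l s w + cell_path (@incr_vec r K s w) l y)%N = barN l (s + y%:R / r.+1%:R) w.
Proof.
move=> s0; rewrite /cell_path.
have E z : (z <= K)%N -> (\sum_(k < K | (k < z)%N) @incr_vec r K s w l k =
    \sum_(0 <= k < z) incr (barN l) (s + k%:R / r.+1%:R) (s + k.+1%:R / r.+1%:R) w)%N.
  by move=> zK; rewrite (big_nat_widen _ _ K) // big_mkord.
move=> yK; rewrite E //; elim: y yK => [|y IH] yK.
  by rewrite big_geq // addn0 mul0r addr0.
rewrite big_nat_recr //= addnA IH ?(ltnW yK) // /incr subnKC //.
apply: barN_homo => //; first by rewrite addr_ge0 // divr_ge0.
by rewrite lerD2l ler_pM2r ?invr_gt0 ?ltr0n // ler_nat.
Qed.

Lemma cell_path_homo K (v : 'I_2 -> 'I_K -> nat) l : {homo cell_path v l : x y / (x <= y)%N}.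
Proof.
move=> x y xy; rewrite /cell_path [leqRHS](bigID (fun k : 'I_K => (k < x)%N)) /=.
rewrite (eq_bigl (fun k : 'I_K => (k < y)%N && (k < x)%N)) ?leq_addr //.
by move=> k; lia.
Qed.

Lemma cell_trace_bounds p K (v : 'I_2 -> 'I_K -> nat) :
  0 <= cell_trace p v <= (cell_path v ix1 K).+1%:R.
Proof.
have /andP[h0 h1] := @loop_trace_bounds R K p (cell_path v ix1) (cell_path v ix2) (@cell_path_homo _ _ _).
rewrite /cell_trace h0 /=; apply: le_trans h1 _; rewrite ler_nat ltnS leq_subr //.
Qed.

Lemma cell_end b r j : (j * b)%:R + (b * r.+1)%:R / r.+1%:R = (j.+1 * b)%:R :> R.
Proof. by rewrite [(b * _)%:R]natrM mulfK ?pnatr_eq0 // -natrD mulSn addnC. Qed.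

Lemma cell_rv_le p r b j w : (cell_rv p r b j w <= (cell_incr barN b ix1 j w).+1)%N.
Proof.
rewrite /cell_rv; set v := incr_vec _ _ _.
have /andP[h0 h1] := cell_trace_bounds p v.
have -> : cell_incr barN b ix1 j w = cell_path v ix1 (b * r.+1).
  rewrite /cell_incr /incr -(cell_end b r) -(@cell_path_telescope r (b * r.+1) _ w ix1) //.
  by rewrite addKn.
by rewrite -[leqRHS](@natrK R) le_truncn.
Qed.

Lemma cell_rv_stationary p r b j (B : set nat) : stationary_increments P barN -> (0 < b)%N ->
  P (cell_rv p r b j @^-1` B) = P (cell_rv p r b 0 @^-1` B).
Proof.
move=> st b0.
have := st (b * r.+1)%N (fun k => k%:R / r.+1%:R).
rewrite muln_gt0 b0 /= mul0r lexx => /(_ isT isT) {}st.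
have tau k : (k < b * r.+1)%N -> k%:R / r.+1%:R < k.+1%:R / r.+1%:R :> R.
  by move=> _; rewrite ltr_pM2r ?invr_gt0 ?ltr0n // ltr_nat.
have := st tau [set v | B (Num.truncn (cell_trace p v))] (j * b)%:R (0 * b)%:R.
by rewrite !ler0n => /(_ isT isT).
Qed.

Section WellMixing.
Variables (c1 c2 cm : R).
Hypotheses (c1_gt0 : 0 < c1) (c2_gt0 : 0 < c2).
Hypothesis mixing : mixing_with P barN c1 c2.
Hypothesis stationary : stationary_increments P barN.
Hypothesis cm0 : 0 <= cm.
Hypothesis unit_tail : unit_tail_bound P barN cm.

(** What the concentration inequality asks of the cell variables, in the form
shared by traces and counts. *)
Definition well_mixing (X : nat -> T -> nat) (k : R) : Prop :=
  [/\ forall j, measurable_fun [set: T] (X j),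
      0 <= k,
      forall j i, (P [set w | (i < X j w)%N] <= ((k / i.+1%:R ^+ 2) ^+ 3)%:E)%E,
      forall j i, P [set w | (i < X j w)%N] = P [set w | (i < X 0%N w)%N]
    & forall j j' i i', (j <= j')%N ->
      (P ([set w | (i < X j w)%N] `&` [set w | (i' < X j' w)%N])
      <= P [set w | (i < X j w)%N] * P [set w | (i' < X j' w)%N]
         + (mix_rate c1 c2 (j' - j) ^+ 3)%:E)%E].

Definition var_cst (k : R) : R := (2 * k) ^+ 2 * (2 * mix_total c1 c2).

Lemma var_cst_ge0 k : 0 <= var_cst k.
Proof. by rewrite /var_cst mulr_ge0 ?sqr_ge0 // mulr_ge0 // mix_total_ge0. Qed.

Lemma well_mixing_concentration X k : well_mixing X k -> forall j0 J (e : R), 0 < e ->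
  (P [set w | (e <= `|window_sum X j0 J w - J%:R * rv_mean P X|)%R]
   <= (var_cst k * J%:R / e ^+ 2)%:E)%E.
Proof.
move=> [h1 h2 h3 h4 h5] j0 J e e0.
exact: (window_sum_concentration h1 h2 h3 h4 (mix_rate_ge0 _ c1_gt0) h5 (sum_mix_rate c1_gt0 c2_gt0)).
Qed.

Lemma cell_rv_well_mixing p r b : (0 < b)%N -> well_mixing (cell_rv p r b) (tail_cst cm b).
Proof.
move=> b0; have ad := cell_rv_adapted p r b0.
have mX j : measurable_fun [set: T] (cell_rv p r b j) by exact: (adapted_measurable barN_point j ad).
split=> //.
- exact: tail_cst_ge0.
- move=> j i; apply: le_trans (cell_incr_tail barN_point stationary cm0 unit_tail ix1 j i b0).
  apply: le_measure; rewrite ?inE.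
  + exact: (nat_measurable_set [set k | (i < k)%N] (mX j)).
  + exact: (discrete_cell_incr barN_point b ix1 j [set n | (i < n.+1)%N]).
  + by move=> w /= h; apply: leq_trans h (cell_rv_le _ _ _ _ _).
- by move=> j i; exact: (cell_rv_stationary p r j [set k | (i < k)%N] stationary b0).
- exact: (adapted_mixing barN_point c1_gt0 c2_gt0 mixing b0 ad).
Qed.

Lemma cell_incr_adapted b l : (0 < b)%N -> adapted barN b (cell_incr barN b l).
Proof.
move=> b0 j; split=> B; apply: sub_sigma_algebra; exists l, (j * b)%:R, (j.+1 * b)%:R, B.
  by split=> //; rewrite ltr_nat ltn_pmul2r.
by split=> //; rewrite ltr_nat ltn_pmul2r.
Qed.

Lemma cell_incr_well_mixing b l : (0 < b)%N -> well_mixing (cell_incr barN b l) (tail_cst cm b).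
Proof.
move=> b0; have ad := cell_incr_adapted l b0.
have mX j : measurable_fun [set: T] (cell_incr barN b l j) by exact: (adapted_measurable barN_point j ad).
split=> //.
- exact: tail_cst_ge0.
- move=> j i; apply: le_trans (cell_incr_tail barN_point stationary cm0 unit_tail l j i b0).
  apply: le_measure; rewrite ?inE.
  + exact: (nat_measurable_set [set k | (i < k)%N] (mX j)).
  + exact: (discrete_cell_incr barN_point b l j [set n | (i < n.+1)%N]).
  + by move=> w /= h; exact: ltnW.
- move=> j i; have := incr_tail_stationary stationary l [set k | (i < k)%N].
  have E q : (q.+1 * b)%:R = (q * b)%:R + b%:R :> R by rewrite -natrD mulSn addnC.
  move=> /(_ b%:R (j * b)%:R (0 * b)%:R); rewrite -!E; apply => //.
  by rewrite ltr0n.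
- exact: (adapted_mixing barN_point c1_gt0 c2_gt0 mixing b0 ad).
Qed.
End WellMixing.
End Cells.

(** * Cells decouple up to bounded errors *)

Lemma truncn_dist (R : realType) (x : R) : 0 <= x -> `|(Num.truncn x)%:R - x| <= 1.
Proof.
move=> x0; have /andP[h1 h2] := truncn_itv x0.
by rewrite -natr1 in h2; rewrite ler_norml; apply/andP; split; lra.
Qed.

Lemma bounded_cluster (R : realType) (u : nat -> R) (A : R) :
  (forall n, 0 <= u n <= A) ->
  exists a, 0 <= a /\ forall e, 0 < e -> forall n0, exists2 n, (n0 <= n)%N & `|u n - a| < e.
Proof.
move=> uA; have := @segment_compact R 0 A (u @ \oo) _.
have Fu : (u @ \oo) [set x | x \in `[0, A]].
  by exists 0%N => // n _ /=; rewrite in_itv /=.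
move=> /(_ _ Fu) [a [aA cl]]; exists a; split; first by move: aA; rewrite /= in_itv /= => /andP[].
move=> e e0 n0.
have [||x [[n n0n <-] xe]] := cl [set u n | n in [set n | (n0 <= n)%N]] (ball a e).
- by exists n0 => // n /= nn; exists n.
- exact: nbhsx_ballx.
by exists n => //; rewrite distrC; exact: xe.
Qed.

Section Paths.
Context {d : measure_display} {T : measurableType d} {R : realType}.
Variables (P : probability T R) (barN : 'I_2 -> R -> T -> nat).
Hypothesis barN_point : forall l, point_process (barN l).

Definition sampled_path (r : nat) (l : 'I_2) (w : T) (x : nat) : nat :=
  barN l (x%:R / r.+1%:R) w.

Lemma sampled_path_homo r l w : {homo sampled_path r l w : x y / (x <= y)%N}.
Proof.
move=> x y xy; apply: barN_homo => //.
by rewrite ler_pM2r ?invr_gt0 ?ltr0n // ler_nat.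
Qed.

Lemma sampled_path_cell r b l w j x : (x <= b * r.+1)%N ->
  sampled_path r l w (j * (b * r.+1) + x)%N =
  (barN l (j * b)%:R w + cell_path (@incr_vec _ _ _ barN r (b * r.+1) (j * b)%:R w) l x)%N.
Proof.
move=> xb; rewrite (cell_path_telescope barN_point) //; congr (barN l _ w).
by rewrite natrD mulrDl mulnA [(_ * r.+1)%:R]natrM mulfK ?pnatr_eq0.
Qed.

Lemma sampled_path_end r b l w j : sampled_path r l w (j * (b * r.+1))%N = barN l (j * b)%:R w.
Proof.
by rewrite /sampled_path mulnA [(_ * r.+1)%:R]natrM mulfK ?pnatr_eq0.
Qed.

Lemma trace_vs_cells p r b w m v0 v1 j0 j1 D0 D1 :
  (j1 * (b * r.+1) <= m)%N ->
  (barN ix1 (j0 * b)%:R w < v0 + D0)%N -> (v1 <= barN ix1 (j1 * b)%:R w + D1)%N ->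
  (forall x, (j0 * (b * r.+1) <= x < j1 * (b * r.+1))%N -> (v0 <= sampled_path r ix1 w x <= v1)%N) ->
  `|\tr (sel m (fun x => v0 <= sampled_path r ix1 w x < v1)%N
         *m loop m p.+1 (sampled_path r ix1 w) (sampled_path r ix2 w))
    - window_sum (cell_rv barN p r b) j0 (j1 - j0) w|
   <= (D0 + D1 + 1 + (4 * p.+1 + 1) * (j1 - j0).+1)%:R :> R.
Proof.
move=> j1m h0 h1 hI.
pose fw l j := cell_path (@incr_vec _ _ _ barN r (b * r.+1) (j * b)%:R w) l.
have eqw l j x y : (x < b * r.+1)%N -> (y < b * r.+1)%N ->
     (sampled_path r l w (j * (b * r.+1) + x)%N == sampled_path r l w (j * (b * r.+1) + y)%N)
     = (fw l j x == fw l j y).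
  by move=> xb yb; rewrite !sampled_path_cell ?(ltnW xb) ?(ltnW yb) // eqn_add2l.
have := @block_cells R m (b * r.+1) p _ _ v0 v1 j0 j1 D0 D1 (fw ix1) (fw ix2)
  (@sampled_path_homo r ix1 w) (@sampled_path_homo r ix2 w) j1m.
rewrite sampled_path_end => /(_ h0); rewrite sampled_path_end => /(_ h1 hI (eqw ix1) (eqw ix2)).
set F := \tr _; set S := \sum_(j0 <= j < j1) _ => FS.
have SX : `|S - window_sum (cell_rv barN p r b) j0 (j1 - j0) w| <= (j1 - j0).+1%:R.
  rewrite /window_sum.
  have [j10|j01] := leqP j1 j0.
    by rewrite /S big_geq // big_geq ?subrr ?normr0 // (eqP j10) addn0.
  rewrite subnKC ?(ltnW j01) // /S -sumrB; apply: le_trans (ler_norm_sum _ _ _) _.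
  apply: (@le_trans _ _ (\sum_(j0 <= j < j1) 1)).
    apply: ler_sum => j _; rewrite distrC; apply: truncn_dist.
    by have /andP[] := @cell_trace_bounds R p _ (@incr_vec _ _ _ barN r (b * r.+1) (j * b)%:R w).
  by rewrite sumr_const_nat ler_nat.
rewrite -(subrK S F) -addrA; apply: le_trans (ler_normD _ _) _.
apply: le_trans (lerD FS SX) _; rewrite -natrD ler_nat; lia.
Qed.

Definition additivity_cst p : R := (8 * p + 14)%:R.

Lemma cell_rv_additive p r b k w : (0 < k)%N ->
  `|(cell_rv barN p r (k * b) 0 w)%:R - window_sum (cell_rv barN p r b) 0 k w|
  <= additivity_cst p * k%:R :> R.
Proof.
move=> k0; set m := (k * b * r.+1)%N.
have E l x : (x <= m)%N -> cell_path (@incr_vec _ _ _ barN r m (0 * (k * b))%:R w) l x = sampled_path r l w x.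
  move=> xm; have := @sampled_path_cell r (k * b) l w 0 x xm.
  by rewrite mul0n add0n mul0n barN_start.
pose v1 := (barN ix1 (k * b)%:R w).+1.
have := @trace_vs_cells p r b w m 0 v1 0 k 1 1.
rewrite mulnA leqnn mul0n barN_start // => /(_ isT isT).
rewrite addn1 leqnn => /(_ isT).
have fm x : (x <= m)%N -> (sampled_path r ix1 w x < v1)%N.
  move=> xm; rewrite /v1 ltnS; have := @sampled_path_end r (k * b) ix1 w 1.
  rewrite !mul1n => <-; exact: sampled_path_homo.
have hI x : (0 <= x < m)%N -> (0 <= sampled_path r ix1 w x <= v1)%N.
  by move=> /andP[_ xm]; have := fm x (ltnW xm); lia.
move=> /(_ hI).
rewrite subn0; set F := \tr _ => FX.
have FE : F = cell_trace p (@incr_vec _ _ _ barN r m (0 * (k * b))%:R w).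
  rewrite /F /cell_trace /loop_trace mxtrace_sel /mxtrace.
  rewrite (@eq_loop R m p.+1 _ (sampled_path r ix1 w) _ (sampled_path r ix2 w)).
  - by apply: eq_bigl => x; rewrite leq0n fm // ltnW.
  - by move=> x xm; rewrite E // ltnW.
  - by move=> x xm; rewrite E // ltnW.
have TX : `|(cell_rv barN p r (k * b) 0 w)%:R - F| <= 1.
  rewrite FE; apply: truncn_dist.
  by have /andP[] := @cell_trace_bounds R p _ (@incr_vec _ _ _ barN r m (0 * (k * b))%:R w).
set S := window_sum _ _ _ _ in FX *; set X := (_ %:R) in TX *.
rewrite -(subrK F X) -addrA; apply: le_trans (ler_normD _ _) _.
apply: le_trans (lerD TX FX) _; rewrite /additivity_cst -natrM -(natrD _ 1) ler_nat; nia.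
Qed.
End Paths.

(** * Means of the cells *)

Section Means.
Context {d : measure_display} {T : measurableType d} {R : realType}.
Variables (P : probability T R) (barN : 'I_2 -> R -> T -> nat).
Hypothesis barN_point : forall l, point_process (barN l).
Variables (c1 c2 cm : R).
Hypotheses (c1_gt0 : 0 < c1) (c2_gt0 : 0 < c2).
Hypothesis mixing : mixing_with P barN c1 c2.
Hypothesis stationary : stationary_increments P barN.
Hypothesis cm0 : 0 <= cm.
Hypothesis unit_tail : unit_tail_bound P barN cm.

Lemma integral_dist (X S : T -> R) m1 m2 c :
  measurable_fun [set: T] X -> measurable_fun [set: T] S ->
  (forall w, 0 <= X w) -> (forall w, 0 <= S w) -> 0 <= c ->
  (\int[P]_w (X w)%:E = m1%:E)%E -> (\int[P]_w (S w)%:E = m2%:E)%E ->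
  (forall w, `|X w - S w| <= c) -> `|m1 - m2| <= c.
Proof.
move=> mX mS X0 S0 c0 IX IS XS.
have half (f g : T -> R) a b : measurable_fun [set: T] f -> measurable_fun [set: T] g ->
   (forall w, 0 <= f w) -> (forall w, 0 <= g w) ->
   (\int[P]_w (f w)%:E = a%:E)%E -> (\int[P]_w (g w)%:E = b%:E)%E ->
   (forall w, f w <= g w + c) -> a <= b + c.
  move=> mf mg f0 g0 If Ig fg; rewrite -lee_fin -If EFinD -Ig.
  have <- := integral_prob_cst P c.
  have n1 w : [set: T] w -> (0 <= (g w)%:E)%E by rewrite lee_fin.
  have n2 w : [set: T] w -> (0 <= cst c%:E w)%E by rewrite lee_fin.
  have mg' : measurable_fun [set: T] (fun w => (g w)%:E) by exact/measurable_EFinP.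
  rewrite -(ge0_integralD P measurableT n1 mg' n2 (measurable_cst _)).
  apply: ge0_le_integral => //.
  - by move=> w _; rewrite lee_fin.
  - exact/measurable_EFinP.
  - by apply: emeasurable_funD; [exact/measurable_EFinP|exact: measurable_cst].
  - by move=> w _; rewrite -EFinD lee_fin.
have h1 : m1 <= m2 + c.
  apply: (half X S) => // w; have := XS w; rewrite ler_norml => /andP[]; lra.
have h2 : m2 <= m1 + c.
  apply: (half S X) => // w; have := XS w; rewrite ler_norml => /andP[]; lra.
rewrite ler_norml; apply/andP; split; lra.
Qed.

Definition cell_mean p r b : R := rv_mean P (cell_rv barN p r b).

Let wm p r b (b0 : (0 < b)%N) := cell_rv_well_mixing barN_point c1_gt0 c2_gt0 mixing stationary cm0 unit_tail p r b0.

Lemma cell_mean_ge0 p r b : 0 <= cell_mean p r b.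
Proof. by rewrite /cell_mean /rv_mean fine_ge0 //; apply: integral_ge0 => w _; rewrite lee_fin. Qed.

Lemma cell_mean_le p r b : (0 < b)%N -> cell_mean p r b <= tail_cst cm b ^+ 2 * (2 * tail_cst cm b).
Proof. by move=> b0; have [h1 h2 h3 h4 h5] := wm p r b0; exact: rv_mean_le h1 h2 h3 h4. Qed.

Lemma cell_mean_additive p r b k : (0 < b)%N -> (0 < k)%N ->
  `|cell_mean p r (k * b) - k%:R * cell_mean p r b| <= (additivity_cst p : R) * k%:R.
Proof.
move=> b0 k0; have kb0 : (0 < k * b)%N by rewrite muln_gt0 k0.
have [h1 h2 h3 h4 h5] := wm p r b0; have [g1 g2 g3 g4 g5] := wm p r kb0.
apply: (@integral_dist (fun w => (cell_rv barN p r (k * b) 0 w)%:R)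
  (window_sum (cell_rv barN p r b) 0 k)) => //.
- exact: (nat_measurable (fun n => n%:R) (g1 0%N)).
- exact: measurable_window_sum h1 0%N k.
- by move=> w; exact: window_sum_ge0.
- by rewrite /additivity_cst mulr_ge0.
- exact: rv_meanE g1 g2 g3 g4 0%N.
- exact: window_sum_mean h1 h2 h3 h4 0%N k.
- by move=> w; exact: cell_rv_additive.
Qed.

(** Compare both means with the mean over a cell of length [b * b'], which is
made of [b'] cells of length [b] and of [b] cells of length [b']. *)
Lemma cell_mean_ratio p r b b' : (0 < b)%N -> (0 < b')%N ->
  `|cell_mean p r b / b%:R - cell_mean p r b' / b'%:R|
  <= (additivity_cst p : R) / b%:R + (additivity_cst p : R) / b'%:R.
Proof.
move=> b0 b0'; have b1 : 0 < b%:R :> R by rewrite ltr0n.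
have b1' : 0 < b'%:R :> R by rewrite ltr0n.
have one c c' : (0 < c)%N -> (0 < c')%N ->
    `|cell_mean p r (c' * c) / (c' * c)%:R - cell_mean p r c / c%:R| <= (additivity_cst p : R) / c%:R.
  move=> c0 c0'; have h := cell_mean_additive p r c0 c0'.
  have c1' : 0 < c%:R :> R by rewrite ltr0n.
  have c1'' : 0 < c'%:R :> R by rewrite ltr0n.
  have -> : cell_mean p r (c' * c) / (c' * c)%:R - cell_mean p r c / c%:R =
     (cell_mean p r (c' * c) - c'%:R * cell_mean p r c) / (c'%:R * c%:R).
    by rewrite natrM; field; rewrite !gt_eqF.
  rewrite normrM [`|(_ * _)^-1|]gtr0_norm ?invr_gt0 ?mulr_gt0 // ler_pdivrMr ?mulr_gt0 //.
  apply: le_trans h _; rewrite le_eqVlt; apply/orP; left; apply/eqP.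
  by field; rewrite gt_eqF.
have := one b b' b0 b0'; have := one b' b b0' b0; rewrite mulnC.
rewrite !ler_norml => /andP[h1 h2] /andP[h3 h4]; apply/andP; split; lra.
Qed.

(** The resolution and the length of the cell grow together, so that one
sequence serves all cell lengths. *)
Definition mean_density p r : R := cell_mean p r r.+1 / r.+1%:R.

(** The densities are bounded, by comparison with cells of length one. A cluster
point serves as well as a limit: a window is compared with the cells at one
resolution, which can be taken from the subsequence. *)
Lemma mean_density_cluster p : exists a, 0 <= a /\
  forall e, 0 < e -> forall r0, exists2 r, (r0 <= r)%N & `|mean_density p r - a| < e.
Proof.
apply: (@bounded_cluster R _ (tail_cst cm 1 ^+ 2 * (2 * tail_cst cm 1) + 2 * (additivity_cst p : R))) => r.
apply/andP; split; first by rewrite divr_ge0 // cell_mean_ge0.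
have := @cell_mean_ratio p r r.+1 1 isT isT; rewrite !divr1 ler_norml => /andP[_ h].
have h1 := @cell_mean_le p r 1 isT.
have h2 : (additivity_cst p : R) / r.+1%:R <= (additivity_cst p : R).
  by rewrite ler_pdivrMr ?ltr0n // ler_peMr // /additivity_cst ler1n.
rewrite /mean_density; move: h h1 h2.
set x := _ / _; set y := cell_mean _ _ _; set z := _ ^+ 2 * _; set v := _ / _; set u : R := additivity_cst p.
move: x y z v u => x y z v u; lra.
Qed.

Section Positivity.
Variables (cv : R) (n0 : nat).
Hypothesis void : void_bound P barN cv n0.

Definition good_event (u K i : nat) : set T := [set w |
  [/\ forall l, (0 < cell_incr barN u l i.-1 w)%N, forall l, (0 < cell_incr barN u l i.+1 w)%N
   & forall l, (cell_incr barN u l i w <= K)%N]].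

Lemma good_event_window r u K i w : (0 < i)%N -> good_event u K i w ->
  good_window (sampled_path barN r ix1 w) (sampled_path barN r ix2 w) (u * r.+1) (K + K) i.
Proof.
move=> i0 [g1 g2 g3]; rewrite /good_window !sampled_path_end.
have m l s s' : (s <= s')%N -> (barN l s%:R w <= barN l s'%:R w)%N.
  by move=> ss; apply: barN_homo => //; rewrite ler_nat.
have := g1 ix1; have := g1 ix2; have := g2 ix1; have := g2 ix2; have := g3 ix1; have := g3 ix2.
rewrite /cell_incr /incr prednK //.
have := m ix1 (i * u)%N (i.+1 * u)%N; have := m ix2 (i * u)%N (i.+1 * u)%N.
rewrite !leq_mul2r leqnSn orbT => /(_ isT) h1 /(_ isT) h2.
by move=> *; apply/and5P; split; lia.
Qed.

Lemma measurable_good_event u K i : measurable (good_event u K i).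
Proof.
have mI l j (B : set nat) : measurable (cell_incr barN u l j @^-1` B).
  exact: (discrete_cell_incr barN_point u l j B).
have -> : good_event u K i =
  (cell_incr barN u ix1 i.-1 @^-1` [set n | (0 < n)%N]) `&`
  (cell_incr barN u ix2 i.-1 @^-1` [set n | (0 < n)%N]) `&`
  (cell_incr barN u ix1 i.+1 @^-1` [set n | (0 < n)%N]) `&`
  (cell_incr barN u ix2 i.+1 @^-1` [set n | (0 < n)%N]) `&`
  (cell_incr barN u ix1 i @^-1` [set n | (n <= K)%N]) `&`
  (cell_incr barN u ix2 i @^-1` [set n | (n <= K)%N]).
  apply/seteqP; split=> w /=; first by case=> g1 g2 g3.
  by case=> -[[[[a1 a2] a3] a4] a5] a6; split; apply: ix_all.
by do 5?apply: measurableI.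
Qed.

(** For [u] large the outer windows contain points with high probability, and
for [K] large the middle window contains at most [K] of them. *)
Lemma good_event_half : exists u K, [/\ (0 < u)%N, (0 < K)%N &
  forall i, (0 < i)%N -> ((2^-1)%:E <= P (good_event u K i))%E].
Proof.
have [u [u0 un0 uc]] := void_length cv n0 (ltac:(by rewrite invr_gt0) : 0 < 16^-1 :> R).
pose k := tail_cst cm u.
pose K := (Num.truncn (2 * k)).+1.
exists u, K; split => // i i0.
have mI l j (B : set nat) : measurable (cell_incr barN u l j @^-1` B).
  exact: (discrete_cell_incr barN_point u l j B).
pose V l j := cell_incr barN u l j @^-1` [set 0%N].
pose L l := cell_incr barN u l i @^-1` [set n | (K < n.+1)%N].
have PV l j : (P (V l j) <= (16^-1)%:E)%E.
  apply: (le_trans (cell_void barN_point stationary void l j un0 u0)).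
  by rewrite lee_fin.
have PL l : (P (L l) <= (8^-1)%:E)%E.
  apply: (le_trans (cell_incr_tail barN_point stationary cm0 unit_tail l i K u0)).
  rewrite lee_fin -/k.
  have k0 : 0 <= k by apply: tail_cst_ge0.
  have kK : 2 * k <= K.+1%:R ^+ 2.
    have h : 2 * k <= K.+1%:R.
      by apply: (@le_trans _ _ K%:R); [rewrite ltW // truncnS_gt|rewrite ler_nat].
    apply: le_trans h _; rewrite expr2 ler_peMr // ler1n //.
  have -> : 8^-1 = 2^-1 ^+ 3 :> R by rewrite exprVn -natrX.
  rewrite lerXn2r ?nnegrE ?divr_ge0 ?invr_ge0 ?exprn_ge0 //.
  rewrite ler_pdivrMr ?exprn_gt0 //; lra.
pose Bad := \big[setU/set0]_(q < 6) nth set0 [:: V ix1 i.-1; V ix2 i.-1; V ix1 i.+1; V ix2 i.+1; L ix1; L ix2] q.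
have mBad : forall q, (q < 6)%N -> measurable (nth set0 [:: V ix1 i.-1; V ix2 i.-1; V ix1 i.+1; V ix2 i.+1; L ix1; L ix2] q).
  by do 6?[case=> [_|]; first exact: mI].
have cov : ~` good_event u K i `<=` Bad.
  move=> w ng; apply: contrapT => nB; apply: ng.
  have nB' q : (q < 6)%N -> ~ nth set0 [:: V ix1 i.-1; V ix2 i.-1; V ix1 i.+1; V ix2 i.+1; L ix1; L ix2] q w.
    by move=> q6 Hq; apply: nB; rewrite /Bad (bigD1 (Ordinal q6)) //=; left.
  split; apply: ix_all.
  - by rewrite lt0n; apply/eqP; exact: (nB' 0%N).
  - by rewrite lt0n; apply/eqP; exact: (nB' 1%N).
  - by rewrite lt0n; apply/eqP; exact: (nB' 2%N).
  - by rewrite lt0n; apply/eqP; exact: (nB' 3%N).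
  - by rewrite leqNgt; apply/negP => h; apply: (nB' 4%N) => //; exact: ltnW.
  - by rewrite leqNgt; apply/negP => h; apply: (nB' 5%N) => //; exact: ltnW.
have PB : (P (~` good_event u K i) <= (2^-1)%:E)%E.
  apply: (@le_trans _ _ (P Bad)).
    apply: le_measure; rewrite ?inE //; first by apply: measurableC; exact: measurable_good_event.
    by apply: bigsetU_measurable => q _; exact: mBad.
  apply: (le_trans (@Boole_inequality _ _ _ P _ 6 mBad)).
  rewrite !big_ord_recl big_ord0 /= adde0.
  apply: (@le_trans _ _ ((16^-1)%:E + ((16^-1)%:E + ((16^-1)%:E + ((16^-1)%:E + ((8^-1)%:E + (8^-1)%:E)))))%E).
    by do 5?[apply: leeD => //].
  by rewrite -!EFinD lee_fin; lra.
have mG := measurable_good_event u K i.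
have := @probability_setC _ _ _ P _ mG.
have fG : P (good_event u K i) \is a fin_num by apply: fin_num_measure.
move: PB => /[swap] ->; rewrite -(fineK fG) -EFinB !lee_fin; lra.
Qed.

(** At least half of the stretches of length [u] are good on average, and each
good stretch adds a fixed amount to the trace. *)
Lemma mean_density_lower : exists2 c, 0 < c & exists r0, forall r, (r0 <= r)%N -> c <= mean_density 0 r.
Proof.
have [u [K [u0 K0 PG]]] := good_event_half.
pose ka : R := (9 * (K + K).+1 ^ 2)%:R^-1.
have ka0 : 0 < ka by rewrite invr_gt0 ltr0n muln_gt0 expn_gt0.
(* Only the stretches that have neighbors inside the cell count, hence n - 1. *)
have low r n : (n.+1 * u <= r.+1)%N -> ka * (n.-1)%:R / 2 <= cell_mean 0 r r.+1 + 1.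
  move=> nu; set b := r.+1 in nu *; set m := (b * r.+1)%N.
  have [h1 h2 h3 h4 h5] := wm 0 r (ltn0Sn r).
  pose X w : R := (cell_rv barN 0 r b 0 w)%:R.
  have pt w : \sum_(1 <= i < n) ka * \1_(good_event u K i) w <= X w + 1.
    pose f := sampled_path barN r ix1 w; pose g := sampled_path barN r ix2 w.
    have fm : {homo f : x y / (x <= y)%N} by exact: sampled_path_homo.
    have gm : {homo g : x y / (x <= y)%N} by exact: sampled_path_homo.
    have num : (n.+1 * (u * r.+1) <= m)%N by rewrite /m mulnA leq_mul2r nu orbT.
    have W := @good_windows_trace R m f g (u * r.+1) (K + K) n fm gm num.
    apply: (@le_trans _ _ (loop_trace m 1 f g)).
      apply: le_trans W; rewrite big_nat [leRHS]big_nat; apply: ler_sum => i /andP[i0 _].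
      rewrite mulrC ler_wpM2r ?(ltW ka0) // indicE.
      have [/set_mem gw|_] := boolP (w \in _); last by rewrite ler0n.
      by rewrite (good_event_window r i0 gw).
    have E l x : (x <= m)%N -> cell_path (@incr_vec _ _ _ barN r m (0 * b)%:R w) l x = sampled_path barN r l w x.
      move=> xm; have := @sampled_path_cell _ _ _ barN barN_point r b l w 0 x xm.
      by rewrite mul0n add0n mul0n barN_start.
    have -> : loop_trace m 1 f g = cell_trace 0 (@incr_vec _ _ _ barN r m (0 * b)%:R w) :> R.
      rewrite /cell_trace /loop_trace; congr (\tr _).
      by apply: eq_loop => x xm; rewrite E // ltnW.
    set v := incr_vec _ _ _ _.
    have /andP[v0 _] := @cell_trace_bounds R 0 _ v.
    have := truncn_dist v0; rewrite /X /cell_rv -/v ler_norml => /andP[]; lra.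
  have mX : measurable_fun [set: T] X by exact: (nat_measurable (fun n => n%:R) (h1 0%N)).
  have mG i : measurable (good_event u K i) by exact: measurable_good_event.
  have IX : (\int[P]_w (X w + 1)%:E = (cell_mean 0 r b + 1)%:E)%E.
    under eq_integral do rewrite EFinD.
    have n1 w : [set: T] w -> (0 <= (X w)%:E)%E by rewrite lee_fin.
    have n2 w : [set: T] w -> (0 <= cst (1%:E : \bar R) w)%E by rewrite lee_fin.
    have mX' : measurable_fun [set: T] (fun w => (X w)%:E) by exact/measurable_EFinP.
    rewrite (ge0_integralD P measurableT n1 mX' n2 (measurable_cst _)).
    rewrite (rv_meanE h1 h2 h3 h4 0%N) -/(cell_mean 0 r b) EFinD; congr (_ + _)%E.
    exact: integral_prob_cst.
  rewrite -lee_fin -IX.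
  have mI i : measurable_fun [set: T] (fun w => ka * \1_(good_event u K i) w : R).
    by apply: measurable_funM; [exact: measurable_cst|exact: measurable_indic].
  apply: (@le_trans _ _ (\int[P]_w (\sum_(1 <= i < n) ka * \1_(good_event u K i) w)%:E)%E); last first.
    apply: ge0_le_integral => //.
    - by move=> w _; rewrite lee_fin sumr_ge0 // => i _; rewrite mulr_ge0 // ltW.
    - by apply/measurable_EFinP; apply: measurable_sum.
    - by apply/measurable_EFinP; apply: measurable_funD => //; exact: measurable_cst.
    - by move=> w _; rewrite lee_fin; exact: pt.
  under eq_integral do rewrite -sumEFin.
  rewrite ge0_integral_sum //; last 2 first.
  - by move=> i; exact/measurable_EFinP.
  - by move=> i w _; rewrite lee_fin mulr_ge0 // ltW.
  apply: (@le_trans _ _ (\sum_(1 <= i < n) (ka / 2)%:E)%E).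
    rewrite sumEFin sumr_const_nat subn1 lee_fin le_eqVlt -[_ *+ n.-1]mulr_natr.
    by apply/orP; left; apply/eqP; ring.
  rewrite big_nat [leRHS]big_nat; apply: lee_sum => i /andP[i0 _].
  under eq_integral do rewrite EFinM.
  have n1 w : [set: T] w -> (0 <= (\1_(good_event u K i) w : R)%:E)%E by rewrite lee_fin.
  have m1 : measurable_fun [set: T] (fun w => (\1_(good_event u K i) w : R)%:E).
    by apply/measurable_EFinP; exact: measurable_indic.
  rewrite (ge0_integralZl_EFin P measurableT n1 m1 (ltW ka0)) integral_indic // setIT EFinM.
  by apply: lee_wpmul2l; [rewrite lee_fin ltW|exact: PG].
exists (ka / (4 * u%:R)).
  by rewrite divr_gt0 // mulr_gt0 // ltr0n.
(* For r + 1 at least [A], half of the main term ka * (r + 1) / (2 * u) absorbs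
   the rounding. *)
pose A := (3 * ka / 2 + 1) * (4 * u%:R) / ka.
exists (Num.truncn A) => r rA.
have u0' : 0 < u%:R :> R by rewrite ltr0n.
have := low r ((r.+1 %/ u).-1).
have ceil := ltn_ceil r.+1 u0.
set q := (r.+1 %/ u)%N in ceil *.
have q2 : r.+1%:R / u%:R - 3 <= (q.-1.-1)%:R :> R.
  rewrite lerBlDr ler_pdivrMr // -(natrD _ _ 3) -natrM ler_nat.
  by apply: leq_trans (ltnW ceil) _; rewrite leq_mul2r; lia.
have step : ka * (r.+1%:R / u%:R - 3) / 2 <= ka * (q.-1.-1)%:R / 2.
  by rewrite ler_pM2r ?invr_gt0 // ler_pM2l.
have qu : (q.-1.+1 * u <= r.+1)%N \/ q = 0%N.
  case: (posnP q) => [|q0]; [by right|left; rewrite prednK //; exact: leq_trunc_div].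
have fin : ka * (r.+1%:R / u%:R - 3) / 2 <= cell_mean 0 r r.+1 + 1.
  apply: le_trans step _; case: qu => [qu|->]; first exact: low.
  by rewrite mulr0 mul0r addr_ge0 // cell_mean_ge0.
move=> _; rewrite /mean_density ler_pdivlMr ?ltr0n //.
have rA' : A <= r.+1%:R by apply: ltW; apply: lt_le_trans (truncnS_gt _) _; rewrite ler_nat ltnS.
set x : R := r.+1%:R in fin rA' *.
have big : 3 * ka / 2 + 1 <= ka / (4 * u%:R) * x.
  have -> : ka / (4 * u%:R) * x = ka * x / (4 * u%:R) by rewrite mulrAC.
  rewrite ler_pdivlMr ?mulr_gt0 //.
  have : A * ka <= x * ka by rewrite ler_pM2r.
  by rewrite /A divfK ?gt_eqF // [x * _]mulrC.
have e : ka * (x / u%:R - 3) / 2 = 2 * (ka / (4 * u%:R) * x) - 3 * ka / 2.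
  by field; rewrite gt_eqF.
rewrite e in fin; lra.
Qed.
End Positivity.
End Means.

(** * The deviation over one window *)

Section Windows.
Context {d : measure_display} {T : measurableType d} {R : realType}.
Variables (P : probability T R) (barN : 'I_2 -> R -> T -> nat).
Hypothesis barN_point : forall l, point_process (barN l).
Variables (c1 c2 cm : R).
Hypotheses (c1_gt0 : 0 < c1) (c2_gt0 : 0 < c2).
Hypothesis stationary : stationary_increments P barN.
Hypothesis cm0 : 0 <= cm.
Hypothesis unit_tail : unit_tail_bound P barN cm.

Lemma cell_incr_tail_real b l j (y : R) : (0 < b)%N -> 0 < y ->
  (P [set w | (y < (cell_incr barN b l j w).+1%:R)%R] <= (tail_cst cm b ^+ 3 / y)%:E)%E.
Proof.
move=> b0 y0; have k0 : 0 <= tail_cst cm b by apply: tail_cst_ge0.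
have h := cell_incr_tail barN_point stationary cm0 unit_tail l j (Num.truncn y) b0.
apply: (@le_trans _ _ (P [set w | (Num.truncn y < (cell_incr barN b l j w).+1)%N])).
  apply: le_measure; rewrite ?inE.
  - exact: (discrete_cell_incr barN_point b l j [set n | y < n.+1%:R]).
  - exact: (discrete_cell_incr barN_point b l j [set n | (Num.truncn y < n.+1)%N]).
  - move=> w /= yw; rewrite -(ltr_nat R); apply: le_lt_trans yw.
    by have /andP[] := truncn_itv (ltW y0).
apply: le_trans h _; rewrite lee_fin expr_div_n -exprM ler_wpM2l ?exprn_ge0 //.
rewrite lef_pV2 ?posrE ?exprn_gt0 ?ltr0n //.
apply: (@le_trans _ _ (Num.truncn y).+1%:R); first by rewrite ltW // truncnS_gt.
by rewrite -[leLHS]expr1 ler_weXn2l // ler1n.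
Qed.

(** The cells [first_cell <= j < last_cell] lie in the window, a cell having length
[hn * b] in the time of the observations; they miss at most [hn * b] of it at
each end. *)
Definition first_cell (hn al : R) (b : nat) : nat := (Num.truncn (al / (hn * b%:R))).+1.
Definition last_cell (hn be : R) (b : nat) : nat := Num.truncn (be / (hn * b%:R)).

Lemma cell_count_bounds hn al be b : 0 < hn -> (0 < b)%N -> 0 <= al -> al < be ->
  let J := (last_cell hn be b - first_cell hn al b)%N in
  (be - al) - 2 * (hn * b%:R) <= hn * b%:R * J%:R <= be - al.
Proof.
move=> h0 b0 al0 albe; rewrite /last_cell /first_cell /=.
have u0 : 0 < hn * b%:R by rewrite mulr_gt0 // ltr0n.
set u := hn * b%:R in u0 *.
have /andP[x1 x2] := truncn_itv (divr_ge0 al0 (ltW u0)).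
have /andP[z1 z2] := truncn_itv (divr_ge0 (le_trans al0 (ltW albe)) (ltW u0)).
set m := Num.truncn (al / u) in x1 x2 *; set n := Num.truncn (be / u) in z1 z2 *.
rewrite ler_pdivlMr // in x1; rewrite ltr_pdivrMr // in x2.
rewrite ler_pdivlMr // in z1; rewrite ltr_pdivrMr // in z2.
rewrite -natr1 in x2; rewrite -natr1 in z2.
have [nm|mn] := leqP n m.
  have -> : (n - m.+1 = 0)%N by lia.
  rewrite mulr0; have : n%:R * u <= m%:R * u by rewrite ler_pM2r // ler_nat.
  move=> nmu; apply/andP; split; lra.
rewrite natrB // -natr1; apply/andP; split; lra.
Qed.

(** Outside [G] and three events of probability of order [hn], the functional is
close to the number of cells times their mean: the sum over the cells
concentrates, the two boundary cells hold at most [e / (10 * hn)] points each,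
and the bounded error per cell is small relative to the length of a cell. *)
Lemma window_deviation (hn al be e a C : R) (b : nat) (l : 'I_2) (X : nat -> T -> nat) (k : R)
    (F : T -> R) (G : set T) :
  0 < hn -> (0 < b)%N -> 0 <= al -> al < be -> be - al <= 1 -> 0 < e -> 0 <= a -> 0 <= C ->
  well_mixing P c1 c2 X k -> measurable_fun [set: T] F -> measurable G ->
  let j0 := first_cell hn al b in let j1 := last_cell hn be b in
  (forall w, ~ G w -> `|F w - window_sum X j0 (j1 - j0) w| <=
     (cell_incr barN b l j0.-1 w).+1%:R + (cell_incr barN b l j1 w).+1%:R + C * (j1 - j0).+1%:R) ->
  `|rv_mean P X / b%:R - a| <= e / 5 -> C / b%:R <= e / 10 -> hn * (C + 2 * a * b%:R) <= e / 10 ->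
  (P [set w | (e < `|hn * F w - a * (be - al)|)%R] <=
   P G + (100 * var_cst c1 c2 k / e ^+ 2 * hn + 20 * tail_cst cm b ^+ 3 / e * hn)%:E)%E.
Proof.
move=> h0 b0 al0 albe be1 e0 a0 C0 wm mF mG j0 j1 FS mean Cb hC.
have b0' : 0 < b%:R :> R by rewrite ltr0n.
have /andP[J1 J2] := cell_count_bounds h0 b0 al0 albe.
rewrite -/j0 -/j1 in J1 J2; set J := (j1 - j0)%N in FS J1 J2 *.
pose y := e / (10 * hn); have y0 : 0 < y by rewrite divr_gt0 // mulr_gt0.
have hy : hn * y = e / 10 by rewrite /y; field; rewrite gt_eqF.
pose B1 := [set w | y <= `|window_sum X j0 J w - J%:R * rv_mean P X|].
pose B2 := [set w | y < (cell_incr barN b l j0.-1 w).+1%:R].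
pose B3 := [set w | y < (cell_incr barN b l j1 w).+1%:R].
have [mX _ _ _ _] := wm.
have mB1 : measurable B1.
  apply: measurable_norm_ge.
  by apply: measurable_funB; [exact: measurable_window_sum|exact: measurable_cst].
have mB2 : measurable B2 by exact: (discrete_cell_incr barN_point b l j0.-1 [set n | y < n.+1%:R]).
have mB3 : measurable B3 by exact: (discrete_cell_incr barN_point b l j1 [set n | y < n.+1%:R]).
have mD : measurable [set w | e < `|hn * F w - a * (be - al)|].
  apply: measurable_norm_gt; apply: measurable_funB; last exact: measurable_cst.
  by apply: measurable_funM => //; exact: measurable_cst.
have sub : [set w | e < `|hn * F w - a * (be - al)|] `<=` G `|` (B1 `|` (B2 `|` B3)).
  move=> w /= big; apply: contrapT => nB.
  have nG : ~ G w by move=> ?; apply: nB; left.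
  have n1 : `|window_sum X j0 J w - J%:R * rv_mean P X| < y.
    by rewrite ltNge; apply/negP => ?; apply: nB; right; left.
  have n2 : (cell_incr barN b l j0.-1 w).+1%:R <= y.
    by rewrite leNgt; apply/negP => ?; apply: nB; right; right; left.
  have n3 : (cell_incr barN b l j1 w).+1%:R <= y.
    by rewrite leNgt; apply/negP => ?; apply: nB; right; right; right.
  have {FS} FS := FS w nG.
  move: big n1 FS; set S := window_sum X j0 J w; set mu := rv_mean P X in mean *.
  set Y2 := (_.+1%:R) in n2 *; set Y3 := (_.+1%:R) in n3 *.
  move=> big n1 FS; move: big; apply/negP; rewrite -leNgt.
  (* The boundary and decoupling errors, the fluctuation, the error in the mean
     and the rounding of the window to whole cells. *)
  have -> : hn * F w - a * (be - al) = hn * (F w - S) + hn * (S - J%:R * mu)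
      + (hn * b%:R * J%:R) * (mu / b%:R - a) + a * (hn * b%:R * J%:R - (be - al)).
    by field; rewrite gt_eqF.
  have t1 : `|hn * (F w - S)| <= e / 10 + e / 10 + (e / 10 + hn * C).
    rewrite normrM (gtr0_norm h0); apply: (@le_trans _ _ (hn * (y + y + C * J.+1%:R))).
      by rewrite ler_pM2l //; apply: le_trans FS _; rewrite lerD2r lerD.
    rewrite !mulrDr hy lerD2l -natr1 mulrDr mulr1 mulrDr lerD2r.
    apply: le_trans Cb; rewrite ler_pdivlMr //.
    have -> : hn * (C * J%:R) * b%:R = C * (hn * b%:R * J%:R) by ring.
    by rewrite ler_piMr //; lra.
  have t2 : `|hn * (S - J%:R * mu)| <= e / 10.
    by rewrite normrM (gtr0_norm h0) -hy ler_pM2l // ltW.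
  have J0 : 0 <= hn * b%:R * J%:R by rewrite !mulr_ge0 // ltW.
  have t3 : `|(hn * b%:R * J%:R) * (mu / b%:R - a)| <= e / 5.
    rewrite normrM (ger0_norm J0); apply: le_trans mean; rewrite ler_piMl //; lra.
  have t4 : `|a * (hn * b%:R * J%:R - (be - al))| <= 2 * a * b%:R * hn.
    rewrite normrM (ger0_norm a0).
    have -> : 2 * a * b%:R * hn = a * (2 * (hn * b%:R)) by ring.
    by rewrite ler_wpM2l // ler_norml; apply/andP; split; lra.
  apply: le_trans (ler_normD _ _) _; apply: le_trans (lerD (ler_normD _ _) (lexx _)) _.
  apply: le_trans (lerD (lerD (ler_normD _ _) (lexx _)) (lexx _)) _.
  have hC' : hn * C + 2 * a * b%:R * hn <= e / 10.
    by apply: le_trans hC; rewrite le_eqVlt; apply/orP; left; apply/eqP; ring.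
  apply: (le_trans (lerD (lerD (lerD t1 t2) t3) t4)); lra.
have mU : measurable (G `|` (B1 `|` (B2 `|` B3))) by do 3?apply: measurableU.
apply: (@le_trans _ _ (P (G `|` (B1 `|` (B2 `|` B3))))).
  by apply: le_measure; rewrite ?inE.
apply: (le_trans (measureU2 P mG _)); first by do 2?apply: measurableU.
apply: leeD => //; apply: (le_trans (measureU2 P mB1 _)); first exact: measurableU.
rewrite EFinD; apply: leeD.
  apply: (le_trans (well_mixing_concentration c1_gt0 c2_gt0 wm j0 J y0)); rewrite lee_fin.
  have v0 : 0 <= var_cst c1 c2 k by exact: var_cst_ge0.
  have -> : var_cst c1 c2 k * J%:R / y ^+ 2 = 100 * var_cst c1 c2 k / e ^+ 2 * (hn * (hn * J%:R)).
    by rewrite /y; field; rewrite !gt_eqF.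
  rewrite ler_wpM2l //.
    by apply: divr_ge0; [exact: mulr_ge0|rewrite exprn_ge0 // ltW].
  rewrite ler_piMr ?(ltW h0) //; apply: le_trans be1; apply: le_trans J2.
  have b1 : 1 <= b%:R :> R by rewrite ler1n.
  by rewrite mulrAC ler_peMr // mulr_ge0 // ltW.
apply: (le_trans (measureU2 P mB2 mB3)).
apply: (le_trans (leeD (cell_incr_tail_real l j0.-1 b0 y0) (cell_incr_tail_real l j1 b0 y0))).
rewrite -EFinD lee_fin le_eqVlt; apply/orP; left; apply/eqP.
by rewrite /y; field; rewrite !gt_eqF.
Qed.
End Windows.

(** * The observation times in terms of the point process *)

Section PointwiseToProbability.
Context {d : measure_display} {T : measurableType d} {R : realType}.
Variable P : probability T R.

(** Pointwise convergence implies convergence in probability; the event that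
infinitely many deviations exceed one is empty. *)
Lemma prob_dev_small (u : nat -> T -> R) (v : T -> R) (eta : R) :
  (forall r, measurable_fun [set: T] (u r)) -> measurable_fun [set: T] v ->
  (forall w, u r w @[r --> \oo] --> v w) -> 0 < eta ->
  exists r0, forall r, (r0 <= r)%N -> (P [set w | (1 < `|u r w - v w|)%R] <= eta%:E)%E.
Proof.
move=> mu mv uv e0; pose A r := [set w | 1 < `|u r w - v w|].
have mA r : measurable (A r) by apply: measurable_norm_gt; exact: measurable_funB.
have mU n : measurable (\bigcup_(k in [set k | (n <= k)%N]) A k) by apply: bigcup_measurable.
have cv : P (\bigcup_(k in [set k | (n <= k)%N]) A k) @[n --> \oo] --> P (lim_sup_set A).
  apply: lim_sup_set_cvg => //; apply: (le_lt_trans (probability_le1 P (mU 0%N))); exact: ltry.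
have E0 : lim_sup_set A = set0.
  rewrite -subset0 => w /= hw.
  have [n _ hn] := (cvgrPdist_lt _ _).1 (uv w) 1 ltr01.
  have [k /= nk] := hw n I; rewrite /A /=; have := hn k nk.
  by rewrite /= distrC => h1 h2; have := lt_trans h1 h2; rewrite ltxx.
rewrite E0 measure0 in cv.
have : \forall n \near \oo, (P (\bigcup_(k in [set k | (n <= k)%N]) A k) < eta%:E)%E.
  apply: (cv [set x | (x < eta%:E)%E]).
  by apply: open_nbhs_nbhs; split; [exact: open_ereal_lt_ereal|rewrite /= lte_fin].
move=> [r0 _ hr0]; exists r0 => r rr.
apply: le_trans (ltW (hr0 r0 (leqnn _))).
apply: le_measure; rewrite ?inE //; first exact: mA.
by move=> w Aw; exists r.
Qed.
End PointwiseToProbability.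

Section Observation.
Context {d : measure_display} {T : measurableType d} {R : realType}.
Variables (P : probability T R) (h : nat -> R).
Variables (M : nat -> 'I_2 -> T -> nat) (S_ : nat -> 'I_2 -> nat -> T -> R).
Variable barN : 'I_2 -> R -> T -> nat.
Hypothesis h_gt0 : forall n, (1 <= n)%N -> 0 < h n.
Hypothesis S_grids : random_grids h M S_.
Hypothesis barN_point : forall l, point_process (barN l).
Hypothesis S_generated : generated_by h M S_ barN.

Lemma grids_ok n w : (1 <= n)%N -> is_grid (grid_size M n w) (grid S_ n w) (horizon h n).
Proof. by move=> n1 l; have [_ _ /(_ w)] := S_grids n1 l. Qed.

Lemma horizon_gt0 n : (1 <= n)%N -> 0 < horizon h n.
Proof. by move=> n1; rewrite /horizon mulr_gt0 ?ltr0n // h_gt0. Qed.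

Lemma obsE n l x w : (1 <= n)%N -> 0 <= x -> x < horizon h n ->
  obs_process M S_ n l x w = barN l ((h n)^-1 * x) w.
Proof. by move=> n1 x0 xT; apply: S_generated. Qed.

Lemma obs_scaled n l s w : (1 <= n)%N -> 0 <= s -> s < n%:R ->
  obs_process M S_ n l (s * h n) w = barN l s w.
Proof.
move=> n1 s0 sn; have hn := h_gt0 n1.
rewrite obsE //; last by rewrite /horizon ltr_pM2r.
  by rewrite mulrCA mulVf ?mulr1 // gt_eqF.
by rewrite mulr_ge0 // ltW.
Qed.

Lemma obs_homo n l x y w : x <= y -> (obs_process M S_ n l x w <= obs_process M S_ n l y w)%N.
Proof. exact: obs_count_homo. Qed.

Lemma obs_end n l x w : (1 <= n)%N -> horizon h n <= x -> obs_process M S_ n l x w = M n l w.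
Proof. by move=> n1 Tx; rewrite /obs_process (obs_count_full (grids_ok w n1)). Qed.

(** The jumps of the point process have size one, and the horizon adds one
observation time at most. *)
Lemma size_bounds n l w : (1 <= n)%N ->
  (barN l n%:R w <= M n l w)%N /\ (M n l w <= (barN l n%:R w).+1)%N.
Proof.
move=> n1; have tg := grids_ok w n1; have hn := h_gt0 n1; have T0 := horizon_gt0 n1.
split.
  have [_ /(_ w) [_ _ _ jump]] := barN_point l.
  have nR : 0 < n%:R :> R by rewrite ltr0n.
  have [x [jx x0 xn]] : exists x, [/\ (barN l n%:R w <= (barN l x w).+1)%N, 0 < x & x < n%:R].
    have near3 : \forall x \near (n%:R)^'-, [/\ (barN l n%:R w <= (barN l x w).+1)%N, 0 < x & x < n%:R].
      near=> x; split.
      - by near: x; exact: jump.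
      - by near: x; exact: nbhs_left_gt.
      - by near: x; exact: nbhs_left_lt.
    by case: (@filter_ex _ _ (at_left_proper_filter _) _ near3) => x hx; exists x.
  apply: leq_trans jx _; rewrite -(obs_scaled l w n1 (ltW x0) xn).
  have [] // := @obs_count_label _ _ _ _ tg l (x * h n); first by rewrite mulr_ge0 // ltW.
  by rewrite /horizon ltr_pM2r.
have [t0 tS tm] := tg l; rewrite /grid_size in tm tS.
have m0 : (0 < M n l w)%N.
  by rewrite lt0n; apply/eqP => m0; move: T0; rewrite -tm m0 t0 ltxx.
have mE : ((M n l w).-1 < M n l w)%N by rewrite prednK.
set t := grid S_ n w l (M n l w).-1.
have tT : t < horizon h n by rewrite -tm /t -[in X in _ < X](prednK m0); exact: tS.
have t0' : 0 <= t by rewrite /t; apply: (grid_ge0 tg); exact: ltnW.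
have : obs_process M S_ n l t w == (M n l w).-1.
  rewrite /obs_process (obs_count_eq tg) // lexx /=.
  by rewrite (prednK m0) tm.
move=> /eqP ot; rewrite -(prednK m0) ltnS -ot obsE //.
apply: barN_homo => //; first by rewrite mulr_ge0 ?invr_ge0 // ltW.
by rewrite mulrC ler_pdivrMr // ltW.
Unshelve. all: by end_near. Qed.

Lemma obs_low n l s x w : (1 <= n)%N -> 0 <= s -> s * h n <= x -> x <= horizon h n ->
  (barN l s w <= obs_process M S_ n l x w)%N.
Proof.
move=> n1 s0 sx xT; have hn := h_gt0 n1.
have [sn|ns] := ltP s n%:R.
  by rewrite -(obs_scaled l w n1 s0 sn); apply: obs_homo.
have nE : n%:R * h n <= s * h n by rewrite ler_pM2r.
have sE : s = n%:R.
  by apply/eqP; rewrite eq_le ns andbT -(ler_pM2r hn); exact: le_trans xT.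
rewrite obs_end //; last by apply: le_trans sx; exact: nE.
by rewrite sE; have [] := size_bounds l w n1.
Qed.

Lemma obs_high n l s x w : (1 <= n)%N -> 0 <= x -> x <= s * h n ->
  (obs_process M S_ n l x w <= (barN l s w).+1)%N /\
  (x < horizon h n -> (obs_process M S_ n l x w <= barN l s w)%N).
Proof.
move=> n1 x0 xs; have hn := h_gt0 n1.
have low : x < horizon h n -> (obs_process M S_ n l x w <= barN l s w)%N.
  move=> xT; rewrite obsE //; apply: barN_homo => //; first by rewrite mulr_ge0 ?invr_ge0 // ltW.
  by rewrite mulrC ler_pdivrMr.
split => //; have [/low/leqW//|Tx] := ltP x (horizon h n).
rewrite obs_end //; have [_ hm] := size_bounds l w n1; apply: leq_trans hm _.
rewrite ltnS; apply: barN_homo => //.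
by rewrite -(ler_pM2r hn); apply: le_trans xs.
Qed.

Lemma discrete_obs n l x : (1 <= n)%N -> 0 <= x -> discrete_in measurable (obs_process M S_ n l x).
Proof.
move=> n1 x0; have [xT|Tx] := ltP x (horizon h n).
  have -> : obs_process M S_ n l x = barN l ((h n)^-1 * x) by apply/funext => w; exact: obsE.
  by apply: discrete_barN => //; rewrite mulr_ge0 // invr_ge0 ltW // h_gt0.
have -> : obs_process M S_ n l x = M n l by apply/funext => w; exact: obs_end.
by apply/discrete_natP; have [] := S_grids n1 l.
Qed.

(** The trace over a block as seen from the sample points. Since it is a function
of finitely many counts, it also provides the measurability of the trace. *)
Definition sampled_block p n (al be : R) (r : nat) (w : T) : R :=
  \tr (sel (n * r.+1) (fun x => obs_process M S_ n ix1 al w <= sampled_path barN r ix1 w x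
                                < obs_process M S_ n ix1 be w)%N
       *m loop (n * r.+1) p.+1 (sampled_path barN r ix1 w) (sampled_path barN r ix2 w)).

Lemma sampled_block_cvg p n al be w : (1 <= n)%N ->
  sampled_block p n al be r w @[r --> \oo] --> block_trace (grid_size M n w) (grid S_ n w) p.+1 al be.
Proof.
move=> n1; have tg := grids_ok w n1; have hn := h_gt0 n1.
pose K r := (n * r.+1)%N; pose dl r := h n / r.+1%:R.
have dl0 r : 0 < dl r by rewrite divr_gt0.
have KT r : (K r)%:R * dl r = horizon h n.
  by rewrite /K /dl /horizon natrM; field; rewrite gt_eqF.
have dlc : dl r @[r --> \oo] --> (0 : R).
  rewrite -(mulr0 (h n)); apply: cvgM; first exact: cvg_cst.
  exact: cvg_harmonic.
have := @sampled_trace_cvg R _ _ _ tg K dl dl0 KT dlc p al be.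
have sE r l x : (x < K r)%N -> sample (grid_size M n w) (grid S_ n w) (dl r) l x = sampled_path barN r l w x.
  move=> xK; rewrite /sampled_path -(@obs_scaled n l _ w n1).
  - by rewrite /sample /obs_process /dl mulrA mulrAC.
  - by rewrite divr_ge0.
  - by rewrite ltr_pdivrMr // -natrM ltr_nat.
suff E : (fun r => \tr (sel (K r) (fun x => obs_count (grid_size M n w) (grid S_ n w) ix1 al
    <= sample (grid_size M n w) (grid S_ n w) (dl r) ix1 x
    < obs_count (grid_size M n w) (grid S_ n w) ix1 be)%N
      *m loop (K r) p.+1 (sample (grid_size M n w) (grid S_ n w) (dl r) ix1)
         (sample (grid_size M n w) (grid S_ n w) (dl r) ix2))) = sampled_block p n al be ^~ w.
  by rewrite E.
apply/funext => r; rewrite /sampled_block !mxtrace_sel.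
rewrite (@eq_loop R (K r) p.+1 _ (sampled_path barN r ix1 w) _ (sampled_path barN r ix2 w));
  try by (move=> x; exact: sE).
by apply: eq_bigl => x; rewrite sE.
Qed.

Lemma measurable_sampled_block p n al be r : (1 <= n)%N -> 0 <= al -> 0 <= be ->
  measurable_fun [set: T] (sampled_block p n al be r).
Proof.
move=> n1 al0 be0; apply: discrete_measurable.
pose K := (n * r.+1)%N.
pose enc w := ((obs_process M S_ n ix1 al w, obs_process M S_ n ix1 be w),
  ([seq sampled_path barN r ix1 w x | x <- iota 0 K], [seq sampled_path barN r ix2 w x | x <- iota 0 K])).
pose dec (z : (nat * nat) * (seq nat * seq nat)) : R :=
  \tr (sel K (fun x => z.1.1 <= nth 0%N z.2.1 x < z.1.2)%N *m loop K p.+1 (nth 0%N z.2.1) (nth 0%N z.2.2)).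
have -> : sampled_block p n al be r = dec \o enc.
  have E l w x : (x < K)%N -> sampled_path barN r l w x = nth 0%N [seq sampled_path barN r l w x | x <- iota 0 K] x.
    by move=> xK; rewrite (nth_map 0%N) ?size_iota // nth_iota.
  apply/funext => w; rewrite /sampled_block /dec /= !mxtrace_sel.
  rewrite (@eq_loop R K p.+1 _ (nth 0%N [seq sampled_path barN r ix1 w x | x <- iota 0 K])
     _ (nth 0%N [seq sampled_path barN r ix2 w x | x <- iota 0 K])); try by (move=> x; exact: E).
  by apply: eq_bigl => x; rewrite -E.
apply: discrete_comp.
have sM := @sigma_algebra_measurable _ T.
have dS l x : discrete_in measurable (fun w => sampled_path barN r l w x).
  by apply: discrete_barN => //; rewrite divr_ge0.
apply: discrete_pair => //; apply: discrete_pair => //; try exact: discrete_obs.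
  by apply: discrete_seq.
by apply: discrete_seq.
Qed.

Lemma measurable_block_trace p n al be : (1 <= n)%N -> 0 <= al -> 0 <= be ->
  measurable_fun [set: T] (fun w => block_trace (grid_size M n w) (grid S_ n w) p.+1 al be).
Proof.
move=> n1 al0 be0; apply: (@measurable_fun_cvg _ _ _ _ (sampled_block p n al be)).
  by move=> r; exact: measurable_sampled_block.
by move=> w _; exact: sampled_block_cvg.
Qed.
End Observation.

(** * Moments and voids of the point process *)

Section Derived.
Context {d : measure_display} {T : measurableType d} {R : realType}.
Variables (P : probability T R) (h : nat -> R).
Variables (M : nat -> 'I_2 -> T -> nat) (S_ : nat -> 'I_2 -> nat -> T -> R).
Variable barN : 'I_2 -> R -> T -> nat.
Hypothesis h_gt0 : forall n, (1 <= n)%N -> 0 < h n.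
Hypothesis S_grids : random_grids h M S_.
Hypothesis barN_point : forall l, point_process (barN l).
Hypothesis S_generated : generated_by h M S_ barN.

Lemma obs_incr_start n l u w : (1 <= n)%N -> 0 <= u -> u < n%:R ->
  incr (obs_process M S_ n l) 0 (0 + u * h n) w = barN l u w.
Proof.
move=> n1 u0 un; rewrite /incr add0r (obs_scaled h_gt0 S_generated) //.
have := obs_scaled h_gt0 S_generated l w n1 (lexx 0).
by rewrite mul0r ltr0n => /(_ n1) ->; rewrite barN_start // subn0.
Qed.

(** Markov's inequality for the sixth moment. *)
Lemma unit_tail_of_moments : condB1 P h M S_ 6 ->
  exists2 cm, 0 <= cm & unit_tail_bound P barN cm.
Proof.
rewrite /condB1 /=; set Mo := ereal_sup _ => hB.
have mom l : (\int[P]_w ((barN l 1 w)%:R ^+ 6)%:E <= Mo)%E.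
  apply: ereal_sup_ubound; exists 2, l, 0; split => //.
    rewrite lexx /= mulr_ge0 //; last by rewrite ltW // h_gt0.
    by rewrite subr_ge0 ler1n.
  rewrite unlock; apply: eq_integral => w _.
  have := @obs_incr_start 2 l 1 w isT ler01; rewrite mul1r ltr1n => /(_ isT) ->.
  by rewrite -[6%R]/(6%:R) powR_mulrn.
have M0 : (0 <= Mo)%E.
  apply: le_trans (mom ix1); apply: integral_ge0 => w _; rewrite lee_fin exprn_ge0 //.
have Mf : Mo \is a fin_num by rewrite ge0_fin_numE.
exists (fine Mo); first exact: fine_ge0.
move=> l i; have dN := discrete_barN barN_point l (ler01).
have mA : measurable [set w | (i < barN l 1 w)%N] by exact: (dN [set k | (i < k)%N]).
have p0 : 0 < i.+1%:R ^+ 6 :> R by rewrite exprn_gt0.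
rewrite -(@lee_pmul2l _ (i.+1%:R ^+ 6)%:E) ?lte_fin //.
rewrite -EFinM [X in (_ <= X%:E)%E]mulrC divfK ?gt_eqF // fineK //.
apply: le_trans (mom l); rewrite -integral_cst //.
have mN : measurable_fun [set: T] (fun w => ((barN l 1 w)%:R ^+ 6)%:E : \bar R).
  by apply/measurable_EFinP; apply: (nat_measurable (fun n => n%:R ^+ 6)); apply/discrete_natP.
apply: (@le_trans _ _ (\int[P]_(w in [set w | (i < barN l 1 w)%N]) ((barN l 1 w)%:R ^+ 6)%:E)%E).
  apply: ge0_le_integral => //.
  - by move=> w _; rewrite lee_fin ltW.
  - exact: measurable_funTS.
  - by move=> w /= iw; rewrite lee_fin lerXn2r ?nnegrE // ler_nat.
apply: ge0_subset_integral => //.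
Qed.

(** A finite limit superior bounds the void probabilities of all long stretches
by a common constant. *)
Lemma void_of_limsup : condB2 P h M S_ 2 ->
  exists cv : R, exists n0, void_bound P barN cv n0.
Proof.
rewrite /condB2 /= => /ereal_inf_lt [_ [A [u0 [u0r Au0]] <-]].
set Mo := ereal_sup _ => Aoo.
have bd l (v : nat) : (Num.truncn u0 < v)%N -> ((v%:R ^+ 2)%:E * P [set w | barN l v%:R w = 0%N] <= Mo)%E.
  move=> uv; have u0v : u0 < v%:R.
    by apply: lt_le_trans (truncnS_gt _) _; rewrite ler_nat.
  apply: (@le_trans _ _ (ereal_sup [set y | exists n l (x : R),
    [/\ (1 <= n)%N, 0 <= x <= n%:R * h n - v%:R * h n
      & y = ((v%:R `^ 2)%:E *
          P [set w | incr (obs_process M S_ n l) x (x + v%:R * h n) w = 0%N])%E]])); last first.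
    by apply: ereal_sup_ubound; exists v%:R => //; exact: Au0.
  apply: ereal_sup_ubound; exists v.+1, l, 0; split => //.
    by rewrite lexx /= -mulrBl; apply: mulr_ge0; [rewrite subr_ge0 ler_nat|exact/ltW/h_gt0].
  rewrite -[2%R in RHS]/(2%:R) powR_mulrn //; congr (_ * P _)%E.
  apply/seteqP; split=> w /=; rewrite (@obs_incr_start v.+1 l v%:R w) // ltr_nat //.
have [v0M|] := leP 0%E Mo; last first.
  move=> Mneg; exfalso; have := bd ix1 _ (ltnSn _); rewrite leNgt => /negP; apply.
  by apply: lt_le_trans Mneg _; rewrite mule_ge0 // lee_fin exprn_ge0.
have Mf : Mo \is a fin_num by rewrite ge0_fin_numE.
exists (fine Mo), (Num.truncn u0).+1 => l v nv v0.
have p0 : 0 < v%:R ^+ 2 :> R by rewrite exprn_gt0 // ltr0n.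
rewrite -(@lee_pmul2l _ (v%:R ^+ 2)%:E) ?lte_fin //.
by rewrite -EFinM [X in (_ <= X%:E)%E]mulrC divfK ?gt_eqF // fineK //; exact: bd.
Qed.
End Derived.

(** * From windows to blocks *)

Section PartitionFacts.
Context {R : realType}.
Variable s : nat -> R.
Hypothesis sS : frakS s.

Lemma partition_step k : 0 < s k.+1 - s k <= 1.
Proof.
have [_ smono sup1 _] := sS; rewrite subr_gt0 smono /=.
have : (`|s k.+1 - s k|%:E <= 1)%E.
  by apply: le_trans sup1; apply: ereal_sup_ubound; exists k.+1.
by rewrite lee_fin ger0_norm // subr_ge0 ltW.
Qed.

Lemma partition_ge0 k : 0 <= s k.
Proof.
have [s0 smono _ _] := sS; elim: k => [|k IH]; first by rewrite s0.
exact: le_trans IH (ltW (smono k)).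
Qed.

Lemma partition_homo : {homo s : i j / (i <= j)%N >-> i <= j}.
Proof.
have [_ smono _ _] := sS; move=> i j; elim: j => [|j IH]; first by rewrite leqn0 => /eqP ->.
rewrite leq_eqVlt => /orP[/eqP -> //|]; rewrite ltnS => /IH h.
exact: le_trans h (ltW (smono j)).
Qed.

(** The gaps are bounded below, so that a partition has at most of order [x]
points up to [x]. *)
Lemma partition_gap : exists2 dl, 0 < dl & forall q, q%:R * dl <= s q.
Proof.
have [s0 smono _ inf0] := sS.
set I := ereal_inf _ in inf0.
have gapk k : (I <= (s k.+1 - s k)%:E)%E.
  apply: ereal_inf_lbound; exists k.+1 => //=.
  by rewrite ger0_norm // subr_ge0 ltW.
have If : I \is a fin_num.
  by rewrite ge0_fin_numE ?(ltW inf0) //; apply: le_lt_trans (gapk 0%N) (ltry _).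
exists (fine I); first by rewrite -lte_fin fineK.
elim=> [|q IH]; first by rewrite mul0r s0.
rewrite -natr1 mulrDl mul1r -[s q.+1](subrK (s q)) addrC lerD //.
by rewrite -lee_fin fineK.
Qed.

Lemma last_index_le x : 0 <= x -> s (last_index s x) <= x.
Proof.
have [s0 _ _ _] := sS; move=> x0; rewrite /last_index; case: xgetP => [k -> [] //|_].
by rewrite s0.
Qed.
End PartitionFacts.

Section WindowsToBlocks.
Context {d : measure_display} {T : measurableType d} {R : realType}.
Variables (P : probability T R) (h : nat -> R).
Variables (M : nat -> 'I_2 -> T -> nat) (S_ : nat -> 'I_2 -> nat -> T -> R).
Hypothesis h_gt0 : forall n, (1 <= n)%N -> 0 < h n.
Hypothesis nh2_cvg0 : n%:R * h n ^+ 2 @[n --> \oo] --> (0 : R).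

Definition window_functional := nat -> forall m : 'I_2 -> nat, ('I_2 -> nat -> R) -> R -> R -> R.

Definition window_measurable (F : window_functional) : Prop :=
  forall n x y, (1 <= n)%N -> 0 <= x -> x <= y ->
  measurable_fun [set: T] (fun w => F n (grid_size M n w) (grid S_ n w) x y).

(** The bound is uniform in the position of the window and of order [h n]: this
is the rate that a union bound over all blocks can afford. *)
Definition window_small (F : window_functional) (c : R) : Prop := forall e, 0 < e ->
  exists C n0, 0 <= C /\ forall n x y, (n0 <= n)%N -> (1 <= n)%N -> 0 <= x -> x < y -> y - x <= 1 -> y <= horizon h n ->
  (P [set w | (e < `|F n (grid_size M n w) (grid S_ n w) x y - c * (y - x)|)%R] <= (C * h n)%:E)%E.

Lemma measurable_window_dev F c e n x y : window_measurable F -> (1 <= n)%N -> 0 <= x -> x <= y ->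
  measurable [set w | e < `|F n (grid_size M n w) (grid S_ n w) x y - c * (y - x)|].
Proof.
move=> mF n1 x0 xy; apply: measurable_norm_gt.
by apply: measurable_funB; [exact: mF|exact: measurable_cst].
Qed.

Lemma block_devP s q (F : R -> R -> R) c e : 0 < e ->
  e < `|block_dev s q F c - 0| <->
  exists2 k, (k < q)%N & e < `|F (s k) (s k.+1) - c * (s k.+1 - s k)|.
Proof.
move=> e0; rewrite subr0 /block_dev big_add1 /= big_mkord.
set B := \big[_/_]_(i < q) _.
have B0 : 0 <= B by apply: bigmax_ge_id.
rewrite ger0_norm //; split.
  by case/bigmax_gtP => [h0|[i _ hi]]; [have := lt_trans e0 h0; rewrite ltxx|exists i].
by case=> k kq hk; apply/bigmax_gtP; right; exists (Ordinal kq).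
Qed.

Lemma block_dev_set s F c e n : 0 < e ->
  [set w | e < `|block_dev s (qn h s n) (F n (grid_size M n w) (grid S_ n w)) c - 0|] =
  \big[setU/set0]_(k < qn h s n)
    [set w | e < `|F n (grid_size M n w) (grid S_ n w) (s k) (s k.+1) - c * (s k.+1 - s k)|].
Proof.
move=> e0.
pose A k := [set w | e < `|F n (grid_size M n w) (grid S_ n w) (s k) (s k.+1) - c * (s k.+1 - s k)|].
rewrite -[RHS]/(\big[setU/set0]_(k < _) A k) -(bigcup_mkord _ A); apply/seteqP; split=> w /=.
  by move=> /(block_devP _ _ _ _ e0) [k kq hk]; exists k.
by move=> [k kq hk]; apply/(block_devP _ _ _ _ e0); exists k.
Qed.

(** There are at most of order n h(n) blocks and each fails with probability of
order h(n); the union bound is of order n h(n)^2. *)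
Lemma blocks_cvg_of_windows (F : window_functional) c s : frakS s ->
  window_measurable F -> window_small F c -> blocks_cvg P h M S_ s F c.
Proof.
move=> sS mF wF e e0; have [C [n0 [C0 hC]]] := wF e e0.
have [dl dl0 gap] := partition_gap sS.
have bound n : (maxn n0 1 <= n)%N ->
  (P [set w | (e < `|block_dev s (qn h s n) (F n (grid_size M n w) (grid S_ n w)) c - 0|)%R]
   <= (C / dl * (n%:R * h n ^+ 2))%:E)%E.
  rewrite geq_max => /andP[nn0 n1]; have hn := h_gt0 n1; rewrite block_dev_set //.
  have T0 : 0 <= horizon h n by rewrite /horizon mulr_ge0 // ltW.
  set q := qn h s n; have sq : s q <= horizon h n by apply: last_index_le.
  apply: (le_trans (@Boole_inequality _ _ _ P (fun k => [set w | e < `|F n (grid_size M n w) (grid S_ n w) (s k) (s k.+1) - c * (s k.+1 - s k)|]) q _)).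
    move=> k kq; apply: measurable_window_dev => //; first exact: partition_ge0.
    exact: partition_homo.
  apply: (@le_trans _ _ (\sum_(k < q) (C * h n)%:E)%E).
    apply: lee_sum => k _; have /andP[g1 g2] := partition_step sS k.
    apply: hC => //; first exact: partition_ge0.
      by rewrite -subr_gt0.
    by apply: le_trans sq; apply: partition_homo.
  rewrite sumEFin lee_fin sumr_const card_ord -[leLHS]mulr_natl.
  have qT : q%:R <= n%:R * h n / dl.
    by rewrite ler_pdivlMr //; apply: le_trans (gap q) sq.
  apply: (@le_trans _ _ (n%:R * h n / dl * (C * h n))).
    by rewrite ler_wpM2r // mulr_ge0 // ltW.
  by rewrite le_eqVlt; apply/orP; left; apply/eqP; field; rewrite gt_eqF.
apply: (@squeeze_cvge _ _ _ _ (fun=> 0%E) _ (fun n => (C / dl * (n%:R * h n ^+ 2))%:E)).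
- exists (maxn n0 1) => // n /= nn; apply/andP; split; first exact: measure_ge0.
  exact: bound.
- exact: cvg_cst.
- apply: cvg_EFin; first by near=> n.
  rewrite -(mulr0 (C / dl)); apply: cvgM => //; exact: cvg_cst.
Unshelve. all: by end_near. Qed.
End WindowsToBlocks.

(** * Counts and traces over a window *)

Lemma window_error_bound p Y0 Y1 J :
  (1 + (Y0.+1 + Y1.+1 + 1 + (4 * p.+1 + 1) * J.+1) <= Y0.+1 + Y1.+1 + (4 * p + 7) * J.+1)%N.
Proof. nia. Qed.

Section WindowEstimates.
Context {d : measure_display} {T : measurableType d} {R : realType}.
Variables (P : probability T R) (h : nat -> R).
Variables (M : nat -> 'I_2 -> T -> nat) (S_ : nat -> 'I_2 -> nat -> T -> R).
Variable barN : 'I_2 -> R -> T -> nat.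
Hypothesis h_gt0 : forall n, (1 <= n)%N -> 0 < h n.
Hypothesis h_cvg0 : h n @[n --> \oo] --> (0 : R).
Hypothesis S_grids : random_grids h M S_.
Hypothesis barN_point : forall l, point_process (barN l).
Hypothesis S_generated : generated_by h M S_ barN.
Variables (c1 c2 cm : R).
Hypotheses (c1_gt0 : 0 < c1) (c2_gt0 : 0 < c2).
Hypothesis mixing : mixing_with P barN c1 c2.
Hypothesis stationary : stationary_increments P barN.
Hypothesis cm0 : 0 <= cm.
Hypothesis unit_tail : unit_tail_bound P barN cm.

Lemma h_small e : 0 < e -> exists n0, forall n, (n0 <= n)%N -> (1 <= n)%N -> h n <= e.
Proof.
move=> e0; have [n0 _ hn0] := (cvgrPdist_le _ _).1 h_cvg0 e e0.
by exists n0 => n nn n1; have := hn0 n nn; rewrite sub0r normrN => /(le_trans (ler_norm _)).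
Qed.

Lemma cell_ends (hn x : R) b : 0 < hn -> (0 < b)%N -> 0 <= x ->
  ((first_cell hn x b).-1 * b)%:R * hn <= x < (first_cell hn x b * b)%:R * hn.
Proof.
move=> h0 b0 x0; have u0 : 0 < hn * b%:R by rewrite mulr_gt0 // ltr0n.
have /andP[x1 x2] := truncn_itv (divr_ge0 x0 (ltW u0)).
rewrite /first_cell /=; rewrite ler_pdivlMr // in x1; rewrite ltr_pdivrMr // in x2.
by rewrite !natrM -!mulrA ![b%:R * hn]mulrC x1 x2.
Qed.

Lemma last_cellE (hn x : R) b : last_cell hn x b = (first_cell hn x b).-1.
Proof. by []. Qed.

(** What the two ends of a window contribute: the cells containing them. *)
Lemma window_ends n l al be b w : (1 <= n)%N -> (0 < b)%N -> 0 <= al -> al < be -> be <= horizon h n ->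
  let j0 := first_cell (h n) al b in let j1 := last_cell (h n) be b in
  let v0 := obs_process M S_ n l al w in let v1 := obs_process M S_ n l be w in
  [/\ (barN l (j0 * b)%:R w <= v0 + cell_incr barN b l j0.-1 w)%N,
      (v1 <= barN l (j1 * b)%:R w + (cell_incr barN b l j1 w).+1)%N,
      (v0 <= barN l (j0 * b)%:R w)%N
    & (barN l (j1 * b)%:R w <= v1)%N].
Proof.
move=> n1 b0 al0 albe beT j0 j1 v0 v1; have hn := h_gt0 n1.
have be0 : 0 <= be by apply: le_trans al0 (ltW albe).
have /andP[a1 a2] := cell_ends hn b0 al0; have /andP[z1 z2] := cell_ends hn b0 be0.
rewrite -/j0 in a1 a2; rewrite -last_cellE -/j1 in z1.
have j1S : first_cell (h n) be b = j1.+1 by [].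
have j0S : j0.-1.+1 = j0 by [].
have alT : al < horizon h n by apply: lt_le_trans beT.
rewrite j1S in z2; rewrite /cell_incr /incr j0S.
have low0 := obs_low h_gt0 S_grids barN_point S_generated l w n1 (ler0n _ _) a1 (ltW alT).
have [_ /(_ alT) high0] := obs_high h_gt0 S_grids barN_point S_generated l w n1 al0 (ltW a2).
have low1 := obs_low h_gt0 S_grids barN_point S_generated l w n1 (ler0n _ _) z1 beT.
have [high1 _] := obs_high h_gt0 S_grids barN_point S_generated l w n1 be0 (ltW z2).
rewrite -/v0 in low0 high0; rewrite -/v1 in low1 high1.
have m0 : (barN l (j0.-1 * b)%:R w <= barN l (j0 * b)%:R w)%N.
  by apply: barN_homo => //; rewrite ler_nat leq_mul2r leq_pred orbT.
have m1 : (barN l (j1 * b)%:R w <= barN l (j1.+1 * b)%:R w)%N.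
  by apply: barN_homo => //; rewrite ler_nat leq_mul2r leqnSn orbT.
split => //.
  by rewrite -[leqLHS](subnKC m0) leq_add2r.
by rewrite addnS subnKC.
Qed.

Lemma sampled_block_vs_cells p n al be b r w : (1 <= n)%N -> (0 < b)%N -> 0 <= al -> al < be -> be <= horizon h n ->
  let j0 := first_cell (h n) al b in let j1 := last_cell (h n) be b in
  `|sampled_block M S_ barN p n al be r w - window_sum (cell_rv barN p r b) j0 (j1 - j0) w|
  <= ((cell_incr barN b ix1 j0.-1 w).+1 + (cell_incr barN b ix1 j1 w).+1 + 1
      + (4 * p.+1 + 1) * (j1 - j0).+1)%:R.
Proof.
move=> n1 b0 al0 albe beT; lazy zeta.
set j0 := first_cell _ _ _; set j1 := last_cell _ _ _; have hn := h_gt0 n1.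
have be0 : 0 <= be by apply: le_trans al0 (ltW albe).
have [e1 e2 e3 e4] := window_ends ix1 w n1 b0 al0 albe beT.
have /andP[_ a2] := cell_ends hn b0 al0; have /andP[z1 _] := cell_ends hn b0 be0.
have alT : al < horizon h n by apply: lt_le_trans beT.
apply: (trace_vs_cells barN_point) => //.
- rewrite mulnA leq_mul2r /=; rewrite -(ler_nat R) -(ler_pM2r hn).
  by apply: le_trans beT; exact: z1.
- by apply: (leq_ltn_trans e1); rewrite addnS ltnS.
- move=> x /andP[x0 x1].
  have xlow : (j0 * b)%:R <= x%:R / r.+1%:R :> R.
    by rewrite ler_pdivlMr // -natrM ler_nat -mulnA.
  have xhigh : x%:R / r.+1%:R <= (j1 * b)%:R :> R.
    by rewrite ler_pdivrMr // -natrM ler_nat -mulnA ltnW.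
  apply/andP; split.
    apply: leq_trans e3 _; rewrite /sampled_path; exact: barN_homo.
  by apply: leq_trans e4; rewrite /sampled_path; apply: barN_homo => //; rewrite divr_ge0.
Qed.

Lemma window_sum_incr b l j0 J w :
  window_sum (cell_incr barN b l) j0 J w =
  (barN l ((j0 + J) * b)%:R w)%:R - (barN l (j0 * b)%:R w)%:R :> R.
Proof.
rewrite /window_sum; elim: J => [|J IH]; first by rewrite addn0 subrr big_geq.
rewrite addnS big_nat_recr ?leq_addr //= IH /cell_incr /incr natrB; first by rewrite addrC subrKA.
by apply: barN_homo => //; rewrite ler_nat leq_mul2r leqnSn orbT.
Qed.

Lemma count_vs_cells n l al be w : (1 <= n)%N -> 0 <= al -> al < be -> be <= horizon h n ->
  let j0 := first_cell (h n) al 1 in let j1 := last_cell (h n) be 1 in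
  `|(block_count (grid_size M n w) (grid S_ n w) l al be)%:R - window_sum (cell_incr barN 1 l) j0 (j1 - j0) w|
  <= (cell_incr barN 1 l j0.-1 w).+1%:R + (cell_incr barN 1 l j1 w).+1%:R :> R.
Proof.
move=> n1 al0 albe beT; lazy zeta.
set j0 := first_cell _ _ _; set j1 := last_cell _ _ _.
have [e1 e2 e3 e4] := window_ends l w n1 (ltn0Sn 0) al0 albe beT.
rewrite -/j0 -/j1 in e1 e2 e3 e4.
have tg := grids_ok S_grids w n1.
rewrite (block_countE tg) -/(obs_process M S_ n l be w) -/(obs_process M S_ n l al w).
have vv : (obs_process M S_ n l al w <= obs_process M S_ n l be w)%N by apply: obs_homo (ltW albe).
rewrite window_sum_incr -natrD.
set v0 := obs_process M S_ n l al w in e1 e3 vv *; set v1 := obs_process M S_ n l be w in e2 e4 vv *.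
set Y0 := cell_incr _ _ _ j0.-1 _ in e1 *; set Y1 := cell_incr _ _ _ j1 _ in e2 *.
have [jj|jj] := leqP j0 j1.
  rewrite subnKC // natrB //.
  set B0 := barN _ _ _ in e1 e3 *; set B1 := barN _ _ _ in e2 e4 *.
  have f1 : B0%:R <= v0%:R + Y0%:R :> R by rewrite -natrD ler_nat.
  have f2 : v1%:R <= B1%:R + Y1.+1%:R :> R by rewrite -natrD ler_nat.
  have f3 : v0%:R <= B0%:R :> R by rewrite ler_nat.
  have f4 : B1%:R <= v1%:R :> R by rewrite ler_nat.
  have g0 : 0 <= Y0%:R :> R by []. 
  rewrite natrD -[Y0.+1%:R]natr1 -[Y1.+1%:R]natr1; rewrite -[Y1.+1%:R]natr1 in f2.
  rewrite ler_norml; apply/andP; split; lra.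
have -> : (j1 - j0 = 0)%N by lia.
rewrite addn0 subrr subr0 ger0_norm // ler_nat.
have jE : j0.-1 = j1.
  have b1 : (j1 <= j0.-1)%N by lia.
  have b2 : (j0.-1 <= j1)%N.
    by rewrite /j0 /j1 /first_cell /last_cell /=; apply: le_truncn; rewrite ler_pM2r ?ltW // invr_gt0 mulr1 h_gt0.
  by apply/eqP; rewrite eqn_leq b1 b2.
have : barN l (j1 * 1)%:R w = barN l (j0.-1 * 1)%:R w by rewrite jE.
move: e1; rewrite /Y0 /cell_incr /incr.
have -> : j0.-1.+1 = j0 by [].
have : (barN l (j0.-1 * 1)%:R w <= barN l (j0 * 1)%:R w)%N.
  by apply: barN_homo => //; rewrite ler_nat leq_mul2r leq_pred orbT.
lia.
Qed.

Lemma count_measurable l : window_measurable M S_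
  (fun n m t x y => h n * (block_count m t l x y)%:R).
Proof.
move=> n x y n1 x0 xy.
apply: measurable_funM; first exact: measurable_cst.
apply: discrete_measurable.
have dO z : 0 <= z -> discrete_in measurable (obs_process M S_ n l z).
  by move=> z0; apply: (discrete_obs h_gt0 S_grids barN_point S_generated).
have -> : (fun w => (block_count (grid_size M n w) (grid S_ n w) l x y)%:R : R) =
  (fun z : nat * nat => (z.1 - z.2)%N%:R) \o (fun w => (obs_process M S_ n l y w, obs_process M S_ n l x w)).
  by apply/funext => w /=; rewrite (block_countE (grids_ok S_grids w n1)).
apply: discrete_comp; apply: discrete_pair; first exact: sigma_algebra_measurable.
  by apply: dO; exact: le_trans xy.
exact: dO.
Qed.

Lemma count_window l : window_small P h M S_
  (fun n m t x y => h n * (block_count m t l x y)%:R) (rv_mean P (cell_incr barN 1 l)).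
Proof.
move=> e e0; set a := rv_mean P _; have wm := cell_incr_well_mixing barN_point c1_gt0 c2_gt0 mixing stationary cm0 unit_tail l (ltn0Sn 0).
have [m1 m2 m3 m4 m5] := wm.
have a0 : 0 <= a by rewrite /a rv_mean_ge0.
have [n0 hn0] : exists n0, forall n, (n0 <= n)%N -> (1 <= n)%N -> h n <= e / (20 * (a + 1)).
  by apply: h_small; rewrite divr_gt0 // mulr_gt0 //; lra.
set k := tail_cst cm 1 in wm.
exists (100 * var_cst c1 c2 k / e ^+ 2 + 20 * tail_cst cm 1 ^+ 3 / e), n0; split.
  have v0 : 0 <= var_cst c1 c2 k by exact: var_cst_ge0.
  have t0 : 0 <= tail_cst cm 1 by exact: tail_cst_ge0.
  apply: addr_ge0; first by apply: divr_ge0; [exact: mulr_ge0|rewrite exprn_ge0 // ltW].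
  by apply: divr_ge0; [rewrite mulr_ge0 // exprn_ge0|exact: ltW].
move=> n x y nn n1 x0 xy xy1 yT; have hn := h_gt0 n1.
have mF := count_measurable l n1 x0 (ltW xy).
have mF' : measurable_fun [set: T] (fun w => (block_count (grid_size M n w) (grid S_ n w) l x y)%:R : R).
  have -> : (fun w => (block_count (grid_size M n w) (grid S_ n w) l x y)%:R : R) =
    (fun w => (h n)^-1 * (h n * (block_count (grid_size M n w) (grid S_ n w) l x y)%:R)).
    by apply/funext => w; rewrite mulrA mulVf ?mul1r // gt_eqF.
  by apply: measurable_funM => //; exact: measurable_cst.
rewrite mulrDl.
have -> : ((100 * var_cst c1 c2 k / e ^+ 2 * h n + 20 * tail_cst cm 1 ^+ 3 / e * h n)%:E =
  P set0 + (100 * var_cst c1 c2 k / e ^+ 2 * h n + 20 * tail_cst cm 1 ^+ 3 / e * h n)%:E)%E.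
  by rewrite measure0 add0e.
apply: (@window_deviation _ _ _ P barN barN_point c1 c2 cm c1_gt0 c2_gt0 stationary cm0 unit_tail
   (h n) x y e a 0 1 l (cell_incr barN 1 l) k _ set0) => //.
- by move=> w _; rewrite mul0r addr0; exact: count_vs_cells.
- by rewrite divr1 subrr normr0 divr_ge0 // ltW.
- by rewrite mul0r divr_ge0 // ltW.
- rewrite add0r mulr1; apply: (@le_trans _ _ (e / (20 * (a + 1)) * (2 * a))).
    by rewrite ler_wpM2r ?mulr_ge0 // hn0.
  rewrite mulrAC ler_pdivrMr ?mulr_gt0 //; last by lra.
  have -> : e / 10 * (20 * (a + 1)) = e * (2 * a) + 2 * e by field.
  by rewrite lerDl mulr_ge0 // ltW.
Qed.

Lemma trace_measurable p : window_measurable M S_ (fun n m t x y => h n * block_trace m t p.+1 x y).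
Proof.
move=> n x y n1 x0 xy; apply: measurable_funM; first exact: measurable_cst.
by apply: (measurable_block_trace h_gt0 S_grids barN_point S_generated) => //; exact: le_trans xy.
Qed.

(** The cells are taken long enough for the errors per cell to be negligible, and
the resolution is chosen last, depending on [n]: fine enough for the sampled
trace to be within one of the trace, and such that the density is close to [a]. *)
Lemma trace_window p a : 0 <= a ->
  (forall e, 0 < e -> forall r0, exists2 r, (r0 <= r)%N & `|mean_density P barN p r - a| < e) ->
  window_small P h M S_ (fun n m t x y => h n * block_trace m t p.+1 x y) a.
Proof.
move=> a0 cl e e0; pose Cp : R := additivity_cst p; pose C1 : R := (4 * p + 7)%:R.
have Cp0 : 0 <= Cp by rewrite /Cp /additivity_cst.
have C10 : 0 < C1 by rewrite /C1 ltr0n; lia.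
pose b := (Num.truncn (20 * (C1 + Cp) / e)).+1.
have b0 : (0 < b)%N by [].
have b0' : 0 < b%:R :> R by rewrite ltr0n.
have bE : 20 * (C1 + Cp) <= e * b%:R.
  by rewrite [e * _]mulrC -ler_pdivrMr //; apply: ltW; exact: truncnS_gt.
have Cb : C1 / b%:R <= e / 10 by rewrite ler_pdivrMr //; lra.
have Cpb : Cp / b%:R <= e / 20 by rewrite ler_pdivrMr //; lra.
have D0 : 0 < C1 + 2 * a * b%:R by rewrite ltr_wpDr // !mulr_ge0 // ltW.
have [n0 hn0] : exists n0, forall n, (n0 <= n)%N -> (1 <= n)%N -> h n <= e / 10 / (C1 + 2 * a * b%:R).
  by apply: h_small; rewrite !divr_gt0.
set k := tail_cst cm b; have k0 : 0 <= k by exact: tail_cst_ge0.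
exists (1 + (100 * var_cst c1 c2 k / e ^+ 2 + 20 * tail_cst cm b ^+ 3 / e)), n0; split.
  have v0 : 0 <= var_cst c1 c2 k by exact: var_cst_ge0.
  apply: addr_ge0 => //; apply: addr_ge0.
    by apply: divr_ge0; [exact: mulr_ge0|rewrite exprn_ge0 // ltW].
  by apply: divr_ge0; [rewrite mulr_ge0 // exprn_ge0|exact: ltW].
move=> n x y nn n1 x0 xy xy1 yT; have hn := h_gt0 n1.
have y0 : 0 <= y by exact: le_trans (ltW xy).
pose F w := block_trace (grid_size M n w) (grid S_ n w) p.+1 x y.
have mF : measurable_fun [set: T] F by exact: (measurable_block_trace h_gt0 S_grids barN_point S_generated).
have mFr r : measurable_fun [set: T] (sampled_block M S_ barN p n x y r).
  exact: (measurable_sampled_block h_gt0 S_grids barN_point S_generated).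
have cvF w : sampled_block M S_ barN p n x y r w @[r --> \oo] --> F w.
  exact: (sampled_block_cvg h_gt0 S_grids S_generated).
have [r1 hr1] := prob_dev_small P mFr mF cvF hn.
have [r rr ra] := cl (e / 20) (divr_gt0 e0 (ltr0n _ 20)) (maxn r1 (Num.truncn (20 * Cp / e))).
rewrite geq_max in rr; have /andP[rr1 rr2] := rr.
have Cr : Cp / r.+1%:R <= e / 20.
  rewrite ler_pdivrMr //.
  have : 20 * Cp <= e * r.+1%:R.
    rewrite [e * _]mulrC -ler_pdivrMr //; apply: ltW; apply: lt_le_trans (truncnS_gt _) _.
    by rewrite ler_nat ltnS.
  lra.
have wm := cell_rv_well_mixing barN_point c1_gt0 c2_gt0 mixing stationary cm0 unit_tail p r b0.
pose G := [set w | 1 < `|sampled_block M S_ barN p n x y r w - F w|].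
have mG : measurable G by apply: measurable_norm_gt; exact: measurable_funB.
apply: (@le_trans _ _ (P G + (100 * var_cst c1 c2 k / e ^+ 2 * h n + 20 * tail_cst cm b ^+ 3 / e * h n)%:E)%E); last first.
  apply: (le_trans (leeD (hr1 r rr1) (lexx _))).
  rewrite -EFinD lee_fin; set u := _ / e ^+ 2; set v := _ / e.
  by rewrite [leRHS](_ : _ = h n + (u * h n + v * h n)) ?lexx //; ring.
apply: (@window_deviation _ _ _ P barN barN_point c1 c2 cm c1_gt0 c2_gt0 stationary cm0 unit_tail
   (h n) x y e a C1 b ix1 (cell_rv barN p r b) k _ G) => //.
- move=> w nG; rewrite -/(F w); set S := window_sum _ _ _ _.
  have FG : `|sampled_block M S_ barN p n x y r w - F w| <= 1.
    by rewrite leNgt; apply/negP => hG; apply: nG.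
  have FS := sampled_block_vs_cells p r w n1 b0 x0 xy yT.
  rewrite -/S in FS.
  rewrite -(subrK (sampled_block M S_ barN p n x y r w) (F w)) -addrA.
  apply: le_trans (ler_normD _ _) _; rewrite distrC.
  apply: le_trans (lerD FG FS) _.
  rewrite /C1 -natrM -!natrD -(natrD _ 1) ler_nat.
  exact: window_error_bound.
- have hx : `|rv_mean P (cell_rv barN p r b) / b%:R - mean_density P barN p r| <= Cp / b%:R + Cp / r.+1%:R.
    exact: (cell_mean_ratio barN_point c1_gt0 c2_gt0 mixing stationary cm0 unit_tail).
  rewrite -(subrK (mean_density P barN p r) (rv_mean P _ / _)) -addrA.
  apply: le_trans (ler_normD _ _) _; apply: (le_trans (lerD hx (ltW ra))).
  apply: (le_trans (lerD (lerD Cpb Cr) (lexx _))).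
  have -> : e / 5 = e / 20 + e / 20 + e / 20 + e / 20 by field.
  by rewrite lerDl divr_ge0 // ltW.
- by rewrite -ler_pdivlMr // hn0.
Qed.
End WindowEstimates.

(** * Mesh, quadratic forms, tightness and intensity *)

Section Conditions.
Context {d : measure_display} {T : measurableType d} {R : realType}.
Variables (P : probability T R) (h : nat -> R).
Variables (M : nat -> 'I_2 -> T -> nat) (S_ : nat -> 'I_2 -> nat -> T -> R).
Variable barN : 'I_2 -> R -> T -> nat.
Hypothesis h_gt0 : forall n, (1 <= n)%N -> 0 < h n.
Hypothesis h_cvg0 : h n @[n --> \oo] --> (0 : R).
Hypothesis nh2_cvg0 : n%:R * h n ^+ 2 @[n --> \oo] --> (0 : R).
Hypothesis S_grids : random_grids h M S_.
Hypothesis barN_point : forall l, point_process (barN l).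
Hypothesis S_generated : generated_by h M S_ barN.
Hypothesis stationary : stationary_increments P barN.

Lemma discrete_size n l : (1 <= n)%N -> discrete_in measurable (M n l).
Proof. by move=> n1; apply/discrete_natP; have [] := S_grids n1 l. Qed.

(** Observation times are measurable only where they exist; hence the restriction
to the realizations with more than [i] intervals. *)
Lemma measurable_gap n l i e : (1 <= n)%N ->
  measurable [set w | (i < M n l w)%N /\ e < S_ n l i.+1 w - S_ n l i w].
Proof.
move=> n1; have [_ mS _] := S_grids n1 l.
pose D := [set w | (i.+1 <= M n l w)%N].
have mD : measurable D by exact: (discrete_size l n1 [set k | (i < k)%N]).
have mDi : measurable [set w | (i <= M n l w)%N] by exact: (discrete_size l n1 [set k | (i <= k)%N]).
have mf : measurable_fun D (fun w => S_ n l i.+1 w - S_ n l i w).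
  apply: measurable_funB; first exact: mS.
  by apply: (measurable_funS mDi) (mS i) => w; exact: ltnW.
have -> : [set w | (i < M n l w)%N /\ e < S_ n l i.+1 w - S_ n l i w] =
    D `&` (fun w => S_ n l i.+1 w - S_ n l i w) @^-1` `]e, +oo[%classic.
  by apply/seteqP; split=> w /=; rewrite in_itv /= andbT.
exact: mf.
Qed.

Lemma mesh_set n e : (1 <= n)%N -> 0 <= e ->
  [set w | e < mesh (grid_size M n w) (grid S_ n w)] =
  \bigcup_i ([set w | (i < M n ix1 w)%N /\ e < S_ n ix1 i.+1 w - S_ n ix1 i w] `|`
             [set w | (i < M n ix2 w)%N /\ e < S_ n ix2 i.+1 w - S_ n ix2 i w]).
Proof.
move=> n1 e0; apply/seteqP; split=> w /=.
  move=> /(mesh_gtP e0) [l [i [im]]]; rewrite (len_itvE (grids_ok S_grids w n1)) // => hi.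
  by exists i => //; have [lE|lE] := ix_cases l; [left|right]; rewrite lE in im hi.
move=> [i _ [[im hi]|[im hi]]].
- by apply: lt_le_trans hi _; rewrite -(len_itvE (grids_ok S_grids w n1)) //; exact: (@len_le_mesh _ (grid_size M n w) (grid S_ n w) ix1 i im).
- by apply: lt_le_trans hi _; rewrite -(len_itvE (grids_ok S_grids w n1)) //; exact: (@len_le_mesh _ (grid_size M n w) (grid S_ n w) ix2 i im).
Qed.

Lemma measurable_mesh_set n e : (1 <= n)%N -> 0 <= e ->
  measurable [set w | e < mesh (grid_size M n w) (grid S_ n w)].
Proof.
move=> n1 e0; rewrite mesh_set //; apply: bigcup_measurable => i _.
by apply: measurableU; exact: measurable_gap.
Qed.

Lemma mesh_ge0 n w : 0 <= mesh (grid_size M n w) (grid S_ n w).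
Proof. by rewrite /mesh; apply: bigmax_ge_id. Qed.

(** A gap contains a whole cell of any length up to half of its own. *)
Lemma gap_empty_cell n v e w : (1 <= n)%N -> (0 < v)%N -> 0 <= e -> 2 * v%:R * h n <= e ->
  e < mesh (grid_size M n w) (grid S_ n w) ->
  exists l j, (j < n)%N /\ cell_incr barN v l j w = 0%N.
Proof.
move=> n1 v0 e0 ve /(mesh_gtP e0) [l [i [im]]].
have tg := grids_ok S_grids w n1; have hn := h_gt0 n1.
rewrite (len_itvE tg) // => hi; exists l.
set t := grid S_ n w l in hi.
have ti0 : 0 <= t i by apply: (grid_ge0 tg); exact: ltnW.
have tT : t i.+1 <= horizon h n by exact: (grid_leT tg).
pose j := first_cell (h n) (t i) v.
have /andP[j1 j2] := cell_ends hn v0 ti0; rewrite -/j in j1 j2.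
have jS : (j.+1 * v)%:R * h n < t i.+1.
  have -> : (j.+1 * v)%:R = (j.-1 * v)%:R + 2 * v%:R :> R.
    by rewrite -[j.+1]/(j.-1.+2) !natrM -!natr1; ring.
  by rewrite mulrDl; lra.
have jle : (j * v)%:R * h n <= (j.+1 * v)%:R * h n.
  by rewrite ler_pM2r // ler_nat leq_mul2r leqnSn orbT.
have val c : (c * v)%:R * h n < t i.+1 -> t i <= (c * v)%:R * h n -> barN l (c * v)%:R w = i.
  move=> c1 c2; have cT : (c * v)%:R * h n < horizon h n by apply: lt_le_trans tT.
  rewrite -(obs_scaled h_gt0 S_generated l w n1) //; last by rewrite -(ltr_pM2r hn).
  apply/eqP; rewrite /obs_process (obs_count_eq tg) //; first by rewrite c2 c1.
  by rewrite mulr_ge0 // ltW.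
exists j; split.
  have : (j.+1 * v)%:R * h n < n%:R * h n by apply: lt_le_trans tT.
  rewrite ltr_pM2r // ltr_nat; apply: leq_trans; rewrite ltnS.
  by apply: leq_trans (leqnSn _) _; rewrite leq_pmulr.
have b1 : barN l (j * v)%:R w = i.
  by apply: val; [exact: le_lt_trans jS|exact: ltW].
have b2 : barN l (j.+1 * v)%:R w = i.
  by apply: val => //; exact: le_trans (ltW j2) jle.
by rewrite /cell_incr /incr b1 b2 subnn.
Qed.

Section Void.
Variables (cv : R) (n0 : nat).
Hypothesis void : void_bound P barN cv n0.

(** Take cells of about half the length [e], that is [v] of order [1 / h n]: one
of [n] cells is empty with probability at most of order [n / v ^ 2]. *)
Lemma mesh_bound e : 0 < e -> exists C n1, forall n, (n1 <= n)%N -> (1 <= n)%N ->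
  (P [set w | (e < mesh (grid_size M n w) (grid S_ n w))%R] <= (C * (n%:R * h n ^+ 2))%:E)%E.
Proof.
move=> e0.
have [n1 hn1] := h_small h_cvg0 (divr_gt0 e0 (ltr0n _ (4 * n0.+1)) : 0 < e / (4 * n0.+1)%:R).
exists (32 * `|cv| / e ^+ 2), n1 => n nn n1'; have hn := h_gt0 n1'.
have hs := hn1 n nn n1'.
pose v := Num.truncn (e / (2 * h n)).
have x0 : 0 <= e / (2 * h n) by rewrite divr_ge0 ?mulr_ge0 // ltW.
have /andP[v1 v2] := truncn_itv x0; rewrite -/v in v1 v2.
have h2 : 0 < 2 * h n by rewrite mulr_gt0.
rewrite ler_pdivlMr // in v1; rewrite ltr_pdivrMr // -natr1 in v2.
have hs' : h n * (4 * n0.+1)%:R <= e by rewrite -ler_pdivlMr // ltr0n.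
have vn : (n0.+1 <= v)%N.
  suff : n0.+1%:R < v%:R + 1 :> R by rewrite natr1 ltr_nat ltnS.
  rewrite -(ltr_pM2r h2); apply: le_lt_trans v2; apply: le_trans hs'.
  rewrite natrM; set N : R := n0.+1%:R.
  have -> : h n * (4%:R * N) = N * (2 * h n) + h n * (2 * N) by ring.
  by rewrite lerDl mulr_ge0 ?(ltW hn) // mulr_ge0.
have v0 : (0 < v)%N by apply: leq_trans vn.
have vbig : e / (4 * h n) <= v%:R.
  have v1' : 1 <= v%:R :> R by rewrite ler1n.
  rewrite ler_pdivrMr ?mulr_gt0 //; apply: (le_trans (ltW v2)).
  have -> : v%:R * (4 * h n) = (v%:R + 1) * (2 * h n) + (v%:R - 1) * (2 * h n) by ring.
  by rewrite lerDl mulr_ge0 ?(ltW h2) // subr_ge0.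
pose A l j := [set w | cell_incr barN v l j w = 0%N].
have mA l j : measurable (A l j) by exact: (discrete_cell_incr barN_point v l j [set 0%N]).
pose B j := A ix1 j `|` A ix2 j.
have mB j : measurable (B j) by exact: measurableU.
have sub : [set w | e < mesh (grid_size M n w) (grid S_ n w)] `<=` \big[setU/set0]_(j < n) B j.
  move=> w /= hw; have [|l [j [jn jA]]] := gap_empty_cell n1' v0 (ltW e0) _ hw.
    by rewrite mulrAC [2 * _ * _]mulrC.
  rewrite -(bigcup_mkord _ B); exists j => //=.
  by have [lE|lE] := ix_cases l; [left|right]; rewrite lE in jA.
apply: (@le_trans _ _ (P (\big[setU/set0]_(j < n) B j))).
  apply: le_measure; rewrite ?inE //; first by apply: measurable_mesh_set => //; exact: ltW.
  exact: bigsetU_measurable.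
apply: (le_trans (@Boole_inequality _ _ _ P B n (fun j _ => mB j))).
apply: (@le_trans _ _ (\sum_(j < n) (2 * (`|cv| / v%:R ^+ 2))%:E)%E).
  apply: lee_sum => j _; apply: (le_trans (measureU2 P (mA _ _) (mA _ _))).
  have PA l : (P (A l j) <= (`|cv| / v%:R ^+ 2)%:E)%E.
    apply: (le_trans (cell_void barN_point stationary void l j (ltnW vn) v0)); rewrite lee_fin ler_wpM2r ?ler_norm //.
  apply: (le_trans (leeD (PA _) (PA _))); rewrite -EFinD lee_fin; lra.
rewrite sumEFin lee_fin sumr_const card_ord -[leLHS]mulr_natl.
have vi : (v%:R ^+ 2)^-1 <= 16 * h n ^+ 2 / e ^+ 2.
  have -> : 16 * h n ^+ 2 / e ^+ 2 = ((e / (4 * h n)) ^+ 2)^-1.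
    by field; rewrite !gt_eqF.
  have q0 : 0 < e / (4 * h n) by rewrite divr_gt0 // mulr_gt0.
  rewrite lef_pV2 ?posrE ?exprn_gt0 ?ltr0n //.
  by rewrite lerXn2r // ?nnegrE // ltW.
have -> : 32 * `|cv| / e ^+ 2 * (n%:R * h n ^+ 2) = n%:R * (2 * (`|cv| * (16 * h n ^+ 2 / e ^+ 2))).
  by field; rewrite gt_eqF.
by rewrite !ler_wpM2l.
Qed.

Lemma mesh_cvg : condA2 P M S_.
Proof.
move=> e e0; have [C [n1 hC]] := mesh_bound e0.
apply: (@squeeze_cvge _ _ _ _ (fun=> 0%E) _ (fun n => (C * (n%:R * h n ^+ 2))%:E)).
- exists (maxn n1 1) => // n /=; rewrite geq_max => /andP[nn n1'].
  rewrite measure_ge0 /=.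
  have -> : [set w | e < `|mesh (grid_size M n w) (grid S_ n w) - 0|] = [set w | e < mesh (grid_size M n w) (grid S_ n w)].
    by apply/seteqP; split=> w /=; rewrite subr0 ger0_norm ?mesh_ge0.
  exact: hC.
- exact: cvg_cst.
- apply: cvg_EFin; first by near=> n.
  rewrite -(mulr0 C); apply: cvgM => //; exact: cvg_cst.
Unshelve. all: by end_near. Qed.
End Void.

Lemma measurable_S_at n l (N : T -> nat) : (1 <= n)%N -> discrete_in measurable N ->
  (forall w, (N w <= M n l w)%N) -> measurable_fun [set: T] (fun w => S_ n l (N w) w).
Proof.
move=> n1 dN NM _ B mB; rewrite setTI; have [_ mS _] := S_grids n1 l.
have -> : (fun w => S_ n l (N w) w) @^-1` B =
  \bigcup_i (N @^-1` [set i] `&` ([set w | (i <= M n l w)%N] `&` S_ n l i @^-1` B)).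
  apply/seteqP; split=> w /=.
    by move=> Bw; exists (N w) => //; split => //; split => //; exact: NM.
  by move=> [i _ [<- [_]]].
apply: bigcup_measurable => i _; apply: measurableI; first exact: dN.
apply: mS => //; exact: (discrete_size l n1 [set k | (i <= k)%N]).
Qed.

(** A functional that sums the lengths of the intervals ending in the block is
within the mesh of the length of the block. *)
Lemma grid_block_cvg (F : window_functional) (l : 'I_2) s : condA2 P M S_ -> frakS s ->
  (forall n w x y, (1 <= n)%N -> x <= y -> F n (grid_size M n w) (grid S_ n w) x y =
     S_ n l (obs_process M S_ n l y w) w - S_ n l (obs_process M S_ n l x w) w) ->
  blocks_cvg P h M S_ s F 1.
Proof.
move=> A2 sS FE e e0.
have mF : window_measurable M S_ F.
  move=> n x y n1 x0 xy.
  have -> : (fun w => F n (grid_size M n w) (grid S_ n w) x y) =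
    (fun w => S_ n l (obs_process M S_ n l y w) w - S_ n l (obs_process M S_ n l x w) w).
    by apply/funext => w; exact: FE.
  apply: measurable_funB; apply: measurable_S_at => //.
  - by apply: (discrete_obs h_gt0 S_grids barN_point S_generated) => //; exact: le_trans xy.
  - by move=> w; exact: obs_count_le.
  - exact: (discrete_obs h_gt0 S_grids barN_point S_generated).
  - by move=> w; exact: obs_count_le.
apply: (@squeeze_cvge _ _ _ _ (fun=> 0%E) _ (fun n => P [set w | e < `|mesh (grid_size M n w) (grid S_ n w) - 0|])).
- exists 1%N => // n /= n1; rewrite measure_ge0 /=.
  have T0 : 0 <= horizon h n by rewrite ltW // horizon_gt0.
  have sq : s (qn h s n) <= horizon h n by apply: last_index_le.
  have mesh0 : [set w | e < `|mesh (grid_size M n w) (grid S_ n w) - 0|] = [set w | e < mesh (grid_size M n w) (grid S_ n w)].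
    by apply/seteqP; split=> w /=; rewrite subr0 ger0_norm ?mesh_ge0.
  rewrite mesh0; apply: le_measure; rewrite ?inE.
  + rewrite block_dev_set //; apply: bigsetU_measurable => k _.
    apply: measurable_window_dev => //; first exact: partition_ge0.
    exact: partition_homo.
  + by apply: measurable_mesh_set => //; exact: ltW.
  + move=> w /= /(block_devP _ _ _ _ e0) [k kq]; rewrite FE //; last exact: partition_homo.
    rewrite mul1r => /lt_le_trans; apply.
    apply: (block_len_dev (grids_ok S_grids w n1)); first exact: partition_ge0.
      exact: partition_homo.
    by apply: le_trans sq; apply: partition_homo.
- exact: cvg_cst.
- exact: A2.
Qed.

Lemma forms_cvg : condA2 P M S_ -> condA5 P h M S_ (fun=> 1) (fun=> 1) (fun=> 1).
Proof.
move=> A2 p; split => // s sS; split.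
- apply: (@grid_block_cvg _ ix1) => // n w x y n1 xy.
  exact: (block_form11E (grids_ok S_grids w n1)).
- apply: (@grid_block_cvg _ ix1) => // n w x y n1 xy.
  exact: (block_form12E (grids_ok S_grids w n1)).
- apply: (@grid_block_cvg _ ix2) => // n w x y n1 xy.
  exact: (block_form22E (grids_ok S_grids w n1)).
Qed.

Lemma h_bounded : exists2 H, 0 <= H & forall n, (1 <= n)%N -> h n <= H.
Proof.
have [n0 hn0] := h_small h_cvg0 ltr01.
exists (\sum_(i < n0) `|h i| + 1); first by rewrite addr_ge0 // sumr_ge0.
move=> n n1; have [nn|nn] := leqP n0 n.
  by apply: le_trans (hn0 n nn n1) _; rewrite lerDr sumr_ge0.
rewrite (bigD1 (Ordinal nn)) //= -addrA; apply: le_trans (ler_norm _) _.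
by rewrite lerDl addr_ge0 // sumr_ge0.
Qed.

Section Tight.
Variables (c1 c2 cm : R).
Hypotheses (c1_gt0 : 0 < c1) (c2_gt0 : 0 < c2).
Hypothesis mixing : mixing_with P barN c1 c2.
Hypothesis cm0 : 0 <= cm.
Hypothesis unit_tail : unit_tail_bound P barN cm.

(** The last block may end beyond the horizon, where nothing is observed; it is
covered by a window of unit length, whose count concentrates. *)
Lemma last_block_tight l s : frakS s ->
  tight P (fun n w => h n * (block_count (grid_size M n w) (grid S_ n w) l
          (s (qn h s n)) (s (qn h s n).+1))%:R).
Proof.
move=> sS eps eps0; have [H H0 hH] := h_bounded.
have wm := cell_incr_well_mixing barN_point c1_gt0 c2_gt0 mixing stationary cm0 unit_tail l (ltn0Sn 0).
set k := tail_cst cm 1 in wm; pose V := var_cst c1 c2 k.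
have V0 : 0 <= V by exact: var_cst_ge0.
set X := cell_incr barN 1 l in wm; set a := rv_mean P X.
have a0 : 0 <= a by rewrite /a rv_mean_ge0.
have U0 : 0 <= V * (1 + 2 * H) * H by apply: mulr_ge0 => //; apply: mulr_ge0 => //; rewrite addr_ge0 // mulr_ge0.
(* Chebyshev gives V * (1 + 2 * H) * H / Kp ^ 2, and Kp ^ 2 is at least Kp. *)
pose Kp := 1 + V * (1 + 2 * H) * H / eps.
have Kp1 : 1 <= Kp by rewrite /Kp lerDl divr_ge0 // ltW.
exists ((1 + 2 * H) * a + Kp + H) => n n1; have hn := h_gt0 n1; have hnH := hH n n1.
set x := s (qn h s n); set y := s (qn h s n).+1.
have x0 : 0 <= x by exact: partition_ge0.
have y0 : 0 <= y by exact: partition_ge0.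
have xT : x <= horizon h n by apply: last_index_le => //; rewrite ltW // horizon_gt0.
have xy1 : y <= x + 1 by have /andP[_] := partition_step sS (qn h s n); rewrite -/x -/y; lra.
pose j0 := Num.truncn (x / h n); pose j1 := (Num.truncn ((x + 1) / h n)).+1.
have x10 : 0 <= x + 1 by rewrite addr_ge0.
have /andP[p1 p2] := truncn_itv (divr_ge0 x0 (ltW hn)).
have /andP[p3 p4] := truncn_itv (divr_ge0 x10 (ltW hn)).
rewrite -/j0 ler_pdivlMr // in p1; rewrite -/j0 ltr_pdivrMr // -natr1 in p2.
rewrite ler_pdivlMr // in p3; rewrite ltr_pdivrMr // -/j1 in p4.
have j01 : (j0 <= j1)%N.
  rewrite -(ler_nat R) -(ler_pM2r hn); apply: ltW; apply: le_lt_trans p1 _.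
  by apply: le_lt_trans p4; lra.
pose J := (j1 - j0)%N.
have hJ : h n * J%:R <= 1 + 2 * H.
  rewrite natrB // mulrBr ![h n * _]mulrC /j1 -natr1; lra.
have cnt w : (block_count (grid_size M n w) (grid S_ n w) l x y)%:R <= window_sum X j0 J w + 1 :> R.
  rewrite (block_countE (grids_ok S_grids w n1)) -/(obs_process M S_ n l y w) -/(obs_process M S_ n l x w).
  rewrite /X window_sum_incr // subnKC // !muln1.
  have low := obs_low h_gt0 S_grids barN_point S_generated l w n1 (ler0n _ j0) p1 xT.
  have [high _] := obs_high h_gt0 S_grids barN_point S_generated l w n1 y0 (le_trans xy1 (ltW p4)).
  have mono : (barN l j0%:R w <= barN l j1%:R w)%N by apply: barN_homo => //; rewrite ler_nat.
  by rewrite -natrB // natr1 ler_nat -subSn //; exact: leq_sub high low.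
pose e := Kp / h n; have e0 : 0 < e by rewrite divr_gt0 //; lra.
have mC : measurable_fun [set: T] (fun w => h n * (block_count (grid_size M n w) (grid S_ n w) l x y)%:R).
  apply: (count_measurable h_gt0 S_grids barN_point S_generated l n1 x0).
  by apply: partition_homo.
have mB := measurable_norm_gt ((1 + 2 * H) * a + Kp + H) mC.
have [mX _ _ _ _] := wm.
have mW : measurable [set w | e <= `|window_sum X j0 J w - J%:R * a|].
  apply: measurable_norm_ge.
  by apply: measurable_funB; [exact: measurable_window_sum|exact: measurable_cst].
apply: (@le_trans _ _ (P [set w | e <= `|window_sum X j0 J w - J%:R * a|])).
  apply: le_measure; rewrite ?inE // => w /=.
  rewrite ger0_norm ?mulr_ge0 ?(ltW hn) // => big; rewrite leNgt; apply/negP => small.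
  move: big; apply/negP; rewrite -leNgt.
  have S1 : window_sum X j0 J w <= J%:R * a + e.
    by move: small; rewrite ltr_norml => /andP[_ h2]; lra.
  apply: (@le_trans _ _ (h n * (J%:R * a + e + 1))).
    by rewrite ler_pM2l //; apply: le_trans (cnt w) _; rewrite lerD2r.
  have -> : h n * (J%:R * a + e + 1) = (h n * J%:R) * a + Kp + h n.
    by rewrite /e; field; rewrite gt_eqF.
  by rewrite !lerD // ler_wpM2r.
apply: (le_trans (well_mixing_concentration c1_gt0 c2_gt0 wm j0 J e0)).
rewrite lee_fin -/V.
have -> : V * J%:R / e ^+ 2 = V * (h n * J%:R) * h n / Kp ^+ 2.
  by rewrite /e; field; rewrite !gt_eqF //; lra.
have Kp2 : 0 < Kp ^+ 2 by rewrite exprn_gt0 //; lra.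
rewrite ler_pdivrMr //; apply: (@le_trans _ _ (V * (1 + 2 * H) * H)).
  have t0 : 0 <= h n * J%:R by rewrite mulr_ge0 // ltW.
  apply: ler_pM => //; [by rewrite mulr_ge0|exact: ltW|by rewrite ler_wpM2l].
have KK : Kp <= Kp ^+ 2 by rewrite expr2 ler_peMr //; lra.
apply: (@le_trans _ _ (eps * Kp)); last by rewrite ler_pM2l.
have -> : eps * Kp = eps + V * (1 + 2 * H) * H by rewrite /Kp mulrDr mulr1 [X in _ + X]mulrC divfK ?gt_eqF.
by rewrite lerDr ltW.
Qed.

Section Intensity.
Variables (cv : R) (n0 : nat).
Hypothesis void : void_bound P barN cv n0.

(** The expected number of points in a long stretch is at least the probability
that it is not empty. *)
Lemma intensity_gt0 l : 0 < rv_mean P (cell_incr barN 1 l).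
Proof.
have [h1 h2 h3 h4 h5] := cell_incr_well_mixing barN_point c1_gt0 c2_gt0 mixing stationary cm0 unit_tail l (ltn0Sn 0).
have [u [u0 un0 uc]] := void_length cv n0 (ltac:(by rewrite invr_gt0) : 0 < 2^-1 :> R).
pose A := [set w | barN l u%:R w = 0%N].
have mA : measurable A by exact: (@discrete_barN _ _ _ _ barN_point l u%:R (ler0n _ _) [set 0%N]).
have PA : (P A <= (2^-1)%:E)%E.
  by apply: (le_trans (void l un0 u0)); rewrite lee_fin.
have IW := window_sum_mean h1 h2 h3 h4 0%N u.
have : (P (~` A) <= \int[P]_w (window_sum (cell_incr barN 1 l) 0 u w)%:E)%E.
  rewrite -[leLHS]/(P (~` A)) -[~` A]setIT -integral_indic //; last exact: measurableC.
  apply: ge0_le_integral => //.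
  - by apply/measurable_EFinP; apply: measurable_indic; exact: measurableC.
  - by apply/measurable_EFinP; exact: measurable_window_sum.
  move=> w _; rewrite lee_fin indicE window_sum_incr // add0n muln1 mul0n barN_start // subr0.
  have [/set_mem /= Aw|_] := boolP (w \in _); last by rewrite ler0n.
  by rewrite ler_nat lt0n; apply/eqP.
rewrite IW; have := @probability_setC _ _ _ P _ mA.
have fA : P A \is a fin_num by apply: fin_num_measure.
move=> ->; rewrite -(fineK fA) -EFinB !lee_fin in PA *.
have u0' : 0 < u%:R :> R by rewrite ltr0n.
move=> h6; rewrite -(pmulr_rgt0 _ u0'); lra.
Qed.
End Intensity.
End Tight.
End Conditions.

(** * Conclusion *)

Theorem corollary2p1 (d : measure_display) (T : measurableType d)
    (R : realType) (P : probability T R)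
    (h : nat -> R)
    (M : nat -> 'I_2 -> T -> nat) (S_ : nat -> 'I_2 -> nat -> T -> R)
    (barN : 'I_2 -> R -> T -> nat)
    (h_gt0 : forall n, (1 <= n)%N -> 0 < h n)
    (h_cvg0 : h n @[n --> \oo] --> (0 : R))
    (Tn_cvgy : horizon h n @[n --> \oo] --> +oo)
    (nh2_cvg0 : n%:R * h n ^+ 2 @[n --> \oo] --> (0 : R))
    (S_grids : random_grids h M S_)
    (barN_point : forall l, point_process (barN l))
    (barN_mixing : exp_alpha_mixing P barN)
    (barN_stationary : stationary_increments P barN)
    (S_generated : generated_by h M S_ barN)
    (HB1 : forall q : R, 0 < q -> condB1 P h M S_ q)
    (HB2 : forall q : R, 0 < q -> condB2 P h M S_ q) :
  condA2 P M S_ /\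
  (exists (a0 : 'I_2 -> R) (a : nat -> R),
     condA4 P h M S_ a0 a /\ 0 < a 1%N) /\
  (exists f11 f12 f22 : nat -> R, condA5 P h M S_ f11 f12 f22).
Proof.
have [c1 [c2 [c1_gt0 c2_gt0 mixing]]] := barN_mixing.
have [cm cm0 unit_tail] := unit_tail_of_moments h_gt0 barN_point S_generated (HB1 6 (ltr0n _ 6)).
have [cv [n0 void]] := void_of_limsup h_gt0 barN_point S_generated (HB2 2 (ltr0n _ 2)).
have A2 := mesh_cvg h_gt0 h_cvg0 nh2_cvg0 S_grids barN_point S_generated barN_stationary void.
split=> //; split; last by exists (fun=> 1), (fun=> 1), (fun=> 1); exact: (forms_cvg h_gt0 S_grids barN_point S_generated A2).
have cluster p := mean_density_cluster barN_point c1_gt0 c2_gt0 mixing barN_stationary cm0 unit_tail p.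
have [a aP] := choice cluster.
have a_pos : 0 < a 0%N.
  have [c c0 [r0 low]] := mean_density_lower barN_point c1_gt0 c2_gt0 mixing barN_stationary cm0 unit_tail void.
  have [_ cl] := aP 0%N; have [r rr ra] := cl c c0 r0.
  have := low r rr; move: ra; rewrite ltr_norml => /andP[h1 h2] h3; lra.
exists (fun l => rv_mean P (cell_incr barN 1 l)), (fun p => a p.-1); split => //.
split; first by move=> l; exact: (intensity_gt0 barN_point barN_stationary c1_gt0 c2_gt0 mixing cm0 unit_tail void).
split=> [l s sS|[//|p] _].
  split; first exact: (last_block_tight h_gt0 h_cvg0 S_grids barN_point S_generated barN_stationary c1_gt0 c2_gt0 mixing cm0 unit_tail).
  apply: (blocks_cvg_of_windows h_gt0 nh2_cvg0 sS).
    exact: (count_measurable h_gt0 S_grids barN_point S_generated).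
  exact: (count_window h_gt0 h_cvg0 S_grids barN_point S_generated c1_gt0 c2_gt0 mixing barN_stationary cm0 unit_tail).
have [ap0 cl] := aP p; split => // s sS.
apply: (blocks_cvg_of_windows h_gt0 nh2_cvg0 sS).
  exact: (trace_measurable h_gt0 S_grids barN_point S_generated).
exact: (trace_window h_gt0 h_cvg0 S_grids barN_point S_generated c1_gt0 c2_gt0 mixing barN_stationary cm0 unit_tail).
Qed.
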